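(* Let $n\ge1$ and $Q=n+2\ge3$. Let $k$ be an integer with $2\le k<Q$, and let $2\le p<\frac{Q}{k}$ and $\beta\in\mathbb{R}$. Then for any $u\in C_0^\infty(\mathbb{R}^{n+1}\setminus\{o\})$ there exists a positive constant $C$, depending only on $k$, $p$ and $\beta$, such that: (i) If $k=2l$ with $l\ge1$ and $-(2l-2)p-Q(p-1)<\beta<Q-2lp$, then $$\int_{\mathbb{R}^{n+1}}\frac{|\mathcal{L}_{\varrho,G}^{\,l}u(x,t)|^p}{|\nabla_G\varrho(x,t)|^{(2l-1)p}\varrho^\beta(x,t)}\,dx\,dt-C_{k,p,\beta}\int_{\mathbb{R}^{n+1}}\frac{|u(x,t)|^p|\nabla_G\varrho(x,t)|^p}{\varrho^{2lp+\beta}(x,t)}\,dx\,dt\ \ge\ C\sup_{R>0}d_R(u,k,\beta)^2.$$ (ii) If $k=2l+1$ with $l\ge1$ and $-(2l-1)p-Q(p-1)<\beta<Q-(2l+1)p$, then $$\int_{\mathbb{R}^{n+1}}\frac{|\nabla_{\varrho,G}\mathcal{L}_{\varrho,G}^{\,l}u(x,t)|^p}{|\nabla_G\varrho(x,t)|^{2lp}\varrho^\beta(x,t)}\,dx\,dt-C_{k,p,\beta}\int_{\mathbb{R}^{n+1}}\frac{|u(x,t)|^p|\nabla_G\varrho(x,t)|^p}{\varrho^{(2l+1)p+\beta}(x,t)}\,dx\,dt\ \ge\ C\sup_{R>0}d_R(u,k,\beta)^2.$$ In each case the constant $C_{k,p,\beta}$ is best possible.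
   Context: Grushin space $G=\mathbb{R}^{n+1}$: points $(x,t)$ with $x\in\mathbb{R}^n$, $t\in\mathbb{R}$; origin $o=(\vec 0,0)$; homogeneous dimension $Q=n+2$; homogeneous norm $\varrho(x,t)=(|x|^4+4t^2)^{1/4}$; Grushin gradient $\nabla_G=(\nabla_x,|x|\partial_t)$, so that $|\nabla_G\varrho|^2=|x|^2/\varrho^2=:\psi$ away from $o$. Polar coordinates $(\varrho,\phi,w)$: $x=\varrho\sin^{1/2}\!\phi\;w$, $w\in\mathbb{S}^{n-1}$, $t=\frac{\varrho^2}{2}\cos\phi$, $0<\phi<\pi$. $\partial_\varrho$ is the partial derivative in $\varrho$ in these coordinates, i.e. $\partial_\varrho u=\frac1\varrho(x\cdot\nabla_xu+2t\,\partial_tu)$. Radial operators: $\nabla_{\varrho,G}u=\psi^{1/2}(\partial_\varrho u,0,0)$, so $|\nabla_{\varrho,G}u|=\psi^{1/2}|\partial_\varrho u|$, and $\mathcal{L}_{\varrho,G}u=\psi\big(\partial_\varrho^2u+\frac{Q-1}{\varrho}\partial_\varrho u\big)$; $\mathcal{L}_{\varrho,G}^{\,l}$ is the $l$-fold iterate. $C_0^\infty$ denotes smooth compactly supported real-valued functions. Constants: $\Lambda_1(Q,p,\beta)=\big(\frac{Q-p-\beta}{p}\big)^p$; for integers $k\ge2$, $\Lambda_k(Q,p,\beta)=\Big(\frac{(Q(p-1)+\beta+(k-2)p)(Q-\beta-kp)}{p^2}\Big)^p$; $C_{2l,p,\beta}=\prod_{i=1}^{l}\Lambda_{2i}(Q,p,\beta)$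 and $C_{2l+1,p,\beta}=\prod_{i=0}^{l}\Lambda_{2i+1}(Q,p,\beta)$. Distance function: with $u_R(x,t)=u\big(R\frac{x}{\varrho(x,t)},R^2\frac{t}{\varrho^2(x,t)}\big)$, $$d_R(u,k,\beta)=\left(\int_{\mathbb{R}^{n+1}}\frac{\Big||u|^{\frac{p-2}{2}}u-|u_R|^{\frac{p-2}{2}}u_R\big(\frac{\varrho}{R}\big)^{-\frac{Q-kp-\beta}{2}}\Big|^2}{\varrho^{kp+\beta}\big(\ln\frac{R}{\varrho}\big)^2}\,|\nabla_G\varrho|^p\,dx\,dt\right)^{1/2}$$ (all functions evaluated at $(x,t)$). ''Best possible'' means that $C_{k,p,\beta}$ cannot be replaced by a larger constant in the inequality obtained by replacing the right-hand side by $0$.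
   Formalization: Powers in Λ_k are read as |base|^p, since for k≥4 a base may be negative in the printed range of β; for p>2 the inequalities (i), (ii) are asserted only when C_{k,p,β}≠0, since they fail when C_{k,p,β}=0. Best possibility is asserted throughout. *)

(* Defs.v *)
From HB Require Import structures.
From mathcomp Require Import all_boot all_order all_algebra.
From mathcomp Require Import all_classical all_reals all_analysis.
Set Implicit Arguments.
Unset Strict Implicit.
Unset Printing Implicit Defensive.
Import Order.TTheory GRing.Theory Num.Theory.
Import numFieldNormedType.Exports.
Local Open Scope classical_set_scope.
Local Open Scope ring_scope.

(** ** Lebesgue measure on n-tuples of reals

    The library has the product sigma-algebra on [n.-tuple R] but no Lebesgue
    measure on it.  It is built by recursion on [n], carrying the product of
    the one-dimensional measure with the n-dimensional one along
    [(a, v) |-> a :: v]. *)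

(** The library's sigma-finite instance for products is shadowed by the one
    for subprobabilities, hence this lemma. *)
Lemma sigma_finite_prod d1 d2 (T1 : measurableType d1) (T2 : measurableType d2)
    (R : realType) (m1 : {sigma_finite_measure set T1 -> \bar R})
    (m2 : {sigma_finite_measure set T2 -> \bar R}) :
  sigma_finite setT (m1 \x m2)%E.
Proof.
have /sigma_finiteP[F [TF ndF Foo]] := sigma_finiteT m1.
have /sigma_finiteP[G [TG ndG Goo]] := sigma_finiteT m2.
exists (fun n => F n `*` G n).
  rewrite -setXTT TF TG predeqE => -[x y]; split.
    move=> [/= [n _ Fnx] [k _ Gky]]; exists (maxn n k) => //; split.
    - by move: x Fnx; exact/subsetPset/ndF/leq_maxl.
    - by move: y Gky; exact/subsetPset/ndG/leq_maxr.
  by move=> [n _ []/= ? ?]; split; exists n.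
move=> k; have [? ?] := Foo k; have [? ?] := Goo k.
split; first exact: measurableX.
by rewrite product_measure1E// lte_mul_pinfty// ge0_fin_numE.
Qed.

Section cons_measure.
Context {d} {T : measurableType d} {R : realType} {n : nat}.

Definition tuple_cons (z : T * n.-tuple T) : n.+1.-tuple T :=
  [tuple of z.1 :: z.2].

Definition tuple_uncons (v : n.+1.-tuple T) : T * n.-tuple T :=
  (thead v, [tuple of behead v]).

Lemma tuple_consK : cancel tuple_cons tuple_uncons.
Proof. by case=> a v; congr pair; apply/val_inj. Qed.

Lemma tuple_unconsK : cancel tuple_uncons tuple_cons.
Proof. by move=> v; rewrite [RHS]tuple_eta; apply/val_inj. Qed.

Lemma measurable_tuple_cons : measurable_fun setT tuple_cons.
Proof. exact: measurable_cons. Qed.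

Lemma measurable_tuple_uncons : measurable_fun setT tuple_uncons.
Proof.
apply: measurable_fun_pair; first exact: measurable_tnth.
exact: measurable_behead.
Qed.

Variables (mu1 : {sigma_finite_measure set T -> \bar R})
  (mu : {sigma_finite_measure set (n.-tuple T) -> \bar R}).

Definition cons_measure : set (n.+1.-tuple T) -> \bar R :=
  pushforward (mu1 \x mu)%E tuple_cons.

Let cons_measure0 : cons_measure set0 = 0%E.
Proof. by rewrite /cons_measure /pushforward preimage_set0 measure0. Qed.

Let cons_measure_ge0 A : (0 <= cons_measure A)%E.
Proof. exact: (@measure_ge0 _ _ _ (mu1 \x mu)%E). Qed.

Let cons_measure_sigma_additive : semi_sigma_additive cons_measure.
Proof.
exact: (@measure_semi_sigma_additive _ _ _
  (measure_function_pushforward__canonical__measure_function_Measure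
     (mu1 \x mu)%E measurable_tuple_cons)).
Qed.

HB.instance Definition _ := isMeasure.Build _ _ _ cons_measure
  cons_measure0 cons_measure_ge0 cons_measure_sigma_additive.

Lemma cons_measure_sigma_finite : sigma_finite setT cons_measure.
Proof.
have [F UF Foo] := sigma_finite_prod mu1 mu.
exists (fun i => tuple_uncons @^-1` F i).
  by rewrite -preimage_bigcup -UF preimage_setT.
move=> i; have [mF Fi] := Foo i; split.
  by rewrite -[X in measurable X]setTI; exact: measurable_tuple_uncons.
rewrite /cons_measure /pushforward -comp_preimage.
rewrite (_ : tuple_uncons \o tuple_cons = id) //.
by apply/funext => z /=; rewrite tuple_consK.
Qed.

HB.instance Definition _ := Measure_isSigmaFinite.Build _ _ _ cons_measure
  cons_measure_sigma_finite.

End cons_measure.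

Definition nil_measure (R : realType) :
    {sigma_finite_measure set (0.-tuple (measurableTypeR R)) -> \bar R} :=
  dirac [tuple].

Fixpoint lebesgue_tuple (R : realType) (n : nat) :
    {sigma_finite_measure set (n.-tuple (measurableTypeR R)) -> \bar R} :=
  if n is m.+1 then cons_measure (@lebesgue_measure R) (lebesgue_tuple R m) else nil_measure R.

(** ** Grushin space

    Points are pairs [(x, t)].  The norm that the library puts on
    ['rV[R]_n * R] is the sup norm; it is used for topology and
    differentiation only.  The Euclidean norm of [x] is [enorm x]. *)

Definition grushin (R : realType) (n : nat) : normedModType R :=
  ('rV[R]_n * R)%type.

Definition grushin_measure (R : realType) (n : nat) :=
  (lebesgue_tuple R n \x @lebesgue_measure R)%E.

Definition grushin_pt (R : realType) (n : nat)
    (z : n.-tuple (measurableTypeR R) * measurableTypeR R) : grushin R n :=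
  (\row_i tnth z.1 i, z.2).

Definition gintegral (R : realType) (n : nat) (f : grushin R n -> R) : \bar R :=
  (\int[@grushin_measure R n]_z (f (grushin_pt z))%:E)%E.

Fixpoint is_Ck (R : realType) (V : normedModType R) (k : nat) (f : V -> R) :
    Prop :=
  continuous f /\
  if k is j.+1 then
    forall v : V, (forall z, derivable f z v) /\ is_Ck j (fun z => 'D_v f z)
  else True.

Definition smooth (R : realType) (V : normedModType R) (f : V -> R) :=
  forall k, is_Ck k f.

Definition support_of (R : realType) (V : normedModType R) (f : V -> R) :
    set V :=
  closure [set z | f z != 0].

(** Functions of class C_0^oo(R^(n+1) minus the origin) are extended by zero. *)
Definition test_function (R : realType) (n : nat) (u : grushin R n -> R) :=
  [/\ smooth u, compact (support_of u) & ~ support_of u 0].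

Section grushin.
Context {R : realType} {n : nat}.
Local Notation G := (grushin R n).
Implicit Types (z : G) (u : G -> R) (p beta : R).

Definition hdim : R := (n + 2)%:R.
Local Notation Q := hdim.

Definition enorm (x : 'rV[R]_n) : R := Num.sqrt (\sum_i x 0 i ^+ 2).

Definition rho z : R := (enorm z.1 ^+ 4 + 4 * z.2 ^+ 2) `^ (1 / 4).

Definition dx (i : 'I_n) u z : R := 'D_((delta_mx 0 i, 0) : G) u z.

Definition dt u z : R := 'D_((0, 1) : G) u z.

Definition grad_norm u z : R :=
  Num.sqrt (\sum_i dx i u z ^+ 2 + (enorm z.1 * dt u z) ^+ 2).

Definition psi z : R := enorm z.1 ^+ 2 / rho z ^+ 2.

Definition drho u z : R :=
  (\sum_i z.1 0 i * dx i u z + 2 * z.2 * dt u z) / rho z.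

Definition radial_grad_norm u z : R := Num.sqrt (psi z) * `|drho u z|.

Definition radial_lap u z : R :=
  psi z * (drho (drho u) z + (Q - 1) / rho z * drho u z).

(** For [r > 0], this depends on [z] only through its direction. *)
Definition radial_value u (r : R) z : R :=
  u ((r / rho z) *: z.1, r ^+ 2 * z.2 / rho z ^+ 2).

Definition signed_pow p (a : R) : R := `|a| `^ ((p - 2) / 2) * a.

Definition dist_integrand p beta (k : nat) u (r : R) z : R :=
  `|signed_pow p (u z) - signed_pow p (radial_value u r z)
      * (rho z / r) `^ (- ((Q - k%:R * p - beta) / 2))| ^+ 2
  / (rho z `^ (k%:R * p + beta) * ln (r / rho z) ^+ 2)
  * grad_norm rho z `^ p.

Definition dist p beta (k : nat) u (r : R) : \bar R :=
  (gintegral (dist_integrand p beta k u r) `^ (1 / 2))%E.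

Definition sup_dist2 p beta (k : nat) u : \bar R :=
  ereal_sup [set (dist p beta k u r ^+ 2)%E | r in [set r : R | 0 < r]].

Definition even_energy p beta (l : nat) u : \bar R :=
  gintegral (fun z => `|iter l radial_lap u z| `^ p
    / (grad_norm rho z `^ ((2 * l%:R - 1) * p) * rho z `^ beta)).

Definition odd_energy p beta (l : nat) u : \bar R :=
  gintegral (fun z => radial_grad_norm (iter l radial_lap u) z `^ p
    / (grad_norm rho z `^ (2 * l%:R * p) * rho z `^ beta)).

Definition hardy_term p beta (k : nat) u : \bar R :=
  gintegral (fun z => `|u z| `^ p * grad_norm rho z `^ p
    / rho z `^ (k%:R * p + beta)).

(** In the range of [beta] of the theorem the base of the factor of [Cst] of
    highest index is positive, but for [k >= 4] the base of a lower factor may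
    be negative, and its power with a real exponent is then undefined.  The
    power [a^p] is read as [`|a| `^ p]; nothing changes when [a >= 0]. *)
Definition Lambda p beta (k : nat) : R :=
  if k == 1%N then `|(Q - p - beta) / p| `^ p
  else `|(Q * (p - 1) + beta + (k%:R - 2) * p) * (Q - beta - k%:R * p)
         / p ^+ 2| `^ p.

Definition Cst p beta (k : nat) : R :=
  if odd k then \prod_(0 <= i < k./2.+1) Lambda p beta (2 * i + 1)
  else \prod_(1 <= i < k./2.+1) Lambda p beta (2 * i).

Definition best_constant (E H : (G -> R) -> \bar R) (c : R) :=
  forall c' : R,
    (forall u, test_function u -> (0 <= E u - c'%:E * H u)%E) -> c' <= c.

End grushin.

Arguments hdim : clear implicits.
Arguments Lambda : clear implicits.
Arguments Cst : clear implicits.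

(* Main.v *)
(** Along an orbit of the dilations [dil s (x, t) = (e^s x, e^(2 s) t)] put
    [g s = e^(a s) u (dil s w)] with [a = (Q - k p - beta) / p].  In this normal
    form the radial operators are products of factors [D - b] with constant
    roots [b = a + 2 j] and [b = a + 2 j + 2 - Q], and [C_(k,p,beta)] is the
    product of the [|b|^p].  Expanding [|g' - b g|^p] by Bernoulli's inequality
    for the squares, the cross term integrates to zero, and a remainder
    [(p / 2) |b|^(p - 2) int |g|^(p - 2) g'^2] is left: it is the energy of the
    signed power of [g], which Hardy's inequality on the line bounds below by
    the integrand of the distance.  A factor may have [b = 0] only when [p = 2],
    and then at most one does.

    Inequalities on orbits are integrated without a surface measure: by Tonelli
    and the scaling of Lebesgue measure, an integral is the average over the
    shell [1 <= rho <= e] of the weighted integrals along the orbits.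

    For the sharpness, take [u = rho^(- a) phi (ln rho)] with [phi] a smooth
    plateau of length [2 N] and transitions of fixed shape: both sides of the
    inequality grow linearly in [N] with ratio [C_(k,p,beta)]. *)
Require Import Defs.
From HB Require Import structures.
From mathcomp Require Import all_boot all_order all_algebra.
From mathcomp Require Import all_classical all_reals all_analysis.
From mathcomp Require Import measurable_realfun.
From mathcomp Require Import ring lra zify.
Set Implicit Arguments.
Unset Strict Implicit.
Unset Printing Implicit Defensive.
Import Order.TTheory GRing.Theory Num.Theory.
Import numFieldNormedType.Exports.
Local Open Scope classical_set_scope.
Local Open Scope ring_scope.

(** The delicate point is a vanishing root [b]. Its remainder carries the factor [|b|^(p - 2)],
    which is [0^0 = 1] for [p = 2] and is 0 for [p > 2]. The loss is genuine: with a zero root the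
    constant C_(k,p,beta) is 0, and spreading [g] out as [phi (s / N)] gives an energy of order at
    most [N^(1 - p)] against a squared distance of order [1 / N]. Hence the assumption
    [2 < p -> Cst R n p beta k != 0] on the two lower bounds.

    The second obstacle is uniformity: [C] is chosen before [n], while the roots move with
    [Q = n + 2]. They are affine in [n] with the nonzero slopes [1 / p] and [1 / p - 1], so some
    [d <= 1] bounds all nonzero roots away from 0 for every [n] at once. Each of the [k] factors
    then costs at most [d^p], and [C = d^(p k) / (2 p)]. Here [1 / (2 p)] is the coefficient [p / 2]
    of the remainder divided by [p^2], the latter being Hardy's constant 4 times the [(p / 2)^2]
    from differentiating the signed power. *)

Lemma is_deriveW {R : numFieldType} {V W : normedModType R} (f : V -> W) x v df :
  is_derive x v f df -> 'D_v f x = df.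
Proof. by case. Qed.

(** * Smooth functions on open sets *)

Section smooth_on.
Context {R : realType} {V : normedModType R}.
Implicit Types (A B : set V) (f g : V -> R) (k : nat).

(** The local form of [is_Ck]. Continuity and derivability are asked at the points of [A] but in the
    ambient space, so that on an open [A] only the germs of [f] matter. A local notion is required
    because the radial operators divide by [rho] and preserve smoothness off the origin only. *)
Fixpoint Ck_on A k f : Prop :=
  (forall z, A z -> {for z, continuous f}) /\
  if k is j.+1 then
    forall v, (forall z, A z -> derivable f z v) /\ Ck_on A j (fun z => 'D_v f z)
  else True.

Definition smooth_on A f := forall k, Ck_on A k f.

Lemma Ck_onW A k f : Ck_on A k.+1 f -> Ck_on A k f.
Proof.
elim: k f => [f [] //|k IH f [fc fD]]; split=> // v.
by have [? ?] := fD v; split=> //; exact: IH.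
Qed.

Lemma Ck_on_eq A k f g : open A -> (forall z, A z -> f z = g z) ->
  Ck_on A k f -> Ck_on A k g.
Proof.
move=> oA; elim: k f g => [|k IH] f g fg.
  move=> [fc _]; split=> // z Az.
  have nfg : \forall x \near z, f x = g x.
    by have := open_nbhs_nbhs (conj oA Az); apply: filterS => x /fg.
  rewrite /prop_for /continuous_at -(fg _ Az).
  apply: cvg_trans (fc _ Az); exact: near_eq_cvg.
move=> [fc fD]; split.
  move=> z Az; have nfg : \forall x \near z, f x = g x.
    by have := open_nbhs_nbhs (conj oA Az); apply: filterS => x /fg.
  rewrite /prop_for /continuous_at -(fg _ Az).
  apply: cvg_trans (fc _ Az); exact: near_eq_cvg.
move=> v; have [fv fDv] := fD v.
have E z : A z -> \forall x \near z, f x = g x.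
  by move=> Az; have := open_nbhs_nbhs (conj oA Az); apply: filterS => x /fg.
split.
  by move=> z Az; apply: (near_eq_derivable (E _ Az)); exact: fv.
by apply: IH fDv => z Az; exact: (near_eq_derive v (E _ Az)).
Qed.

(** All conditions are pointwise, so they may be checked on the pieces of a cover. This turns a
    function that is smooth off the origin and vanishes near it into one that is smooth
    everywhere. *)
Lemma Ck_onU A B k f : Ck_on A k f -> Ck_on B k f -> Ck_on (A `|` B) k f.
Proof.
elim: k f => [f [fA _] [fB _]|k IH f [fA DA] [fB DB]]; split=> //.
- by move=> z [/fA|/fB].
- by move=> z [/fA|/fB].
- move=> v; have [dA CA] := DA v; have [dB CB] := DB v.
  by split; [move=> z [/dA|/dB]|exact: IH].
Qed.

Lemma Ck_on_cst A k (c : R) : Ck_on A k (fun=> c).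
Proof.
elim: k c => [|k IH] c; first by split=> // z _; exact: cst_continuous.
split; first by move=> z _; exact: cst_continuous.
move=> v; split; first by move=> z _; exact: derivable_cst.
by under eq_fun do rewrite (_ : 'D_v _ _ = 0) ?derive_cst//; exact: IH.
Qed.

Lemma Ck_onD A k f g : open A ->
  Ck_on A k f -> Ck_on A k g -> Ck_on A k (fun z => f z + g z).
Proof.
move=> oA; elim: k f g => [f g [fc _] [gc _]|k IH f g [fc fD] [gc gD]].
  by split=> // z Az; apply: continuousD; [exact: fc|exact: gc].
split; first by move=> z Az; apply: continuousD; [exact: fc|exact: gc].
move=> v; have [fv fDv] := fD v; have [gv gDv] := gD v; split.
  by move=> z Az; apply: derivableD; [exact: fv|exact: gv].
apply: Ck_on_eq (IH _ _ fDv gDv) => // z Az.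
by rewrite (_ : (fun z => f z + g z) = f + g)// deriveD//; [exact: fv|exact: gv].
Qed.

Lemma Ck_onM A k f g : open A ->
  Ck_on A k f -> Ck_on A k g -> Ck_on A k (fun z => f z * g z).
Proof.
move=> oA; elim: k f g => [f g [fc _] [gc _]|k IH f g Cf Cg].
  by split=> // z Az; apply: continuousM; [exact: fc|exact: gc].
have [fc fD] := Cf; have [gc gD] := Cg.
split; first by move=> z Az; apply: continuousM; [exact: fc|exact: gc].
move=> v; have [fv fDv] := fD v; have [gv gDv] := gD v; split.
  by move=> z Az; apply: derivableM; [exact: fv|exact: gv].
apply: Ck_on_eq (Ck_onD oA (IH _ _ (Ck_onW Cf) gDv) (IH _ _ (Ck_onW Cg) fDv)) => // z Az.
by rewrite (_ : (fun z => f z * g z) = f * g)// deriveM//; [exact: fv|exact: gv].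
Qed.

Lemma is_derive_linear f z v : continuous f ->
  (forall h v z, f (h *: v + z) = h * f v + f z) -> is_derive z v f (f v).
Proof.
move=> fc fl.
have E : (fun h : R => h^-1 *: ((f \o shift z) (h *: v) - f z)) @ (0 : R)^' --> f v.
  apply: (@cvg_trans _ ((fun _ : R => f v) @ (0 : R)^')); last exact: cvg_cst.
  apply: near_eq_cvg.
  near=> h; rewrite /= fl addrK /GRing.scale /= mulrA mulVf ?mul1r//.
  by near: h; exact: nbhs_dnbhs_neq.
by apply: DeriveDef; [exact: cvgP E|exact: cvg_lim E].
Unshelve. all: end_near. Qed.

Lemma Ck_on_linear A k f : continuous f ->
  (forall h v z, f (h *: v + z) = h * f v + f z) -> Ck_on A k f.
Proof.
move=> fc fl; have D z v := is_derive_linear z v fc fl.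
case: k => [|k] /=; split=> //; first by move=> z _; exact: fc.
  by move=> z _; exact: fc.
move=> v; split; first by move=> z _; exact: ex_derive.
by under eq_fun do rewrite (is_deriveW (D _ v)); exact: Ck_on_cst.
Qed.

Lemma smooth_on_derive A f v : smooth_on A f -> smooth_on A (fun z => 'D_v f z).
Proof. by move=> Sf k; have [_ /(_ v) []] := Sf k.+1. Qed.

Lemma smooth_on_sum A (I : Type) (s : seq I) (F : I -> V -> R) : open A ->
  (forall i, smooth_on A (F i)) -> smooth_on A (fun z => \sum_(i <- s) F i z).
Proof.
move=> oA SF k; elim: s => [|i s IH].
  by under eq_fun do rewrite big_nil; exact: Ck_on_cst.
by under eq_fun do rewrite big_cons; apply: Ck_onD => //; exact: SF.
Qed.

End smooth_on.

Section smooth_comp.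
Context {R : realType} {V : normedModType R}.

(** A directional derivative at [z] is the derivative at 0 of the restriction to the line
    [s *: v + z], so the chain rule for real functions suffices, without differentiability of [f] as
    a map on [V]. *)
Lemma is_derive_comp1 (h : R -> R) (f : V -> R) z v (df dh : R) :
  is_derive z v f df -> is_derive (f z) 1 h dh ->
  is_derive z v (h \o f) (dh * df).
Proof.
move=> [fd fv] Dh.
have E (g : V -> R) (w : V) (u : V) : (fun t : R => t^-1 *: ((g \o shift w) (t *: u) - g w)) =
   (fun t : R => t^-1 *: (((fun s : R => g (s *: u + w)) \o shift 0) (t *: 1) - (fun s : R => g (s *: u + w)) 0)).
  apply/funext => t /=.
  by rewrite addr0 scale0r add0r [t *: 1]mulr1.
have D1 : is_derive (0 : R) 1 (fun s : R => f (s *: v + z)) df.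
  split; first by rewrite /derivable -E.
  by rewrite /derive -E.
have D2 : is_derive (0 : R) 1 (h \o (fun s : R => f (s *: v + z))) (dh * df).
  have Dh0 : is_derive ((fun s : R => f (s *: v + z)) 0) 1 h dh by rewrite /= scale0r add0r.
  exact: (is_derive1_comp Dh0 D1).
case: D2 => ex vl; split.
  by rewrite /derivable E.
by rewrite /derive E.
Qed.

Lemma Ck_on_comp (A : set V) (I : set R) k (h : R -> R) (f : V -> R) :
  open A -> (forall z, A z -> I (f z)) ->
  Ck_on I k h -> Ck_on A k f -> Ck_on A k (fun z => h (f z)).
Proof.
move=> oA AI; elim: k h => [h [hc _] [fc _]|k IH h Ch Cf].
  split=> // z Az; apply: (@continuous_comp _ _ _ f h); first exact: fc.
  exact/hc/AI.
have [hc hD] := Ch; have [fc fD] := Cf; split.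
  move=> z Az; apply: (@continuous_comp _ _ _ f h); first exact: fc.
  exact/hc/AI.
move=> v; have [fv fDv] := fD v; have [hv hDv] := hD 1.
have D z : A z -> is_derive z v (h \o f) ('D_1 h (f z) * 'D_v f z).
  move=> Az; apply: is_derive_comp1; apply: derivableP; first exact: fv.
  exact/hv/AI.
split; first by move=> z /D [].
apply: Ck_on_eq (Ck_onM oA (IH _ hDv (Ck_onW Cf)) fDv) => // z Az; exact: (esym (is_deriveW (D z Az))).
Qed.

Lemma is_derive_scale1 (h : R -> R) (x v dh : R) :
  is_derive x 1 h dh -> is_derive x v h (v * dh).
Proof.
move=> Dh; have Dv : is_derive (0 : R) 1 (fun s : R => s *: v + x) v.
  have -> : v = v *: 1 + 0 by rewrite addr0 [v *: 1]mulr1.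
  rewrite [in X in is_derive _ _ X](_ : (fun s => _) = (fun s : R => v *: s + x)).
    by apply: is_deriveD; apply: is_deriveZ.
  by apply/funext => s; rewrite addr0 [v *: 1]mulr1 [s *: v]mulrC.
have Dh0 : is_derive ((fun s : R => s *: v + x) 0) 1 h dh by rewrite /= scale0r add0r.
have [ex vl] := @is_derive1_comp R h (fun s : R => s *: v + x) 0 dh v Dh0 Dv.
have E : (fun t : R => t^-1 *: ((h \o shift x) (t *: v) - h x)) =
   (fun t : R => t^-1 *: (((h \o (fun s : R => s *: v + x)) \o shift 0) (t *: 1) - (h \o (fun s : R => s *: v + x)) 0)).
  by apply/funext => t /=; rewrite addr0 scale0r add0r [t *: 1]mulr1.
by rewrite mulrC; split; [rewrite /derivable E|rewrite /derive E].
Qed.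

(** On the line the derivative in direction [v] is [v] times the derivative in direction 1, so one
    direction decides all of them and induction on the order only has to follow [h']. *)
Lemma Ck_on1 (I : set R) (h h' : R -> R) k : open I ->
  (forall x, I x -> is_derive x 1 h (h' x)) -> Ck_on I k h' -> Ck_on I k.+1 h.
Proof.
move=> oI D Ch'; split.
  by move=> x /D [/derivable1_diffP /differentiable_continuous].
move=> v; split; first by move=> x /D /(@is_derive_scale1 _ _ v) [].
apply: Ck_on_eq (Ck_onM oI (Ck_on_cst I k v) Ch') => // x /D /(@is_derive_scale1 _ _ v) Dv.
exact: (esym (is_deriveW Dv)).
Qed.

End smooth_comp.

(** * Special functions and a smooth step *)

Section special_functions.
Context {R : realType}.

Lemma Ck_on_expR k : Ck_on setT k (@expR R).
Proof.
elim: k => [|k IH].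
  by split; [move=> x _; exact: continuous_expR|].
apply: (@Ck_on1 _ _ _ expR) => //; first exact: openT.
Qed.

Lemma Ck_on_ln k : Ck_on [set x : R | 0 < x] k (@ln R).
Proof.
have o0 : open [set x : R | 0 < x] by exact: open_gt.
elim: k => [|k IH].
  by split; [move=> x x0; exact: continuous_ln|].
apply: (@Ck_on1 _ _ _ (fun x => x^-1)) => //.
apply: (@Ck_on_eq _ _ _ _ (fun x => expR (-1 * ln x))) => //.
  by move=> x x0; rewrite mulN1r expRN lnK.
apply: (@Ck_on_comp _ _ _ setT) => //; first exact: Ck_on_expR.
by apply: Ck_onM => //; exact: Ck_on_cst.
Qed.

(** The derivatives of [exp (- 1 / x)] on [x > 0] are combinations of these
    functions, which makes the induction on the order of differentiation go
    through. *)
Definition flat (m : nat) (x : R) : R :=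
  if 0 < x then expR (- x^-1) * x^-1 ^+ m else 0.

(** From [expR (y / (m + 1)) >= y / (m + 1)] raised to the power [m + 1], with [y = 1 / x]. The
    linear bound in [x] is what makes difference quotients at 0 tend to 0. *)
Lemma flat_le m x : 0 < x -> flat m x <= (m.+1 ^ m.+1)%:R * x.
Proof.
move=> x0; rewrite /flat x0; set y := x^-1.
have y0 : 0 < y by rewrite invr_gt0.
have H : y ^+ m.+1 <= (m.+1 ^ m.+1)%:R * expR y.
  have -> : expR y = expR (y / m.+1%:R) ^+ m.+1.
    by rewrite -expRM_natl mulrC divfK.
  rewrite natrX -exprMn lerXn2r ?nnegrE ?mulr_ge0 ?expR_ge0 ?(ltW y0)//.
  by rewrite -ler_pdivrMl// mulrC (le_trans _ (expR_ge1Dx _))// lerDr.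
rewrite expRN mulrC ler_pdivrMr ?expR_gt0// mulrAC -ler_pdivrMr//.
by rewrite -/y -exprSr.
Qed.

Lemma flat_ge0 m x : 0 <= flat m x.
Proof.
rewrite /flat; case: ifP => // x0.
by rewrite mulr_ge0 ?expR_ge0// exprn_ge0// invr_ge0 ltW.
Qed.

Lemma flat_eq0 m (x : R) : x <= 0 -> flat m x = 0.
Proof. by move=> x0; rewrite /flat ltNge x0. Qed.

Lemma is_derive_flat m (x : R) : is_derive x 1 (flat m) (flat m.+2 x - m%:R * flat m.+1 x).
Proof.
have [x0|x0|->] := ltgtP x 0.
- have E : \forall y \near x, cst 0 y = flat m y.
    near=> y; rewrite /flat ifF//; apply/negbTE; rewrite -leNgt ltW//.
    by near: y; exact: lt_nbhsl.
  rewrite /flat !ifF; try by apply/negbTE; rewrite -leNgt ltW.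
  rewrite mulr0 subr0; apply: near_eq_is_derive E _; exact: is_derive_cst.
- have E : \forall y \near x, expR (- y^-1) * y^-1 ^+ m = flat m y.
    near=> y; rewrite /flat ifT//.
    by near: y; exact: lt_nbhsr.
  have xn0 : x != 0 by rewrite gt_eqF.
  apply: near_eq_is_derive E _; rewrite /flat x0.
  have D1 : is_derive x 1 (fun y : R => y^-1) (- x ^- 2).
    by rewrite -[- x ^- 2]mulr1; exact: (@is_deriveV R id x 1 1 xn0 _).
  have D2 : is_derive x 1 (fun y : R => expR (- y^-1)) (expR (- x^-1) * x ^- 2).
    have DN : is_derive x 1 (fun y : R => - y^-1) (x ^- 2).
      by rewrite -[X in is_derive _ _ _ X]opprK; exact: is_deriveN.
    exact: (@is_derive1_comp R (@expR R) (fun y => - y^-1) x _ _ (is_derive_expR _) DN).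
  have D3 : is_derive x 1 (fun y : R => y^-1 ^+ m) ((m%:R * x^-1 ^+ m.-1) *: - x ^- 2).
    by have := @is_deriveX _ _ (fun y : R => y^-1) m x 1 _ D1; rewrite exprfctE.
  apply: (is_derive_eq (is_deriveM D2 D3)).
  rewrite /GRing.scale /= -exprVn; case: m {D3} => [|m] /=.
    by rewrite !expr0 !mul0r mulr0 mul1r add0r subr0.
  rewrite !exprS; ring.
- rewrite !flat_eq0// mulr0 subr0.
  (* For [h > 0] the difference quotient at 0 is [flat m.+1 h], squeezed by [flat_le]; for [h < 0]
     it is 0. *)
  have E : (fun h : R => h^-1 *: ((flat m \o shift 0) (h *: 1) - flat m 0)) @ (0 : R)^' --> (0 : R).
    apply: (@squeeze_cvgr _ _ _ _ (fun=> 0) (fun h : R => (m.+2 ^ m.+2)%:R * `|h|)).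
    + near=> h; have h0 : h != 0 by near: h; exact: nbhs_dnbhs_neq.
      rewrite /= addr0 [h *: 1]mulr1 [X in _ - X]/flat ltxx subr0 /GRing.scale /=.
      have [hl|hg|] := ltgtP h 0; last by move/eqP; rewrite (negbTE h0).
        by rewrite /flat ltNge (ltW hl)/= mulr0 lexx/= mulr_ge0.
      rewrite mulr_ge0 ?flat_ge0 ?invr_ge0 ?(ltW hg)//=.
      rewrite gtr0_norm//; apply: le_trans (flat_le m.+1 hg).
      by rewrite /flat hg exprS mulrCA.
    + exact: cvg_cst.
    + rewrite -[X in _ --> X](mulr0 (m.+2 ^ m.+2)%:R).
      apply: cvgMr; rewrite -[X in _ --> X](normr0 R).
      apply: cvg_norm; apply: cvg_within_filter; exact: cvg_id.
  by apply: DeriveDef; [exact: cvgP E|exact: cvg_lim E].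
Unshelve. all: end_near. Qed.

Lemma Ck_on_flat m k : Ck_on setT k (flat m).
Proof.
elim: k m => [|k IH] m.
  split=> // x _; apply: differentiable_continuous; apply/derivable1_diffP.
  by case: (is_derive_flat m x).
apply: (@Ck_on1 _ _ _ (fun x => flat m.+2 x + - m%:R * flat m.+1 x)).
- exact: openT.
- by move=> x _; rewrite mulNr; exact: is_derive_flat.
- by apply: Ck_onD => //; [exact: openT|apply: Ck_onM => //; [exact: openT|exact: Ck_on_cst]].
Qed.

End special_functions.

Section smooth_compositions.
Context {R : realType} {V : normedModType R}.
Variable A : set V.
Hypothesis oA : open A.
Implicit Types f : V -> R.

Lemma smooth_on_cst c : smooth_on A (fun=> c).
Proof. by move=> k; exact: Ck_on_cst. Qed.

Lemma smooth_onD f g : smooth_on A f -> smooth_on A g -> smooth_on A (fun z => f z + g z).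
Proof. by move=> Sf Sg k; exact: Ck_onD. Qed.

Lemma smooth_onM f g : smooth_on A f -> smooth_on A g -> smooth_on A (fun z => f z * g z).
Proof. by move=> Sf Sg k; exact: Ck_onM. Qed.

Lemma smooth_on_eq f g : (forall z, A z -> f z = g z) -> smooth_on A f -> smooth_on A g.
Proof. by move=> fg Sf k; exact: Ck_on_eq (Sf k). Qed.

Lemma smooth_onX f m : smooth_on A f -> smooth_on A (fun z => f z ^+ m).
Proof.
move=> Sf; elim: m => [|m IH]; first exact: smooth_on_cst.
by under eq_fun do rewrite exprS; exact: smooth_onM.
Qed.

Lemma smooth_on_comp (h : R -> R) f :
  smooth_on setT h -> smooth_on A f -> smooth_on A (fun z => h (f z)).
Proof. by move=> Sh Sf k; exact: (@Ck_on_comp _ _ _ setT). Qed.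

Lemma smooth_on_ln f : (forall z, A z -> 0 < f z) -> smooth_on A f ->
  smooth_on A (fun z => ln (f z)).
Proof. by move=> f0 Sf k; apply: (@Ck_on_comp _ _ _ [set x : R | 0 < x]) => //; exact: Ck_on_ln. Qed.

Lemma smooth_on_powR f c : (forall z, A z -> 0 < f z) -> smooth_on A f ->
  smooth_on A (fun z => f z `^ c).
Proof.
move=> f0 Sf; apply: (@smooth_on_eq (fun z => expR (c * ln (f z)))).
  by move=> z /f0 fz; rewrite /powR gt_eqF.
apply: (@smooth_on_comp expR); first by move=> k; exact: Ck_on_expR.
by apply: smooth_onM; [exact: smooth_on_cst|exact: smooth_on_ln].
Qed.

Lemma smooth_onV f : (forall z, A z -> 0 < f z) -> smooth_on A f ->
  smooth_on A (fun z => (f z)^-1).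
Proof.
move=> f0 Sf; apply: smooth_on_eq (smooth_on_powR (-1) f0 Sf) => z /f0 /ltW fz.
exact: powR_inv1.
Qed.

End smooth_compositions.

Section smooth_step.
Context {R : realType}.

Definition step (x : R) : R := flat 0 x / (flat 0 x + flat 0 (1 - x)).

Lemma flat0_gt0 (x : R) : 0 < x -> 0 < flat 0 x.
Proof. by move=> x0; rewrite /flat x0 expr0 mulr1 expR_gt0. Qed.

Lemma step_eq0 x : x <= 0 -> step x = 0.
Proof. by move=> x0; rewrite /step flat_eq0// mul0r. Qed.

Lemma step_eq1 x : 1 <= x -> step x = 1.
Proof.
move=> x1; rewrite /step [flat _ (1 - x)]flat_eq0 ?subr_le0// addr0 divff//.
by rewrite gt_eqF// flat0_gt0// (lt_le_trans ltr01).
Qed.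

Lemma smooth_step : smooth_on setT step.
Proof.
have oT : open [set: R] by exact: openT.
have S0 : smooth_on [set: R] (flat 0) by move=> k; exact: Ck_on_flat.
have S1 : smooth_on [set: R] (fun x : R => flat 0 (1 - x)).
  apply: (smooth_on_comp oT S0); apply: smooth_onD => //; first exact: smooth_on_cst.
  by move=> k; apply: Ck_on_linear => [x|h v z]; [exact: opp_continuous|rewrite opprD mulrN].
apply: smooth_onM => //; apply: smooth_onV => //; last exact: smooth_onD.
move=> x _; have [x0|x0] := ltP 0 x.
  by rewrite ltr_wpDr ?flat_ge0 ?flat0_gt0.
by rewrite ltr_wpDl ?flat_ge0 ?flat0_gt0// subr_gt0 (le_lt_trans x0).
Qed.

End smooth_step.

(** * Chain rule along curves, from continuous directional derivatives *)

Section chain_rule.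
Context {R : realType} {V : normedModType R}.
Variables (A : set V) (f : V -> R).
Hypotheses (oA : open A) (Cf : Ck_on A 1 f).

(** With this value at [h = 0] the identity [f (h *: v + y) - f y = h * slope v y h] holds for every
    [h]. In the chain rule [h] is the increment of a coordinate, which may vanish arbitrarily close
    to the base time. *)
Definition slope (v y : V) (h : R) : R :=
  if h == 0 then 'D_v f y else (f (h *: v + y) - f y) / h.

Lemma is_derive_line (y v : V) (s : R) : derivable f (s *: v + y) v ->
  is_derive s 1 (fun t : R => f (t *: v + y)) ('D_v f (s *: v + y)).
Proof.
move=> D; have E : (fun t : R => t^-1 *: (((fun t : R => f (t *: v + y)) \o shift s) (t *: 1) - f (s *: v + y)))
   = (fun t : R => t^-1 *: ((f \o shift (s *: v + y)) (t *: v) - f (s *: v + y))).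
  by apply/funext => t /=; rewrite [t *: 1]mulr1 scalerDl addrA.
by split; [rewrite /derivable E|rewrite /derive E].
Qed.

Lemma slopeE v y h : (forall t, 0 <= t <= 1 -> A ((t * h) *: v + y)) ->
  exists2 t, 0 <= t <= 1 & slope v y h = 'D_v f ((t * h) *: v + y).
Proof.
move=> Ah; have [_ /(_ v) [fD _]] := Cf.
rewrite /slope; case: eqVneq => [->|h0].
  by exists 0; rewrite ?lexx ?ler01// mulr0 scale0r add0r.
have D (t : R) : 0 <= t <= 1 -> is_derive t 1 (fun t : R => f ((t * h) *: v + y))
    (h * 'D_v f ((t * h) *: v + y)).
  move=> t01; rewrite mulrC.
  have D1 := @is_derive_line y v (t * h) (fD _ (Ah _ t01)).
  apply: (@is_derive1_comp R (fun s : R => f (s *: v + y)) (fun t => t * h) t _ h D1).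
  have -> : (fun t : R => t * h) = (fun t : R => h *: t) by apply/funext => ?; exact: mulrC.
  by rewrite -[X in is_derive _ _ _ X]mulr1; exact: is_deriveZ.
have D01 (t : R) : t \in `]0, 1[%R -> is_derive t 1 (fun t : R => f ((t * h) *: v + y))
    (h * 'D_v f ((t * h) *: v + y)).
  by rewrite in_itv /= => /andP[/ltW t0 /ltW t1]; apply: D; rewrite t0.
have cG : {within `[0, 1], continuous (fun t : R => f ((t * h) *: v + y))}.
  apply: continuous_in_subspaceT => t; rewrite inE /= in_itv /= => t01.
  by have [/derivable1_diffP /differentiable_continuous] := D t t01.
have [t] := MVT_segment ler01 D01 cG.
rewrite in_itv /= => t01; rewrite mul1r mul0r scale0r add0r subr0 mulr1 => ->.
by exists t => //; rewrite mulrAC divff ?mul1r.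
Qed.

(** By the mean value theorem a slope is a value of ['D_v f] at a point near [z]. Convergence is
    joint in base point and increment; this stands in for differentiability in the sense of
    Frechet. *)
Lemma slope_cvg (T : Type) (F : set_system T) (FF : Filter F) v z (y : T -> V) (h : T -> R) :
  A z -> y @ F --> z -> h @ F --> (0 : R) ->
  slope v (y t) (h t) @[t --> F] --> 'D_v f z.
Proof.
move=> Az yz h0; have [_ /(_ v) [_ Cv]] := Cf.
have cD := Cv.1 z Az.
apply/cvgrPdist_lt => e e0.
have /nbhs_ballP[d /= d0 dP] : \forall x \near z, A x /\ `|'D_v f z - 'D_v f x| < e.
  near=> x; split; first by near: x; exact: open_nbhs_nbhs.
  by near: x; move/cvgrPdist_lt : cD; exact.
have hv : h t *: v @[t --> F] --> (0 : V).
  by rewrite -(scale0r v); apply: cvgZl.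
near=> t.
have yd : `|z - y t| < d / 2 by near: t; move/cvgrPdist_lt : yz; apply; rewrite divr_gt0.
have hd : `|0 - h t *: v| < d / 2 by near: t; move/cvgrPdist_lt : hv; apply; rewrite divr_gt0.
have B s : 0 <= s <= 1 -> ball z d ((s * h t) *: v + y t).
  move=> /andP[s0 s1]; rewrite -ball_normE /= opprD addrCA.
  rewrite sub0r normrN in hd.
  apply: le_lt_trans (ler_normD _ _) _; rewrite normrN -scalerA normrZ ger0_norm//.
  rewrite (splitr d) ler_ltD// (le_trans _ (ltW hd))//.
  by rewrite ler_piMl.
have [s s01 ->] := @slopeE v (y t) (h t) (fun s s01 => (dP _ (B s s01)).1).
exact: (dP _ (B s s01)).2.
Unshelve. all: end_near. Qed.

(** Directional derivatives alone satisfy no chain rule along curves; their continuity does it. The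
    increment of the curve is split into moves along the directions [v i], made one after the other,
    and the quotient of each move tends to [dc i * 'D_(v i) f z]. *)
Lemma is_derive_curve (I : Type) (r : seq I) (c : I -> R -> R) (dc : I -> R)
    (v : I -> V) (s : R) :
  (forall i, is_derive s 1 (c i) (dc i)) -> A (\sum_(i <- r) c i s *: v i) ->
  is_derive s 1 (fun t : R => f (\sum_(i <- r) c i t *: v i))
    (\sum_(i <- r) dc i * 'D_(v i) f (\sum_(i <- r) c i s *: v i)).
Proof.
move=> Dc; set z := \sum_(i <- r) c i s *: v i => Az.
pose dl i (h : R) := c i (h + s) - c i s.
have dlE i : h^-1 * dl i h @[h --> 0^'] --> dc i.
  have [ex vl] := Dc i; rewrite -vl.
  have -> : (fun h => h^-1 * dl i h) = (fun h : R => h^-1 *: ((c i \o shift s) (h *: 1) - c i s)).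
    by apply/funext => h; rewrite /dl /= [h *: 1]mulr1.
  exact: ex.
have dl0 i : dl i h @[h --> 0^'] --> (0 : R).
  rewrite -[X in _ --> X](mul0r (dc i)).
  have : h * (h^-1 * dl i h) @[h --> 0^'] --> 0 * dc i.
    by apply: cvgM => //; apply: cvg_within_filter; exact: cvg_id.
  move=> H; apply: cvg_trans H; apply: near_eq_cvg; near=> h.
  have h0 : h != 0 by near: h; exact: nbhs_dnbhs_neq.
  by rewrite mulrA divff ?mul1r.
(* The induction performs the moves listed in [q] only. The base point of the next move depends on
   [h], so its convergence to [z] is carried along. *)
have key (q : seq I) :
  (z + \sum_(i <- q) dl i h *: v i @[h --> 0^'] --> z) /\
  (h^-1 * (f (z + \sum_(i <- q) dl i h *: v i) - f z) @[h --> 0^'] -->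
    \sum_(i <- q) dc i * 'D_(v i) f z).
  elim: q => [|i q [IHz IHf]].
    split; first by under eq_fun do rewrite big_nil addr0; exact: cvg_cst.
    rewrite big_nil; under eq_fun do rewrite big_nil addr0 subrr mulr0.
    exact: cvg_cst.
  split.
    have H : dl i h *: v i + (z + \sum_(j <- q) dl j h *: v j) @[h --> 0^'] --> 0 + z.
      by apply: cvgD IHz; rewrite -(scale0r (v i)); exact: cvgZl.
    by rewrite add0r in H; under eq_fun do rewrite big_cons addrCA; exact: H.
  rewrite big_cons.
  have H : h^-1 * dl i h * slope (v i) (z + \sum_(j <- q) dl j h *: v j) (dl i h) +
      h^-1 * (f (z + \sum_(i <- q) dl i h *: v i) - f z) @[h --> 0^'] -->
      dc i * 'D_(v i) f z + \sum_(j <- q) dc j * 'D_(v j) f z.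
    by apply: cvgD IHf; apply: cvgM (dlE i) _; exact: slope_cvg.
  apply: cvg_trans H; apply: near_eq_cvg; near=> h.
  rewrite big_cons addrCA /=.
  have -> : h^-1 * dl i h * slope (v i) (z + \sum_(j <- q) dl j h *: v j) (dl i h)
     = h^-1 * (f (dl i h *: v i + (z + \sum_(j <- q) dl j h *: v j)) -
               f (z + \sum_(j <- q) dl j h *: v j)).
    rewrite -mulrA /slope; congr (_ * _); case: eqVneq => [->|n0].
      by rewrite mul0r scale0r add0r subrr.
    by rewrite mulrC divfK.
  by rewrite -mulrDr; congr (_ * _); ring.
have [_ K] := key r.
have E : (fun h : R => h^-1 *: (((fun t : R => f (\sum_(i <- r) c i t *: v i)) \o shift s) (h *: 1) - f z)) @ (0 : R)^' -->
    \sum_(i <- r) dc i * 'D_(v i) f z.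
  apply: cvg_trans K; apply: near_eq_cvg; near=> h.
  rewrite /= [h *: 1]mulr1 /GRing.scale /=; congr (_ * (f _ - _)).
  rewrite /z -big_split /=; apply: eq_bigr => i _.
  by rewrite -scalerDl /dl addrC subrK.
by apply: DeriveDef; [exact: cvgP E|exact: cvg_lim E].
Unshelve. all: end_near. Qed.

End chain_rule.

(** * Inequalities on the line *)

Section real_powers.
Context {R : realType}.
Implicit Types p q r x y : R.

(** The graph of the convex function [x^q] lies above its tangent at [y]. For [q > 1] this is
    Young's inequality for [x] and [y^(q - 1)] with the exponents [q] and [q / (q - 1)]. *)
Lemma powR_bernoulli q x y : 1 <= q -> 0 <= x -> 0 <= y ->
  y `^ q + q * y `^ (q - 1) * (x - y) <= x `^ q.
Proof.
rewrite le_eqVlt => /predU1P[<- x0 y0|q1 x0 y0].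
  by rewrite subrr powRr0 !powRr1// mulr1 mul1r addrC subrK.
have q0 : 0 < q by rewrite (lt_trans ltr01).
have q10 : 0 < q - 1 by rewrite subr_gt0.
have := @conjugate_powR R x (y `^ (q - 1)) q (q / (q - 1)) x0 (powR_ge0 _ _) q0.
rewrite divr_gt0// => /(_ isT).
have -> : q^-1 + (q / (q - 1))^-1 = 1 by field; rewrite !gt_eqF.
move=> /(_ erefl); rewrite -powRrM.
have -> : (q - 1) * (q / (q - 1)) = q by field; rewrite gt_eqF.
move=> H; have {H} : q * (x * y `^ (q - 1)) <= x `^ q + (q - 1) * y `^ q.
  rewrite -ler_pdivlMl//; apply: (le_trans H); rewrite le_eqVlt; apply/orP; left.
  by apply/eqP; field; rewrite !gt_eqF.
have : y * y `^ (q - 1) = y `^ q by exact: mulr_powRB1.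
set Y := y `^ q => HY H; rewrite mulrBr -[q * _ * y]mulrA [_ * y]mulrC HY.
by rewrite [q * _ * x]mulrAC -mulrA; lra.
Qed.

Lemma normr_powR2 p x : (x ^+ 2) `^ (p / 2) = `|x| `^ p.
Proof.
rewrite -real_normK ?num_real// -powR_mulrn// -powRrM mulrC divfK//.
Qed.

(** Bernoulli's inequality for the squares. *)
Lemma normr_powR_sub p x y : 2 <= p ->
  `|y| `^ p - p * `|y| `^ (p - 2) * (y * x) + p / 2 * `|y| `^ (p - 2) * x ^+ 2
    <= `|x - y| `^ p.
Proof.
move=> p2; rewrite -[leRHS]normr_powR2 -(normr_powR2 p y).
have p21 : 1 <= p / 2 by rewrite ler_pdivlMr// mul1r.
have -> : `|y| `^ (p - 2) = (y ^+ 2) `^ (p / 2 - 1).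
  by rewrite -(normr_powR2 _ y); congr (_ `^ _); field.
apply: le_trans (powR_bernoulli p21 (sqr_ge0 _) (sqr_ge0 y)).
by rewrite le_eqVlt; apply/orP; left; apply/eqP; field.
Qed.

Lemma cvg_normr_powR0 r : 0 < r -> (fun h : R => `|h| `^ r) @ (0 : R) --> (0 : R).
Proof.
move=> r0; apply/cvgrPdist_lt => e e0.
have e'0 : 0 < e `^ r^-1 by rewrite powR_gt0.
have : \forall h \near (0 : R), `|h| < e `^ r^-1 by exact: nbhs0_lt.
apply: filterS => h he; rewrite sub0r normrN ger0_norm ?powR_ge0//.
have -> : e = (e `^ r^-1) `^ r by rewrite -powRrM mulVf ?gt_eqF// powRr1// ltW.
by rewrite gt0_ltr_powR// nnegrE powR_ge0.
Qed.

(** The function is odd, which reduces [x < 0] to [x > 0]. At 0 its difference quotient is [|h|^r],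
    which tends to 0 for [r > 0]; for [r = 0] the function is the identity, as [0^0 = 1]. *)
Lemma is_derive_normr_powRM r x : 0 <= r ->
  is_derive x 1 (fun y : R => `|y| `^ r * y) ((r + 1) * `|x| `^ r).
Proof.
rewrite le_eqVlt => /predU1P[<-|r0].
  under eq_fun do rewrite powRr0 mul1r.
  by rewrite powRr0 add0r mulr1; exact: is_derive_id.
have pos y : 0 < y -> is_derive y 1 (fun y : R => `|y| `^ r * y) ((r + 1) * `|y| `^ r).
  move=> y0; have E : \forall z \near y, z `^ (r + 1) = `|z| `^ r * z.
    near=> z; have z0 : 0 < z by near: z; exact: lt_nbhsr.
    by rewrite gtr0_norm// powRD ?powRr1 ?ltW// (gt_eqF z0) implybT.
  apply: near_eq_is_derive E _.
  by have := is_derive1_powR (r + 1) y0; rewrite addrK gtr0_norm.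
have [x0|x0|->] := ltgtP x 0.
- have D := pos (- x); rewrite oppr_gt0 in D.
  have := @is_derive1_comp R _ (fun y => - y) x _ _ (D x0) (is_deriveNid x 1).
  rewrite mulrN1 normrN => H.
  have := is_deriveN H; rewrite opprK; congr (is_derive _ _ _ _).
  apply/funext => y; change (- (`|- y| `^ r * - y) = `|y| `^ r * y).
  by rewrite normrN mulrN opprK.
- exact: pos.
- have E : (fun h : R => h^-1 *: (((fun y : R => `|y| `^ r * y) \o shift 0) (h *: 1) - `|0 : R| `^ r * 0)) @ (0 : R)^' -->
     (r + 1) * `|0 : R| `^ r.
    rewrite normr0 powR0 ?gt_eqF// !mulr0.
    have H : (fun h : R => `|h| `^ r) @ (0 : R)^' --> (0 : R).
      by apply: cvg_within_filter; exact: cvg_normr_powR0.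
    apply: cvg_trans H; apply: near_eq_cvg; near=> h.
    have h0 : h != 0 by near: h; exact: nbhs_dnbhs_neq.
    by rewrite /= addr0 [h *: 1]mulr1 subr0 /GRing.scale /= mulrCA mulVf ?mulr1.
  by apply: DeriveDef; [exact: cvgP E|exact: cvg_lim E].
Unshelve. all: end_near. Qed.

Lemma is_derive_normr_powR p x : 2 <= p ->
  is_derive x 1 (fun y : R => `|y| `^ p) (p * `|x| `^ (p - 2) * x).
Proof.
move=> p2; have p20 : 0 <= p - 2 by rewrite subr_ge0.
have E (y : R) : `|y| `^ p = `|y| `^ (p - 2) * y * y.
  rewrite -mulrA -expr2 -real_normK ?num_real// -[X in X ^+ 2]normr_id.
  rewrite normr_id -powR_mulrn// -powRD ?subrK//.
  by rewrite gt_eqF// (lt_le_trans _ p2).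
have D := is_deriveM (is_derive_normr_powRM x p20) (is_derive_id x 1).
have -> : (fun y : R => `|y| `^ p) = (fun y : R => `|y| `^ (p - 2) * y) * id.
  by apply/funext => y; rewrite E.
apply: is_derive_eq D _; rewrite /GRing.scale /=; ring.
Qed.

Lemma continuous_normr_powR r : 0 <= r -> continuous (fun x : R => `|x| `^ r).
Proof.
rewrite le_eqVlt => /predU1P[<- x|r0 x].
  by under eq_fun do rewrite powRr0; exact: cst_continuous.
have [->|x0] := eqVneq x 0.
  rewrite /continuous_at normr0 powR0 ?gt_eqF//; exact: cvg_normr_powR0.
apply: (@continuous_comp _ _ _ (fun x : R => `|x|) (fun x => x `^ r)).
  exact: norm_continuous.
apply: differentiable_continuous; apply/derivable1_diffP.
have nx0 : 0 < `|x| by rewrite normr_gt0.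
by have [] := is_derive1_powR r nx0.
Qed.

End real_powers.

Lemma ge0_integral_comb d (T : measurableType d) (R : realType)
    (m : {measure set T -> \bar R}) (f1 f2 : T -> R) (c1 c2 : R) :
  measurable_fun setT f1 -> measurable_fun setT f2 ->
  (forall x, 0 <= f1 x) -> (forall x, 0 <= f2 x) -> 0 <= c1 -> 0 <= c2 ->
  (c1%:E * \int[m]_x (f1 x)%:E + c2%:E * \int[m]_x (f2 x)%:E =
   \int[m]_x (c1 * f1 x + c2 * f2 x)%:E)%E.
Proof.
move=> mf1 mf2 f10 f20 c10 c20.
have I (f : T -> R) c : measurable_fun setT f -> (forall x, 0 <= f x) -> 0 <= c ->
    (c%:E * \int[m]_x (f x)%:E = \int[m]_x (c * f x)%:E)%E.
  move=> mf f0 c0; under [RHS]eq_integral do rewrite EFinM.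
  rewrite ge0_integralZl_EFin// => [x _|]; first by rewrite lee_fin.
  exact/measurable_EFinP.
rewrite !I//; under [RHS]eq_integral do rewrite EFinD.
rewrite ge0_integralD// => [x _||x _|].
- by rewrite lee_fin mulr_ge0.
- by apply/measurable_EFinP; exact: measurable_funM.
- by rewrite lee_fin mulr_ge0.
- by apply/measurable_EFinP; exact: measurable_funM.
Qed.

(** * Integrals on the line and Hardy's inequality *)

Section line_integrals.
Context {R : realType}.
Local Notation mu := (@lebesgue_measure R).
Implicit Types (f g h K : R -> R) (a b M : R).

Lemma measurable_EFin_continuous f (D : set R) : measurable D -> continuous f ->
  measurable_fun D (EFin \o f).
Proof.
move=> mD cf; apply/measurable_EFinP.
exact: measurable_funTS (continuous_measurable_fun cf).
Qed.

(** Both Bernoulli's and Hardy's inequalities are obtained from a pointwise inequality that holds up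
    to an exact derivative [K']; after integration only the boundary values of [K] remain. *)
Lemma le_integral_FTC f h K (K' : R -> R) a b : a < b ->
  continuous f -> continuous h -> continuous K' ->
  (forall x : R, is_derive x 1 K (K' x)) ->
  (forall x, 0 <= h x) -> (forall x, h x <= f x + K' x) ->
  (\int[mu]_(x in `[a, b]) (h x)%:E <=
   \int[mu]_(x in `[a, b]) (f x)%:E + (K b - K a)%:E)%E.
Proof.
move=> ab cf ch cK DK h0 hfK.
have W (g : R -> R) : continuous g -> {within `[a, b], continuous g}.
  by move=> cg; exact: continuous_subspaceT.
have I (g : R -> R) : continuous g -> mu.-integrable `[a, b] (EFin \o g).
  move=> cg; apply: continuous_compact_integrable; first exact: segment_compact.
  exact: W.
have cKK : continuous K.
  by move=> x; apply: differentiable_continuous; apply/derivable1_diffP; have [] := DK x.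
have <- : (\int[mu]_(x in `[a, b]) (K' x)%:E = (K b - K a)%:E)%E.
  rewrite EFinB; apply: continuous_FTC2 => //; first exact: W.
  - split.
    + by move=> x _; have [] := DK x.
    + by apply: cvg_at_right_filter; exact: cKK.
    + by apply: cvg_at_left_filter; exact: cKK.
  - by move=> x _; rewrite derive1E; exact: is_deriveW.
rewrite -integralD_EFin//; [|exact: I|exact: I].
apply: ge0_le_integral => //=.
- by move=> x _; rewrite lee_fin.
- exact: measurable_EFin_continuous.
- by apply: (@measurable_EFin_continuous (fun x => f x + K' x)) => // x; exact: (continuousD (cf x) (cK x)).
- by move=> x _; rewrite lee_fin.
Qed.

Lemma integral_itv_support f M : 0 < M -> (forall s, M < `|s| -> f s = 0) ->
  (\int[mu]_s (f s)%:E = \int[mu]_(s in `[(- M)%R, M]) (f s)%:E)%E.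
Proof.
move=> M0 fM; rewrite [RHS]integral_mkcond; apply: eq_integral => s _.
rewrite patchE; case: ifPn => //; rewrite notin_setE /= in_itv /= => /negP.
by rewrite -ler_norml -ltNge => /fM ->.
Qed.

(** Bounds on large intervals are enough by monotone convergence. The threshold [N0] lets the
    interval contain the singular point of Hardy's inequality. *)
Lemma integral_le_itv f (B : \bar R) (N0 : R) : continuous f -> (forall x, 0 <= f x) ->
  (forall N : R, (N0 < N)%R -> \int[mu]_(x in `[(- N)%R, N]) (f x)%:E <= B)%E ->
  (\int[mu]_x (f x)%:E <= B)%E.
Proof.
move=> cf f0 fB.
have T : \bigcup_i `[- (i%:R : R), i%:R]%classic = [set: R].
  rewrite -subTset => x _; exists (Num.truncn `|x|).+1 => //=.
  by rewrite in_itv /= -ler_norml ltW// truncnS_gt.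
have H : (\int[mu]_(x in `[(- (i%:R : R))%R, i%:R]) (f x)%:E @[i --> \oo] -->
    \int[mu]_(x in \bigcup_i `[(- (i%:R : R))%R, i%:R]%classic) (f x)%:E)%E.
  apply: (@ge0_nondecreasing_set_cvg_integral _ (measurableTypeR R) R
    (fun i : nat => `[- (i%:R : R), i%:R]%classic : set (measurableTypeR R)) (EFin \o f) mu).
  - move=> i j ij; rewrite subsetEset => x /=; rewrite !in_itv /= -!ler_norml.
    by move=> /le_trans; apply; rewrite ler_nat.
  - by move=> i; exact: measurable_itv.
  - by move=> i; exact: measurable_EFin_continuous.
  - by move=> i x _; rewrite lee_fin.
rewrite T in H; apply: cvge_le H.
exists (Num.truncn `|N0|).+1 => // i /= Ni; apply: fB.
apply: le_lt_trans (ler_norm _) _; apply: lt_le_trans (truncnS_gt _) _.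
by rewrite ler_nat.
Qed.

(** The difference quotient of [G] at [s0], continued by the derivative, so that it is continuous
    across [s0]. *)
Definition quot (G G' : R -> R) s0 s := if s == s0 then G' s0 else (G s - G s0) / (s - s0).

Lemma continuous_quot (G G' : R -> R) s0 : (forall x : R, is_derive x 1 G (G' x)) ->
  continuous (quot G G' s0).
Proof.
move=> DG s; have cG x : {for x, continuous G}.
  by apply: differentiable_continuous; apply/derivable1_diffP; have [] := DG x.
have [->|ss0] := eqVneq s s0.
  have Q0 : quot G G' s0 s0 = G' s0 by rewrite /quot eqxx.
  suff : quot G G' s0 @ s0 --> G' s0 by rewrite /continuous_at Q0.
  have [ex vl] := DG s0.
  have H : (fun h : R => h^-1 *: ((G \o shift s0) (h *: 1) - G s0)) @ (0 : R)^' --> G' s0.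
    by rewrite -vl; exact: ex.
  apply/cvgrPdist_lt => e e0; move/cvgrPdist_lt : H => /(_ e e0).
  rewrite near_withinE => H.
  have : \forall h \near (0 : R), `|G' s0 - quot G G' s0 (h + s0)| < e.
    apply: filterS H => h H; rewrite /quot.
    case: eqVneq => [_|hs]; first by rewrite subrr normr0.
    have h0 : h != 0 by apply: contra_neq hs => ->; rewrite add0r.
    by have := H h0; rewrite /= [h *: 1]mulr1 addrK /GRing.scale /= mulrC.
  move=> {}H; have K : \forall x \near s0, `|G' s0 - quot G G' s0 x| < e.
    by apply/nbhs0P; apply: filterS H => h; rewrite [h + s0]addrC.
  exact: K.
have E : \forall x \near s, (G x - G s0) / (x - s0) = quot G G' s0 x.
  near=> x; rewrite /quot ifF//; apply/negbTE.
  by near: x; apply: open_nbhs_nbhs; split => //; exact: open_neq.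
rewrite /continuous_at /quot (negbTE ss0).
have H : (fun x => (G x - G s0) / (x - s0)) @ s --> (G s - G s0) / (s - s0).
  apply: cvgM; first by apply: cvgB; [exact: cG|exact: cvg_cst].
  apply: cvgV; first by rewrite subr_eq0.
  by apply: cvgB; [exact: cvg_id|exact: cvg_cst].
by apply: cvg_trans H; apply: near_eq_cvg.
Unshelve. all: end_near. Qed.

(** The function is [(G - G s0)^2 / (s - s0)]. It is differentiable at [s0] too, although [quot] is
    merely continuous there: its difference quotient at [s0] is [quot^2]. *)
Lemma is_derive_quotM (G G' : R -> R) (s0 s : R) : (forall x : R, is_derive x 1 G (G' x)) ->
  is_derive s 1 (fun x => quot G G' s0 x * (G x - G s0))
    (2 * quot G G' s0 s * G' s - quot G G' s0 s ^+ 2).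
Proof.
move=> DG; have [->|ss0] := eqVneq s s0.
  have -> : 2 * quot G G' s0 s0 * G' s0 - quot G G' s0 s0 ^+ 2 = quot G G' s0 s0 ^+ 2.
    by rewrite /quot eqxx; ring.
  have E : (fun h : R => h^-1 *: (((fun x => quot G G' s0 x * (G x - G s0)) \o shift s0) (h *: 1)
      - quot G G' s0 s0 * (G s0 - G s0))) @ (0 : R)^' --> quot G G' s0 s0 ^+ 2.
    have H : (fun h : R => quot G G' s0 (h + s0) ^+ 2) @ (0 : R)^' --> quot G G' s0 s0 ^+ 2.
      apply: cvg_within_filter; rewrite expr2; under eq_fun do rewrite expr2.
      have c0 : (fun h : R => quot G G' s0 (h + s0)) @ (0 : R) --> quot G G' s0 s0.
        rewrite -[X in _ --> quot _ _ _ X]add0r.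
        apply: (@continuous_comp _ _ _ (fun h : R => h + s0) (quot G G' s0)).
          by apply: continuousD; [exact: cvg_id|exact: cvg_cst].
        exact: continuous_quot.
      exact: cvgM.
    apply: cvg_trans H; apply: near_eq_cvg; near=> h.
    have h0 : h != 0 by near: h; exact: nbhs_dnbhs_neq.
    rewrite /= [h *: 1]mulr1 subrr mulr0 subr0 /GRing.scale /=.
    have hs : (h + s0 == s0) = false.
      by apply/negbTE; apply: contra_neq h0 => /(congr1 (fun y => y - s0)); rewrite addrK subrr.
    by rewrite /quot hs addrK; field.
  by apply: DeriveDef; [exact: cvgP E|exact: cvg_lim E].
have ns0 : s - s0 != 0 by rewrite subr_eq0.
have E : \forall x \near s, (G x - G s0) / (x - s0) * (G x - G s0) = quot G G' s0 x * (G x - G s0).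
  near=> x; rewrite /quot ifF//; apply/negbTE.
  by near: x; apply: open_nbhs_nbhs; split => //; exact: open_neq.
apply: near_eq_is_derive E _.
have D1 : is_derive s 1 (fun x => G x - G s0) (G' s).
  by rewrite -[G' s]subr0; apply: is_deriveB.
have D2 : is_derive s 1 (fun x : R => (x - s0)^-1) (- (s - s0) ^- 2).
  rewrite -[- _ ^- 2]mulr1; apply: (@is_deriveV R (fun x => x - s0) s 1 1 ns0).
  by rewrite -[X in is_derive _ _ _ X]subr0; apply: is_deriveB.
apply: (is_derive_eq (is_deriveM (is_deriveM D1 D2) D1)).
rewrite /quot (negbTE ss0) /GRing.scale /= mulrfctE.
by field.
Unshelve. all: end_near. Qed.

(** Hardy's inequality with a singularity at [s0], for a function [G - G s0] that need not vanish
    far away. The condition [h s0 = 0] reflects the integrand of the distance, whose denominator is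
    0 at [s0] and whose value there is 0 by the convention for division. *)
Lemma hardy_line (G G' h : R -> R) s0 : continuous G' ->
  (forall x : R, is_derive x 1 G (G' x)) ->
  measurable_fun setT h -> (forall s, 0 <= h s) -> h s0 = 0 ->
  (forall s, s != s0 -> h s <= (G s - G s0) ^+ 2 / (s - s0) ^+ 2) ->
  (\int[mu]_s (h s)%:E <= 4%:E * \int[mu]_s (G' s ^+ 2)%:E)%E.
Proof.
move=> cG' DG mh h0 hs0 hq; set q := quot G G' s0.
have cq : continuous q by exact: continuous_quot.
have cq2 : continuous (fun x => q x ^+ 2).
  by under eq_fun do rewrite expr2; move=> x; apply: continuousM; exact: cq.
have cG2 : continuous (fun x => 4 * G' x ^+ 2).
  under eq_fun do rewrite expr2; move=> x.
  apply: (@continuousM _ _ (fun=> 4) (fun x => G' x * G' x)); first exact: cst_continuous.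
  by apply: continuousM; exact: cG'.
have q0 s : 0 <= q s ^+ 2 by exact: sqr_ge0.
have mG2 : measurable_fun setT (fun x => G' x ^+ 2).
  apply: measurable_funX; exact: continuous_measurable_fun.
apply: (@le_trans _ _ (\int[mu]_s (q s ^+ 2)%:E)%E).
  apply: ge0_le_integral => //=.
  - by move=> s _; rewrite lee_fin.
  - exact/measurable_EFinP.
  - by apply/measurable_EFinP; exact: continuous_measurable_fun.
  - move=> s _; rewrite lee_fin; have [->|ss0] := eqVneq s s0; first by rewrite hs0.
    by rewrite /q /quot (negbTE ss0) expr_div_n; exact: hq.
rewrite -ge0_integralZl_EFin//; last 2 first.
  by move=> s _; rewrite lee_fin sqr_ge0.
  exact/measurable_EFinP.
apply: (@integral_le_itv _ _ `|s0|) => // N sN.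
have N0 : 0 < N by rewrite (le_lt_trans _ sN).
(* With [K = q (G - G s0)], [(2 G' - q)^2 >= 0] reads [q^2 <= 4 G'^2 - 2 K']. *)
apply: (le_trans (@le_integral_FTC (fun x => 4 * G' x ^+ 2) (fun x => q x ^+ 2)
  (fun x => - 2 * (q x * (G x - G s0))) (fun x => - 2 * (2 * q x * G' x - q x ^+ 2)) (- N) N _ _ _ _ _ _ _)) => //.
- by rewrite gtrN.
- move=> x; apply: (@continuousM _ _ (fun=> - 2) (fun x => 2 * q x * G' x - q x ^+ 2)).
    exact: cst_continuous.
  apply: continuousB; last exact: cq2.
  apply: continuousM; last exact: cG'.
  by apply: (@continuousM _ _ (fun=> 2) q); [exact: cst_continuous|exact: cq].
- by move=> x; exact: (is_deriveZ (- 2) (is_derive_quotM s0 x DG)).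
- move=> x; have := sqr_ge0 (2 * G' x - q x); rewrite -subr_ge0.
  by move=> H; rewrite -subr_ge0; apply: le_trans H _; rewrite le_eqVlt; apply/orP; left; apply/eqP; ring.
have KN (x : R) : x != s0 -> q x * (G x - G s0) = (G x - G s0) ^+ 2 / (x - s0).
  by move=> xs; rewrite /q /quot (negbTE xs) expr2 mulrAC.
apply: (@le_trans _ _ (\int[mu]_(x in `[(- N)%R, N]) (4 * G' x ^+ 2)%:E)%E).
  rewrite -[leRHS]adde0 leeD2l// lee_fin -mulrBr mulNr oppr_le0 mulr_ge0// subr_ge0.
  rewrite !KN; last 2 first.
    by apply: contraTN sN => /eqP <-; rewrite ?normrN gtr0_norm// ltxx.
    by apply: contraTN sN => /eqP <-; rewrite ?normrN gtr0_norm// ltxx.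
  move: sN; rewrite ltr_norml => /andP[s1 s2].
  apply: (@le_trans _ _ 0).
    by rewrite mulr_ge0_le0 ?sqr_ge0// invr_le0 subr_le0 ltW.
  by rewrite divr_ge0 ?sqr_ge0// subr_ge0 ltW.
apply: ge0_subset_integral => //=.
- by apply: measurable_EFin_continuous.
- by move=> x _; rewrite lee_fin mulr_ge0// sqr_ge0.
Qed.

End line_integrals.

(** * First-order factors [D - a] acting on compactly supported functions *)

Section factors.
Context {R : realType}.
Local Notation mu := (@lebesgue_measure R).
Implicit Types (g h : R -> R) (a b p : R) (s : seq R).

Definition test1 g := smooth_on [set: R] g /\
  exists2 M, 0 < M & forall x, M < `|x| -> g x = 0.

Definition op a g : R -> R := fun x => 'D_1 g x - a * g x.

Definition ops s g := foldr op g s.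

Lemma smooth_on_op a g : smooth_on setT g -> smooth_on setT (op a g).
Proof.
move=> Sg; have oT : open [set: R] by exact: openT.
have -> : op a g = (fun x => 'D_1 g x + (- a) * g x).
  by apply/funext => x; rewrite /op mulNr.
apply: smooth_onD => //; first exact: smooth_on_derive.
by apply: smooth_onM => //; exact: smooth_on_cst.
Qed.

Lemma smooth_derivable g (x : R) : smooth_on setT g -> is_derive x 1 g ('D_1 g x).
Proof. by move=> /(_ 1) [_ /(_ 1)] [D _]; apply: derivableP; exact: D. Qed.

Lemma smooth_continuous g : smooth_on setT g -> continuous g.
Proof. by move=> /(_ 0) [c _] x; exact: c. Qed.

Lemma derive_support g (M x : R) : (forall x, M < `|x| -> g x = 0) ->
  M < `|x| -> 'D_1 g x = 0.
Proof.
move=> gM Mx; have E : \forall y \near x, cst 0 y = g y.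
  have o : open [set y : R | M < `|y|].
    apply: (@open_comp _ _ (fun y : R => `|y|) [set y : R | M < y]) => [y _|].
      exact: norm_continuous.
    exact: open_gt.
  by have := open_nbhs_nbhs (conj o Mx); apply: filterS => y /gM ->.
by rewrite -(near_eq_derive (1 : R) E) derive_cst.
Qed.

Lemma test1_op a g : test1 g -> test1 (op a g).
Proof.
move=> [Sg [M M0 gM]]; split; first exact: smooth_on_op.
by exists M => // x Mx; rewrite /op gM// (derive_support gM Mx) mulr0 subr0.
Qed.

Lemma test1_ops s g : test1 g -> test1 (ops s g).
Proof. by move=> tg; elim: s => //= a s; exact: test1_op. Qed.

Lemma op_comm a b g : smooth_on setT g -> op a (op b g) = op b (op a g).
Proof.
move=> Sg; apply/funext => x.
have Sg' : smooth_on setT ('D_1 g) by exact: smooth_on_derive.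
have D c : 'D_1 (op c g) x = 'D_1 ('D_1 g) x - c * 'D_1 g x.
  apply: is_deriveW; apply: is_deriveB.
    by apply: smooth_derivable; exact: Sg'.
  by apply: is_deriveZ; exact: smooth_derivable.
rewrite {1}/op [in RHS]/op !D /op; ring.
Qed.

Lemma ops_op s a g : smooth_on setT g -> ops s (op a g) = op a (ops s g).
Proof.
move=> Sg; elim: s => //= b s ->; apply: op_comm.
by elim: s => //= c s; exact: smooth_on_op.
Qed.

Lemma op_ineq p a g : 2 <= p -> test1 g ->
  ((`|a| `^ p)%:E * \int[mu]_x (`|g x| `^ p)%:E +
   (p / 2 * `|a| `^ (p - 2))%:E * \int[mu]_x (`|g x| `^ (p - 2) * 'D_1 g x ^+ 2)%:E
   <= \int[mu]_x (`|op a g x| `^ p)%:E)%E.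
Proof.
move=> p2 tg; have [Sg [M M0 gM]] := tg.
have [So _] := test1_op a tg.
have p0 : 0 < p by rewrite (lt_le_trans _ p2).
have pn0 : p != 0 by rewrite gt_eqF.
have p20 : 0 <= p - 2 by rewrite subr_ge0.
have cg := smooth_continuous Sg.
have cg' : continuous ('D_1 g) by exact: smooth_continuous (smooth_on_derive _ Sg).
have cP r (f : R -> R) : 0 <= r -> continuous f -> continuous (fun x => `|f x| `^ r).
  move=> r0 cf x; apply: (@continuous_comp _ _ _ f (fun x : R => `|x| `^ r)); first exact: cf.
  exact: continuous_normr_powR.
have cr : continuous (fun x => `|g x| `^ (p - 2) * 'D_1 g x ^+ 2).
  move=> x; apply: (@continuousM _ _ (fun x => `|g x| `^ (p - 2)) (fun x => 'D_1 g x * 'D_1 g x)).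
    exact: cP.
  by apply: continuousM; exact: cg'.
have r0 x : 0 <= `|g x| `^ (p - 2) * 'D_1 g x ^+ 2 by rewrite mulr_ge0 ?powR_ge0 ?sqr_ge0.
have k0 : 0 <= p / 2 * `|a| `^ (p - 2) by rewrite mulr_ge0 ?powR_ge0 ?divr_ge0 ?(ltW p0).
have cgp : continuous (fun x => `|g x| `^ p) by exact: (cP _ _ (ltW p0) cg).
rewrite ge0_integral_comb ?powR_ge0//; last 2 first.
- exact: continuous_measurable_fun.
- exact: continuous_measurable_fun.
pose h x := `|a| `^ p * `|g x| `^ p + p / 2 * `|a| `^ (p - 2) * (`|g x| `^ (p - 2) * 'D_1 g x ^+ 2).
have hM x : M < `|x| -> h x = 0.
  by move=> Mx; rewrite /h (derive_support gM Mx) gM// normr0 powR0// expr2 !mulr0 addr0.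
have fM x : M < `|x| -> `|op a g x| `^ p = 0.
  by move=> Mx; rewrite /op (derive_support gM Mx) gM// mulr0 subrr normr0 powR0.
(* The support condition is the strict [M < |x|], so the interval is enlarged to make [g] vanish at
   its endpoints. *)
have M1 : 0 < M + 1 by rewrite addr_gt0.
have M1M x : M + 1 < `|x| -> M < `|x| by apply: lt_trans; rewrite ltrDl.
rewrite (@integral_itv_support _ h (M + 1))//; last by move=> x /M1M; exact: hM.
rewrite (@integral_itv_support _ (fun x => `|op a g x| `^ p) (M + 1))//; last by move=> x /M1M; exact: fM.
have Dg x := smooth_derivable x Sg.
(* Bernoulli is applied with [y = a g] and [x = g']. Its cross term is then minus the derivative of
   [c |g|^p], and this primitive vanishes at both ends. *)
pose c := `|a| `^ (p - 2) * a.
pose K' x := c * (p * `|g x| `^ (p - 2) * g x * 'D_1 g x).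
have cK' : continuous K'.
  move=> x; apply: (@continuousM _ _ (fun=> c) (fun x => p * `|g x| `^ (p - 2) * g x * 'D_1 g x)).
    exact: cst_continuous.
  apply: continuousM; last exact: cg'.
  apply: continuousM; last exact: cg.
  apply: (@continuousM _ _ (fun=> p) (fun x => `|g x| `^ (p - 2))); first exact: cst_continuous.
  exact: cP.
have DK (x : R) : is_derive x 1 (fun x => c * `|g x| `^ p) (K' x).
  apply: is_deriveZ.
  exact: (@is_derive1_comp R (fun y => `|y| `^ p) g x _ _ (is_derive_normr_powR (g x) p2) (Dg x)).
apply: (le_trans (@le_integral_FTC _ (fun x => `|op a g x| `^ p) h _ K' (- (M + 1)) (M + 1)
   _ _ _ cK' DK _ _)).
- by rewrite gtrN.
- by apply: cP; [exact: ltW|exact: smooth_continuous].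
- move=> x; apply: (@continuousD _ _ _ (fun x => `|a| `^ p * `|g x| `^ p)
    (fun x => p / 2 * `|a| `^ (p - 2) * (`|g x| `^ (p - 2) * 'D_1 g x ^+ 2))).
    apply: (@continuousM _ _ (fun=> `|a| `^ p) (fun x => `|g x| `^ p)).
      exact: cst_continuous.
    exact: cgp.
  apply: (@continuousM _ _ (fun=> p / 2 * `|a| `^ (p - 2))
    (fun x => `|g x| `^ (p - 2) * 'D_1 g x ^+ 2)); first exact: cst_continuous.
  exact: cr.
- by move=> x; apply: addr_ge0; apply: mulr_ge0 => //; exact: powR_ge0.
- move=> x; have := normr_powR_sub ('D_1 g x) (a * g x) p2.
  rewrite normrM powRM// powRM// /K' /h /c -/(op a g x) => H.
  by rewrite -lerBlDr; apply: le_trans H; rewrite le_eqVlt; apply/orP; left; apply/eqP; ring.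
have g1 : g (M + 1) = 0 by apply: gM; rewrite gtr0_norm// ltrDl.
have g2 : g (- (M + 1)) = 0 by apply: gM; rewrite normrN gtr0_norm// ltrDl.
by rewrite g1 g2 subrr adde0.
Qed.

End factors.

(** * The remainder of a product of factors *)

Section remainder.
Context {R : realType}.
Local Notation mu := (@lebesgue_measure R).
Implicit Types (g h : R -> R) (a b p : R) (s : seq R).

(** Hardy's inequality for the signed power [G = |g|^((p - 2) / 2) g]. Since
    [G' = (p / 2) |g|^((p - 2) / 2) g'], the constant is [4 (p / 2)^2 = p^2]. *)
Lemma signed_remainder p g h (x0 : R) : 2 <= p -> smooth_on setT g ->
  measurable_fun setT h -> (forall x, 0 <= h x) -> h x0 = 0 ->
  (forall x, x != x0 ->
     h x <= (signed_pow p (g x) - signed_pow p (g x0)) ^+ 2 / (x - x0) ^+ 2) ->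
  (\int[mu]_x (h x)%:E <=
   (p ^+ 2)%:E * \int[mu]_x (`|g x| `^ (p - 2) * 'D_1 g x ^+ 2)%:E)%E.
Proof.
move=> p2 Sg mh h0 hs0 hq.
have cg := smooth_continuous Sg.
have cg' : continuous ('D_1 g) by exact: smooth_continuous (smooth_on_derive _ Sg).
have r0 : 0 <= (p - 2) / 2 by rewrite divr_ge0// subr_ge0.
pose G' x := ((p - 2) / 2 + 1) * `|g x| `^ ((p - 2) / 2) * 'D_1 g x.
have cr (r : R) : 0 <= r -> continuous (fun x => `|g x| `^ r).
  move=> r1 x; apply: (@continuous_comp _ _ _ g (fun x : R => `|x| `^ r)); first exact: cg.
  exact: continuous_normr_powR.
have cG' : continuous G'.
  move=> x; apply: (@continuousM _ _ (fun x => ((p - 2) / 2 + 1) * `|g x| `^ ((p - 2) / 2)) ('D_1 g)); last exact: cg'.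
  apply: (@continuousM _ _ (fun=> (p - 2) / 2 + 1) (fun x => `|g x| `^ ((p - 2) / 2))).
    exact: cst_continuous.
  exact: cr.
have DG (x : R) : is_derive x 1 (fun x => signed_pow p (g x)) (G' x).
  exact: (@is_derive1_comp R (fun y => signed_pow p y) g x _ _
    (is_derive_normr_powRM (g x) r0) (smooth_derivable x Sg)).
have := hardy_line cG' DG mh h0 hs0 hq.
move=> /le_trans; apply.
have p20 : 0 <= p - 2 by rewrite subr_ge0.
rewrite -!ge0_integralZl_EFin ?sqr_ge0//; last 4 first.
- by move=> x _; rewrite lee_fin mulr_ge0 ?powR_ge0 ?sqr_ge0.
- apply/measurable_EFinP; apply: measurable_funM.
    by apply: continuous_measurable_fun; exact: cr.
  by apply: measurable_funX; exact: continuous_measurable_fun.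
- by move=> x _; rewrite lee_fin sqr_ge0.
- by apply/measurable_EFinP; apply: measurable_funX; exact: continuous_measurable_fun.
rewrite le_eqVlt; apply/orP; left; apply/eqP; apply: eq_integral => x _.
rewrite -!EFinM; congr EFin; rewrite /G' !exprMn.
have -> : (`|g x| `^ ((p - 2) / 2)) ^+ 2 = `|g x| `^ (p - 2).
  by rewrite -powR_mulrn ?powR_ge0// -powRrM divfK.
by field.
Qed.

Lemma prodr_ge_exp (I : eqType) (t : seq I) (F : I -> R) (c : R) : 0 <= c ->
  (forall i, i \in t -> c <= F i) -> c ^+ size t <= \prod_(i <- t) F i.
Proof.
move=> c0; elim: t => [|i t IH] H; first by rewrite big_nil.
rewrite big_cons exprS ler_pM// ?exprn_ge0//; first by rewrite H ?mem_head.
by apply: IH => j jt; apply: H; rewrite inE jt orbT.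
Qed.

Lemma ops_ineq p s g : 2 <= p -> test1 g ->
  ((\prod_(b <- s) `|b| `^ p)%:E * \int[mu]_x (`|g x| `^ p)%:E
    <= \int[mu]_x (`|ops s g x| `^ p)%:E)%E.
Proof.
move=> p2 tg; elim: s => [|b s IH]; first by rewrite big_nil mul1e.
rewrite big_cons EFinM -muleA.
apply: le_trans (op_ineq b p2 (test1_ops s tg)).
apply: (@le_trans _ _ ((`|b| `^ p)%:E * \int[mu]_x (`|ops s g x| `^ p)%:E)%E).
  by apply: lee_wpmul2l IH; rewrite lee_fin powR_ge0.
rewrite leeDl// mule_ge0//.
  by rewrite lee_fin mulr_ge0 ?powR_ge0// divr_ge0// (le_trans _ p2).
by apply: integral_ge0 => x _; rewrite lee_fin mulr_ge0 ?powR_ge0 ?sqr_ge0.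
Qed.

(** A root that vanishes, if any, is put innermost: its remainder does not
    vanish, while the lower bounds of the other factors are multiplied. *)
Lemma ops_remainder p (d : R) s g h (x0 : R) : 2 <= p -> test1 g ->
  0 < d <= 1 -> s != [::] -> (forall b, b \in s -> b != 0 -> d <= `|b|) ->
  (count_mem (0%R : R) s <= 1)%N -> (2 < p -> 0 \notin s) ->
  measurable_fun setT h -> (forall x, 0 <= h x) -> h x0 = 0 ->
  (forall x, x != x0 ->
     h x <= (signed_pow p (g x) - signed_pow p (g x0)) ^+ 2 / (x - x0) ^+ 2) ->
  ((d `^ p ^+ size s / (2 * p))%:E * \int[mu]_x (h x)%:E +
   (\prod_(b <- s) `|b| `^ p)%:E * \int[mu]_x (`|g x| `^ p)%:E
    <= \int[mu]_x (`|ops s g x| `^ p)%:E)%E.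
Proof.
move=> p2 tg /andP[d0 d1] sn0 ds cs ps mh h0 hs0 hq.
have p0 : 0 < p by rewrite (lt_le_trans _ p2).
have p20 : 0 <= p - 2 by rewrite subr_ge0.
have Sg := tg.1.
have [a [as0 aP]] : exists a, a \in s /\ (0 \in s -> a = 0).
  have [s0in|s0n] := boolP (0 \in s); first by exists 0.
  by case: s sn0 {ds cs ps s0n} => // a s _; exists a; rewrite mem_head.
have [s1 [s2 sE]] : exists s1 s2, s = s1 ++ a :: s2.
  by case/splitPr: as0 => s1 s2; exists s1, s2.
have s12n0 b : b \in s1 ++ s2 -> d `^ p <= `|b| `^ p.
  move=> bs; have bs' : b \in s by rewrite sE mem_cat inE orbCA -mem_cat bs orbT.
  have b0 : b != 0.
    apply: contraTneq bs => b0; rewrite b0 in bs'.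
    have a0 := aP bs'; move: cs; rewrite sE count_cat /= a0 eqxx addnCA -count_cat.
    by rewrite add1n ltnS leqn0 => /eqP/count_memPn; rewrite b0.
  by apply: ge0_ler_powR; rewrite ?nnegrE ?(ltW p0) ?(ltW d0)//; exact: ds.
(* If [a = 0] then [p = 2], and the right side is [0^0 = 1]. Otherwise [d <= |a|], and [d <= 1]
   permits raising the exponent from [p - 2] to [p]. *)
have da : d `^ p <= `|a| `^ (p - 2).
  have [a0|an0] := eqVneq a 0.
    have -> : p = 2.
      apply/eqP; rewrite eq_le p2 andbT leNgt; apply/negP => /ps.
      by rewrite -a0 as0.
    by rewrite subrr powRr0 powR_mulrn ?(ltW d0)// exprn_ile1 ?(ltW d0).
  apply: (@le_trans _ _ (d `^ (p - 2))).
    by apply: ger_powR; [rewrite d0|rewrite gerBl].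
  by apply: ge0_ler_powR; rewrite ?nnegrE ?(ltW p0) ?(ltW d0)//; exact: ds.
have opsE : ops s g = ops (s1 ++ s2) (op a g).
  rewrite sE /ops !foldr_cat /= -/(ops s2 g) -/(ops s2 (op a g)).
  by rewrite (ops_op s2 a Sg).
have prodE (F : R -> R) : \prod_(b <- s) F b = \prod_(b <- s1 ++ s2) F b * F a.
  by rewrite sE !big_cat big_cons /=; ring.
have szE : size s = (size (s1 ++ s2)).+1 by rewrite sE !size_cat /= addnS.
have Pd := @prodr_ge_exp _ (s1 ++ s2) (fun b => `|b| `^ p) (d `^ p) (powR_ge0 _ _) s12n0.
rewrite opsE; apply: le_trans (ops_ineq (s1 ++ s2) p2 (test1_op a tg)).
rewrite prodE; set P := \prod_(b <- s1 ++ s2) _ in Pd *.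
have P0 : 0 <= P by rewrite (le_trans _ Pd)// exprn_ge0// powR_ge0.
apply: (@le_trans _ _ (P%:E * ((`|a| `^ p)%:E * \int[mu]_x (`|g x| `^ p)%:E +
   (p / 2 * `|a| `^ (p - 2))%:E * \int[mu]_x (`|g x| `^ (p - 2) * 'D_1 g x ^+ 2)%:E))%E); last first.
  by apply: lee_wpmul2l; [rewrite lee_fin|exact: op_ineq].
set E := (\int[mu]_x (`|g x| `^ (p - 2) * 'D_1 g x ^+ 2)%:E)%E.
have E0 : (0 <= E)%E.
  by apply: integral_ge0 => x _; rewrite lee_fin mulr_ge0 ?powR_ge0 ?sqr_ge0.
have I0 : (0 <= \int[mu]_x (`|g x| `^ p)%:E)%E.
  by apply: integral_ge0 => x _; rewrite lee_fin powR_ge0.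
have p20' : 0 <= p / 2 * `|a| `^ (p - 2) by rewrite mulr_ge0 ?powR_ge0 ?divr_ge0 ?(ltW p0).
rewrite [leRHS]ge0_muleDr; last 2 first.
- by rewrite mule_ge0// lee_fin powR_ge0.
- by rewrite mule_ge0// lee_fin.
rewrite [leRHS]addeC muleA -EFinM; apply: leeD; last by rewrite [in leRHS]muleA -EFinM.
apply: (@le_trans _ _ ((d `^ p ^+ size s / (2 * p))%:E * ((p ^+ 2)%:E * E))%E).
  apply: lee_wpmul2l; first by rewrite lee_fin divr_ge0 ?exprn_ge0 ?powR_ge0// mulr_ge0 ?(ltW p0).
  exact: (@signed_remainder p g h x0).
rewrite muleA -EFinM; apply: lee_wpmul2r => //; rewrite lee_fin.
(* One of the [size s] powers of [d] pays for the remainder of the innermost factor, the others for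
   the factors that contribute only [|b|^p]. *)
have -> : d `^ p ^+ size s / (2 * p) * p ^+ 2 = p / 2 * (d `^ p ^+ size (s1 ++ s2) * d `^ p).
  by rewrite szE exprSr; field; rewrite gt_eqF.
rewrite [leRHS]mulrCA; apply: ler_wpM2l; first by rewrite divr_ge0 ?(ltW p0).
by apply: ler_pM => //; rewrite ?exprn_ge0 ?powR_ge0.
Qed.

End remainder.

(** * Dilations and polar integration *)

Section dilations.
Context {R : realType}.
Local Notation leb := (@lebesgue_measure R).
Local Notation mR := (measurableTypeR R).

Lemma measurable_scale (c : R) : measurable_fun setT (fun x : mR => c * x : mR).
Proof. by apply: measurable_funM => //; exact: measurable_id. Qed.

(** The scaled push-forward agrees with Lebesgue measure on half-open intervals and hence
    everywhere; the change of variables is then integration against a push-forward. *)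
Lemma integral_scale (c : R) (F : mR -> \bar R) : 0 < c ->
  measurable_fun setT F -> (forall x, 0 <= F x)%E ->
  (\int[leb]_x F x = c%:E * \int[leb]_x F (c * x)%R)%E.
Proof.
move=> c0 mF F0; have cn : 0 <= c := ltW c0.
pose m : {measure set mR -> \bar R} := mscale (NngNum cn)
    (measure_function_pushforward__canonical__measure_function_Measure leb (measurable_scale c)).
have E : forall A, measurable A -> leb A = m A.
  apply: lebesgue_measure_unique => _ [[a b] _ <-] /=.
  change (leb `]a, b]%classic = c%:E * leb ((fun x : mR => (c * x)%R : mR) @^-1` `]a, b]%classic))%E.
  have -> : (fun x : mR => c * x : mR) @^-1` `]a, b]%classic = `]a / c, b / c]%classic.
    apply/seteqP; split => x /=; rewrite !in_itv /= ltr_pdivrMr// ler_pdivlMr// mulrC//.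
  rewrite !lebesgue_measure_itv /= !lte_fin ltr_pM2r ?invr_gt0//.
  case: ifP => _; last by rewrite mule0.
  by rewrite -!EFinB -EFinM -mulrBl mulrC divfK ?gt_eqF.
rewrite (eq_measure_integral m) => [|A mA _]; last exact: E.
rewrite /m ge0_integral_mscale//=; congr (_ * _)%E.
rewrite ge0_integral_pushforward//; exact: measurable_scale.
Qed.
End dilations.

Section tuple_measure.
Context {d} {T : measurableType d} {R : realType} {n : nat}.
Variables (m1 : {sigma_finite_measure set T -> \bar R})
  (m2 : {sigma_finite_measure set (n.-tuple T) -> \bar R}).

Lemma integral_cons_measure (F : n.+1.-tuple T -> \bar R) :
  measurable_fun setT F -> (forall v, 0 <= F v)%E ->
  (\int[cons_measure m1 m2]_v F v = \int[m1]_x \int[m2]_v F (tuple_cons (x, v)))%E.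
Proof.
move=> mF F0; rewrite ge0_integral_pushforward//; last exact: measurable_tuple_cons.
rewrite preimage_setT fubini_tonelli1 => [//||z]; last exact: F0.
by apply: measurableT_comp => //; exact: measurable_tuple_cons.
Qed.
End tuple_measure.

Section grushin_dilations.
Context {R : realType} {n : nat}.
Local Notation mR := (measurableTypeR R).

Definition scale_tuple (c : R) m (v : m.-tuple mR) : m.-tuple mR :=
  [tuple of [seq c * x | x <- v]].

Lemma measurable_scale_tuple c m : measurable_fun setT (@scale_tuple c m).
Proof.
apply/measurable_fun_tnthP => i.
rewrite (_ : _ \o _ = (fun x : mR => c * x : mR) \o (tnth (T:=mR))^~ i).
  by apply: measurableT_comp; [exact: measurable_scale|exact: measurable_tnth].
by apply/funext => v; rewrite /= tnth_map.
Qed.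

Lemma integral_scale_tuple (c : R) m (F : m.-tuple mR -> \bar R) : 0 < c ->
  measurable_fun setT F -> (forall v, 0 <= F v)%E ->
  (\int[lebesgue_tuple R m]_v F v =
   (c ^+ m)%:E * \int[lebesgue_tuple R m]_v F (scale_tuple c v))%E.
Proof.
move=> c0; elim: m F => [|m IH] F mF F0.
  rewrite expr0 mul1e; apply: eq_integral => v _.
  by congr F; apply/val_inj; rewrite [v]tuple0.
have mFs : measurable_fun setT (F \o @scale_tuple c m.+1).
  by apply: measurableT_comp => //; exact: measurable_scale_tuple.
have mFx (x : mR) : measurable_fun setT (fun v => F (tuple_cons (x, v))).
  apply: measurableT_comp => //; apply: measurableT_comp; first exact: measurable_tuple_cons.
  exact: measurable_pair1.
pose G x := (\int[lebesgue_tuple R m]_v F (tuple_cons (x, v)))%E.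
have mG : measurable_fun setT G.
  apply: (@measurable_fun_fubini_tonelli_F _ _ _ _ _ (lebesgue_tuple R m) (F \o tuple_cons)) => //.
    by apply: measurableT_comp => //; exact: measurable_tuple_cons.
  by move=> z; exact: F0.
have G0 x : (0 <= G x)%E by apply: integral_ge0 => v _; exact: F0.
rewrite /= integral_cons_measure// (integral_scale c0 mG G0).
rewrite (integral_cons_measure _ _ mFs); last by move=> v; exact: F0.
have E (x : mR) : G (c * x) = ((c ^+ m)%:E * \int[lebesgue_tuple R m]_v F (scale_tuple c (tuple_cons (x, v))))%E.
  rewrite /G IH//; congr (_ * _)%E; apply: eq_integral => v _; congr F.
  exact/val_inj.
under eq_integral do rewrite E.
rewrite ge0_integralZl_EFin//; last 3 first.
- by move=> x _; apply: integral_ge0 => v _; exact: F0.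
- apply: (@measurable_fun_fubini_tonelli_F _ _ _ _ _ (lebesgue_tuple R m) (F \o @scale_tuple c m.+1 \o tuple_cons)) => //.
    by apply: measurableT_comp => //; exact: measurable_tuple_cons.
  by move=> z; exact: F0.
- by rewrite exprn_ge0// ltW.
by rewrite muleA -EFinM exprS.
Qed.

End grushin_dilations.

Lemma open_neq0 {R : realType} {V : normedModType R} : open [set z : V | z != 0].
Proof.
have -> : [set z : V | z != 0] = ~` [set 0].
  by apply/seteqP; split => z /= /eqP.
apply: closed_openC; apply: accessible_closed_set1; apply: hausdorff_accessible.
exact: norm_hausdorff.
Qed.

(** * From continuity off the origin to measurability *)

Section grushin_measurability.
Context {R : realType} {n : nat}.
Local Notation mR := (measurableTypeR R).
Local Notation T := (n.-tuple mR * mR)%type.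
Local Notation G := (grushin R n).
Local Notation pt := (@grushin_pt R n).

Lemma measurable_abs_lt (q r : R) : measurable [set x : mR | `|x - q| < r].
Proof.
have -> : [set x : mR | `|x - q| < r] = `]q - r, q + r[%classic.
  by apply/seteqP; split => x /=; rewrite in_itv /= ltr_distl.
exact: measurable_itv.
Qed.

(** Links the topology of [grushin R n], given by the sup norm on row vectors, with the product
    sigma-algebra on tuples: an open set is a countable union of boxes with rational centre and
    radius. *)
Lemma measurable_pt_open (U : set G) : open U -> measurable (pt @^-1` U).
Proof.
move=> oU.
pose box (c : 'rV[rat]_n * rat * rat) : set T :=
  [set z | (forall i, `|tnth z.1 i - ratr (c.1.1 0 i)| < ratr c.2) /\
           `|z.2 - ratr c.1.2| < ratr c.2].
have mbox c : measurable (box c).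
  have -> : box c = (\bigcap_(i in [set: 'I_n])
       ((fun z : T => tnth z.1 i) @^-1` [set x : mR | `|x - ratr (c.1.1 0 i)| < ratr c.2]))
     `&` (snd @^-1` [set x : mR | `|x - ratr c.1.2| < ratr c.2]).
    apply/seteqP; split => z /= [z1 z2]; split => // i; [move=> _; exact: z1|exact: (z1 i)].
  apply: measurableI.
    apply: fin_bigcap_measurable => // i _; rewrite -[X in measurable X]setTI.
    have m : measurable_fun setT ((fun v : n.-tuple mR => tnth v i) \o (@fst (n.-tuple mR) mR)).
      by apply: measurableT_comp; [exact: measurable_tnth|exact: measurable_fst].
    by apply: m => //; exact: measurable_abs_lt.
  rewrite -[X in measurable X]setTI.
  by apply: (@measurable_snd _ _ _ mR) => //; exact: measurable_abs_lt.
pose D := [set c | box c `<=` pt @^-1` U].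
have -> : pt @^-1` U = \bigcup_c (if `[< D c >] then box c else set0).
  apply/seteqP; split => [z Uz|z [c _]]; last first.
    by case: ifPn => [/asboolP Dc|_ []]; exact: Dc.
  have /nbhs_ballP[e /= e0 eU] : nbhs (pt z) U by exact: open_nbhs_nbhs.
  have e20 : 0 < e / 2 by rewrite divr_gt0.
  have [r] := rat_in_itvoo e20; rewrite in_itv /= => /andP[r0 re].
  have Q (x : R) : exists q : rat, `|x - ratr q| < ratr r.
    have : x - ratr r < x + ratr r by rewrite ltr_wpDr// ?ltW// gtrBl.
    move=> /rat_in_itvoo[q]; rewrite in_itv /= => qI; exists q.
    by rewrite distrC ltr_distl.
  have /choice[q qP] : forall i : 'I_n, exists q : rat, `|tnth z.1 i - ratr q| < ratr r.
    by move=> i; exact: Q.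
  have [t tP] := Q z.2.
  exists (\row_i q i, t, r) => //; rewrite ifT; last first.
    apply/asboolP => w [w1 w2] /=; apply: eU; split => /=.
      split => // i j; rewrite /ball /= !mxE.
      have := w1 j; rewrite /= mxE => w1j.
      rewrite (splitr e); apply: le_lt_trans (ler_distD (ratr (q j)) _ _) _.
      by rewrite ltrD// ?(lt_trans _ re)// ?qP// distrC.
    rewrite /ball /= (splitr e); apply: le_lt_trans (ler_distD (ratr t) _ _) _.
    by rewrite ltrD// ?(lt_trans _ re)// distrC.
  by split => [i|] //=; rewrite mxE.
apply: countable_bigcupT_measurable; first exact: countableP.
by move=> c; case: ifP.
Qed.

(** Continuity is available off the origin only. Whatever value [f] has at the origin, that point
    adds to a preimage either nothing or the preimage of a closed set. *)
Lemma measurable_pt (f : G -> R) : (forall z, z != 0 -> {for z, continuous f}) ->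
  measurable_fun setT (f \o pt).
Proof.
move=> cf; apply: (measurability _ (RGenOpens.measurableE R)).
move=> _ [_ [a [b ->] <-]]; rewrite setTI.
have -> : (f \o pt) @^-1` `]a, b[ =
    pt @^-1` ([set z | z != 0] `&` f @^-1` `]a, b[) `|`
    (if f 0 \in `]a, b[ then ~` (pt @^-1` [set z | z != 0]) else set0).
  apply/seteqP; split => z /=.
    move=> fz; have [z0|z0] := eqVneq (pt z) 0; [right|by left].
    by rewrite z0 in fz; rewrite fz /= z0 eqxx.
  move=> [[]//|]; case: ifP => //= f0 /negP; rewrite negbK => /eqP ->.
  exact: f0.
have o0 : open [set z : G | z != 0] by exact: open_neq0.
apply: measurableU; last first.
  by case: ifP => // _; apply: measurableC; exact: measurable_pt_open.
apply: measurable_pt_open.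
rewrite openE => z [z0 fz] /=; apply: filterI; first exact: open_nbhs_nbhs.
apply: (cf z z0); apply: open_nbhs_nbhs; split => //; exact: interval_open.
Qed.

End grushin_measurability.

HB.instance Definition _ (R : realType) (n : nat) := Measure.on (@grushin_measure R n).

HB.instance Definition _ (R : realType) (n : nat) :=
  Measure_isSigmaFinite.Build _ _ _ (@grushin_measure R n)
    (sigma_finite_prod (lebesgue_tuple R n) (@lebesgue_measure R)).

Section polar.
Context {R : realType} {n : nat}.
Local Notation mR := (measurableTypeR R).
Local Notation leb := (@lebesgue_measure R).
Local Notation T := (n.-tuple mR * mR)%type.
Local Notation G := (grushin R n).
Local Notation pt := (@grushin_pt R n).
Local Notation gm := (@grushin_measure R n).

Definition dilT (s : R) (z : T) : T := (scale_tuple (expR s) z.1, expR s ^+ 2 * z.2).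

Definition dil (s : R) (z : G) : G := (expR s *: z.1, expR s ^+ 2 * z.2).

Lemma pt_dilT s z : pt (dilT s z) = dil s (pt z).
Proof.
congr pair; apply/rowP => i.
by rewrite !mxE tnth_map.
Qed.

Lemma dilD s t z : dil s (dil t z) = dil (s + t) z.
Proof. by rewrite /dil /= scalerA expRD exprMn mulrA. Qed.

Lemma dil0 z : dil 0 z = z.
Proof. by rewrite /dil expR0 scale1r expr1n mul1r; case: z. Qed.

Lemma measurable_dilT2 : measurable_fun setT (fun zs : T * mR => dilT zs.2 zs.1).
Proof.
have me : measurable_fun setT (fun zs : T * mR => expR zs.2 : mR).
  apply: measurableT_comp; first exact: measurable_expR.
  exact: measurable_snd.
have m1 : measurable_fun setT (fun zs : T * mR => zs.1.1).
  by apply: measurableT_comp; [exact: measurable_fst|exact: measurable_fst].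
have m2 : measurable_fun setT (fun zs : T * mR => zs.1.2).
  by apply: measurableT_comp; [exact: measurable_snd|exact: measurable_fst].
apply: measurable_fun_pair.
  apply/measurable_fun_tnthP => i.
  have -> : (tnth (T:=mR))^~ i \o (fun zs : T * mR => scale_tuple (expR zs.2) zs.1.1)
     = (fun zs => expR zs.2 * tnth zs.1.1 i).
    by apply/funext => zs; rewrite /= tnth_map.
  apply: measurable_funM => //.
  exact: (measurableT_comp (measurable_tnth i) m1).
by apply: measurable_funM => //; apply: measurable_funX.
Qed.

Lemma measurable_dilT s : measurable_fun setT (dilT s).
Proof.
have -> : dilT s = (fun zs : T * mR => dilT zs.2 zs.1) \o (fun z => (z, s : mR)) by [].
apply: measurableT_comp; first exact: measurable_dilT2.
exact: measurable_pair2.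
Qed.

Lemma integral_dilT s (F : T -> \bar R) : measurable_fun setT F -> (forall z, 0 <= F z)%E ->
  (\int[gm]_z F z = (expR s ^+ (n + 2))%:E * \int[gm]_z F (dilT s z))%E.
Proof.
move=> mF F0; have mFs : measurable_fun setT (F \o dilT s).
  by apply: measurableT_comp => //; exact: measurable_dilT.
rewrite /grushin_measure fubini_tonelli1//.
rewrite (fubini_tonelli1 _ mFs); last by move=> z; exact: F0.
have mG := @measurable_fun_fubini_tonelli_F _ _ _ _ _ leb F mF F0.
have G0 v : (0 <= fubini_F leb F v)%E by apply: integral_ge0 => t _; exact: F0.
rewrite (integral_scale_tuple (expR_gt0 s) mG G0).
have E v : fubini_F leb F (scale_tuple (expR s) v) =
    ((expR s ^+ 2)%:E * fubini_F leb (F \o dilT s) v)%E.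
  rewrite /fubini_F (@integral_scale _ (expR s ^+ 2)) ?exprn_gt0 ?expR_gt0//.
  by apply: measurableT_comp => //; exact: measurable_pair1.
under eq_integral do rewrite E.
rewrite ge0_integralZl_EFin ?exprn_ge0 ?expR_ge0//; last 2 first.
- by move=> v _; apply: integral_ge0 => t _; exact: F0.
- by apply: (@measurable_fun_fubini_tonelli_F _ _ _ _ _ leb (F \o dilT s) mFs) => z; exact: F0.
by rewrite muleA -EFinM exprD.
Qed.

(** The shell [1 <= rho <= e] meets each orbit of the dilations in a segment of
    logarithmic length one. *)
Definition shell (z : G) : R :=
  if (0 < rho z) && (0 <= ln (rho z) <= 1) then 1 else 0.

Lemma shell_ge0 z : 0 <= shell z.
Proof. by rewrite /shell; case: ifP. Qed.

Lemma enorm_ge0 (x : 'rV[R]_n) : 0 <= enorm x.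
Proof. exact: sqrtr_ge0. Qed.

Lemma enorm_sqr (x : 'rV[R]_n) : enorm x ^+ 2 = \sum_i x 0 i ^+ 2.
Proof. by rewrite sqr_sqrtr// sumr_ge0// => i _; exact: sqr_ge0. Qed.

Lemma rho4_ge0 (z : G) : 0 <= enorm z.1 ^+ 4 + 4 * z.2 ^+ 2.
Proof. by apply: addr_ge0; [exact/exprn_ge0/enorm_ge0|apply: mulr_ge0 => //; exact: sqr_ge0]. Qed.

Lemma enormZ (c : R) (x : 'rV[R]_n) : enorm (c *: x) = `|c| * enorm x.
Proof.
rewrite /enorm; under eq_bigr do rewrite mxE exprMn.
by rewrite -mulr_sumr sqrtrM ?sqr_ge0// sqrtr_sqr.
Qed.

Lemma rho_dil s z : rho (dil s z) = expR s * rho z.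
Proof.
rewrite /rho /= enormZ ger0_norm ?expR_ge0//.
have -> : (expR s * enorm z.1) ^+ 4 + 4 * (expR s ^+ 2 * z.2) ^+ 2 =
   expR s ^+ 4 * (enorm z.1 ^+ 4 + 4 * z.2 ^+ 2) by ring.
have S0 := rho4_ge0 z.
have e0 : 0 <= expR s ^+ 4 by rewrite exprn_ge0 ?expR_ge0.
rewrite powRM// -powR_mulrn ?expR_ge0// -powRrM mulrCA divff// mulr1.
by rewrite powRr1 ?expR_ge0.
Qed.

Lemma rho0 : rho (0 : G) = 0.
Proof.
rewrite /rho /= /enorm big1 => [|i _]; last by rewrite mxE expr0n.
by rewrite sqrtr0 !expr0n /= mulr0 addr0 powR0.
Qed.

Lemma rho_ge0 z : 0 <= rho (z : G).
Proof. exact: powR_ge0. Qed.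

Lemma rho_gt0 z : z != 0 -> 0 < rho (z : G).
Proof.
move=> z0; apply: powR_gt0; rewrite lt_neqAle eq_sym rho4_ge0 andbT.
apply: contra_neq z0; rewrite (exprM _ 2 2) enorm_sqr => /eqP.
have b0 : 0 <= 4 * z.2 ^+ 2 by apply: mulr_ge0 => //; exact: sqr_ge0.
rewrite paddr_eq0 ?sqr_ge0// !(expf_eq0, mulf_eq0, pnatr_eq0) /=.
rewrite psumr_eq0 => [|i _]; last exact: sqr_ge0.
case: z {b0} => x t /= /andP[/allP x0 /eqP ->]; congr pair; apply/rowP => i.
by rewrite mxE; apply/eqP; rewrite -sqrf_eq0; apply: x0; rewrite mem_index_enum.
Qed.

(** The point [dil (- s) z] is in the shell exactly for [ln (rho z) - 1 <= s <= ln (rho z)]. The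
    translates of [shell] thus form a continuous partition of unity on each orbit. *)
Lemma shell_integral z : z != 0 -> (\int[leb]_s (shell (dil (- s) z))%:E = 1)%E.
Proof.
move=> z0; have rz := rho_gt0 z0.
have E s : shell (dil (- s) z) = \1_(`[ln (rho z) - 1, ln (rho z)]%classic : set mR) s.
  rewrite /shell rho_dil mulr_gt0 ?expR_gt0//= lnM ?posrE ?expR_gt0// expRK.
  rewrite indicE mem_setE in_itv /= lerBlDr.
  rewrite addrC subr_ge0 [_ - _ <= 1]lerBlDr andbC [1 + _]addrC.
  by case: ifP.
under eq_integral do rewrite E.
rewrite integral_indic// setIT /= lebesgue_measure_itv /= lte_fin gtrBl ltr01.
by rewrite -EFinB opprB addrC subrK.
Qed.

Lemma measurable_shell : measurable_fun setT (@rho R n \o pt) ->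
  measurable_fun setT (shell \o pt).
Proof.
move=> mrho.
have -> : shell \o pt = (fun r : mR => if (0 < r) && (0 <= ln r <= 1) then 1 else 0) \o (@rho R n \o pt) by [].
apply: measurableT_comp => //; apply: measurable_fun_ifT => //.
apply: measurable_and; first exact: measurable_fun_ltr.
by apply: measurable_and; apply: measurable_fun_ler => //; exact: measurable_ln.
Qed.

(** Write 1 as the integral over [s] of [shell (dil (- s) z)], exchange the integrals, and
    substitute [dil s z] for [z], with Jacobian [expR s ^+ (n + 2)]. At the origin this formula for
    1 fails, and [f 0 = 0] takes its place. The first conclusion is the measurability on which
    comparisons of such integrals rest. *)
Lemma polar (f : G -> R) : measurable_fun setT (@rho R n \o pt) ->
  measurable_fun setT (f \o pt) ->
  (forall z, 0 <= f z) -> f 0 = 0 ->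
  measurable_fun setT (fun z => \int[leb]_s
    (shell (pt z) * (f (dil s (pt z)) * expR s ^+ (n + 2)))%:E)%E /\
  (gintegral f = \int[gm]_z \int[leb]_s
     (shell (pt z) * (f (dil s (pt z)) * expR s ^+ (n + 2)))%:E)%E.
Proof.
move=> mrho mf f0 f00.
have mshell := measurable_shell mrho.
have msh : measurable_fun setT (fun zs : T * mR => shell (dil (- zs.2) (pt zs.1))).
  have -> : (fun zs : T * mR => shell (dil (- zs.2) (pt zs.1))) = (shell \o pt) \o
     ((fun zs : T * mR => dilT zs.2 zs.1) \o (fun zs => (zs.1, - zs.2))).
    by apply/funext => zs; rewrite /= pt_dilT.
  apply: (measurableT_comp mshell); apply: (measurableT_comp measurable_dilT2).
  apply: measurable_fun_pair; first exact: measurable_fst.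
  by apply: measurableT_comp => //; exact: measurable_snd.
have mfd : measurable_fun setT (fun zs : T * mR => f (dil zs.2 (pt zs.1))).
  have -> : (fun zs : T * mR => f (dil zs.2 (pt zs.1))) = (f \o pt) \o (fun zs : T * mR => dilT zs.2 zs.1).
    by apply/funext => zs; rewrite /= pt_dilT.
  exact: (measurableT_comp mf measurable_dilT2).
have me : measurable_fun setT (fun zs : T * mR => expR zs.2 ^+ (n + 2)).
  apply: measurable_funX; apply: measurableT_comp; first exact: measurable_expR.
  exact: measurable_snd.
have sec1 (F : T * mR -> mR) z : measurable_fun setT F -> measurable_fun setT (fun s => F (z, s)).
  by move=> mF; apply: measurableT_comp => //; exact: measurable_pair1.
have sec2 (F : T * mR -> mR) s : measurable_fun setT F -> measurable_fun setT (fun z => F (z, s)).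
  by move=> mF; apply: measurableT_comp => //; exact: measurable_pair2.
pose F1 (zs : T * mR) := (f (pt zs.1) * shell (dil (- zs.2) (pt zs.1)))%:E.
pose F2 (zs : T * mR) := (shell (pt zs.1) * (f (dil zs.2 (pt zs.1)) * expR zs.2 ^+ (n + 2)))%:E.
have mF1 : measurable_fun setT F1.
  apply/measurable_EFinP; apply: measurable_funM => //.
  exact: (measurableT_comp mf measurable_fst).
have mF2 : measurable_fun setT F2.
  apply/measurable_EFinP; apply: measurable_funM; last exact: measurable_funM.
  exact: (measurableT_comp mshell measurable_fst).
have F10 zs : (0 <= F1 zs)%E by rewrite lee_fin mulr_ge0 ?f0 ?shell_ge0.
have e0 s : 0 <= expR s ^+ (n + 2) by rewrite exprn_ge0 ?expR_ge0.
have F20 zs : (0 <= F2 zs)%E by rewrite lee_fin mulr_ge0 ?shell_ge0// mulr_ge0.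
split; first exact: (@measurable_fun_fubini_tonelli_F _ _ _ _ _ leb F2 mF2 F20).
rewrite /gintegral; transitivity (\int[gm]_z \int[leb]_s F1 (z, s))%E.
  apply: eq_integral => z _; rewrite /F1 /=; have [->|z0] := eqVneq (pt z) 0.
    by rewrite f00; under eq_integral do rewrite mul0r; rewrite integral0.
  under eq_integral do rewrite EFinM.
  rewrite ge0_integralZl_EFin//; last 2 first.
  - by move=> s _; rewrite lee_fin shell_ge0.
  - by apply/measurable_EFinP; exact: (sec1 _ z msh).
  by rewrite shell_integral// mule1.
change (\int[gm]_z \int[leb]_s F1 (z, s) = \int[gm]_z \int[leb]_s F2 (z, s))%E.
rewrite (fubini_tonelli _ mF1 F10) (fubini_tonelli _ mF2 F20).
apply: eq_integral => s _.
rewrite (integral_dilT s); last 2 first.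
- by apply: measurableT_comp => //; exact: measurable_pair2.
- by move=> z; exact: F10.
rewrite -ge0_integralZl_EFin//; last first.
  have -> : (fun z => F1 (dilT s z, s)) = (fun z => F1 (z, s)) \o dilT s by [].
  apply: measurableT_comp; last exact: measurable_dilT.
  by apply: measurableT_comp => //; exact: measurable_pair2.
apply: eq_integral => z _; rewrite /F1 /F2 /= pt_dilT dilD addNr dil0 -EFinM.
by congr EFin; ring.
Qed.

End polar.

(** * Radial operators along the orbits *)

Section nice.
Context {R : realType} {n : nat}.
Local Notation G := (grushin R n).
Implicit Types (u : G -> R) (z w : G).

Definition punctured : set G := [set z | z != 0].

Lemma open_punctured : open punctured.
Proof. exact: open_neq0. Qed.

Lemma smooth_coord (A : set G) (i : 'I_n) : smooth_on A (fun z => z.1 0 i).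
Proof.
move=> k; apply: Ck_on_linear => [z|h v z]; last by rewrite /= !mxE.
apply: (@continuous_comp _ _ _ (fst : G -> 'rV[R]_n) (fun x => x 0 i)).
  exact: cvg_fst.
exact: coord_continuous.
Qed.

Lemma smooth_snd (A : set G) : smooth_on A (fun z => z.2).
Proof.
move=> k; apply: Ck_on_linear => [z|h v z] //.
exact: cvg_snd.
Qed.

Lemma smooth_enorm2 (A : set G) : open A -> smooth_on A (fun z => enorm z.1 ^+ 2).
Proof.
move=> oA; apply: (@smooth_on_eq _ _ _ oA (fun z => \sum_i z.1 0 i ^+ 2)).
  by move=> z _; rewrite enorm_sqr.
apply: smooth_on_sum => // i; apply: smooth_onX => //; exact: smooth_coord.
Qed.

Lemma smooth_rho4 (A : set G) : open A ->
  smooth_on A (fun z => enorm z.1 ^+ 4 + 4 * z.2 ^+ 2).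
Proof.
move=> oA; apply: smooth_onD => //.
  have -> : (fun z : G => enorm z.1 ^+ 4) = (fun z => (enorm z.1 ^+ 2) ^+ 2).
    by apply/funext => z; rewrite -exprM.
  by apply: smooth_onX => //; exact: smooth_enorm2.
apply: smooth_onM => //; first exact: smooth_on_cst.
by apply: smooth_onX => //; exact: smooth_snd.
Qed.

Lemma rho4_gt0 z : z != 0 -> 0 < enorm z.1 ^+ 4 + 4 * z.2 ^+ 2.
Proof.
move=> /rho_gt0; rewrite /rho lt_neqAle eq_sym powR_eq0 => /andP[+ _].
by rewrite lt_neqAle eq_sym rho4_ge0 andbT; apply: contra => ->; rewrite andTb.
Qed.

Lemma smooth_rho : smooth_on punctured (@rho R n).
Proof.
apply: smooth_on_powR; first exact: open_punctured.
  by move=> z; exact: rho4_gt0.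
exact/smooth_rho4/open_punctured.
Qed.

Lemma smooth_rhoV : smooth_on punctured (fun z => (rho z)^-1).
Proof.
apply: smooth_onV; [exact: open_punctured| |exact: smooth_rho].
by move=> z; exact: rho_gt0.
Qed.

Lemma smooth_psi : smooth_on punctured (@psi R n).
Proof.
have oP := open_punctured.
have -> : @psi R n = (fun z => enorm z.1 ^+ 2 * (rho z)^-1 ^+ 2).
  by apply/funext => z; rewrite /psi exprVn.
apply: smooth_onM => //; first exact: smooth_enorm2.
by apply: smooth_onX => //; exact: smooth_rhoV.
Qed.

(** Smooth functions supported in an annulus around the origin: a class that contains the test
    functions and is stable under the radial operators. The value at the origin is left free, since
    [drho] divides by [rho], which is 0 there. *)
Definition nice u := smooth_on punctured u /\
  exists M, forall z, z != 0 -> M < `|ln (rho z)| -> u z = 0.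

Lemma niceM (m : G -> R) u : smooth_on punctured m -> nice u ->
  nice (fun z => m z * u z).
Proof.
move=> Sm [Su [M uM]]; split; first exact: smooth_onM open_punctured _ _ _ _.
by exists M => z z0 /(uM _ z0) ->; rewrite mulr0.
Qed.

Lemma niceD u v : nice u -> nice v -> nice (fun z => u z + v z).
Proof.
move=> [Su [M uM]] [Sv [M' vM]]; split; first exact: smooth_onD open_punctured _ _ _ _.
exists (Num.max M M') => z z0; rewrite gt_max => /andP[/(uM _ z0) -> /(vM _ z0) ->].
by rewrite addr0.
Qed.

Lemma nice_cst0 : nice (fun=> 0).
Proof. by split; [exact: smooth_on_cst|exists 0]. Qed.

Lemma nice_sum (I : Type) (s : seq I) (F : I -> G -> R) :
  (forall i, nice (F i)) -> nice (fun z => \sum_(i <- s) F i z).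
Proof.
move=> nF; elim: s => [|i s IH].
  by under eq_fun do rewrite big_nil; exact: nice_cst0.
by under eq_fun do rewrite big_cons; exact: niceD.
Qed.

Lemma nice_derive u v : nice u -> nice (fun z => 'D_v u z).
Proof.
move=> [Su [M uM]]; split; first exact: smooth_on_derive.
exists M => z z0 Mz.
have E : \forall y \near z, cst 0 y = u y.
  have [cr _] := smooth_on_ln open_punctured (fun y (y0 : punctured y) => rho_gt0 y0) smooth_rho 0.
  have cl : {for z, continuous (fun y : G => `|ln (rho y)|)}.
    apply: (@continuous_comp _ _ _ (fun y : G => ln (rho y)) (fun x : R => `|x|)).
      exact: cr.
    exact: norm_continuous.
  have N1 : \forall y \near z, M < `|ln (rho y)|.
    have N0 : nbhs `|ln (rho z)| [set x : R | M < x].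
      by apply: open_nbhs_nbhs; split; [exact: open_gt|exact: Mz].
    exact: cl N0.
  have N2 : \forall y \near z, y != 0.
    by apply: open_nbhs_nbhs; split; [exact: open_neq0|].
  by apply: filterS2 N1 N2 => y My y0 /=; rewrite uM.
by rewrite -(near_eq_derive v E) derive_cst.
Qed.

(** The generator of the dilations, [rho] times the radial derivative: the derivative of
    [u (dil s w)] in [s] is [euler u (dil s w)]. *)
Definition euler u z := \sum_i z.1 0 i * dx i u z + 2 * z.2 * dt u z.

Lemma nice_euler u : nice u -> nice (euler u).
Proof.
move=> nu; apply: niceD.
  apply: nice_sum => i; apply: niceM; first exact: smooth_coord.
  exact: nice_derive.
apply: niceM; last exact: nice_derive.
by apply: smooth_onM; [exact: open_punctured|exact: smooth_on_cst|exact: smooth_snd].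
Qed.

Lemma drhoE u z : drho u z = (rho z)^-1 * euler u z.
Proof. by rewrite mulrC. Qed.

Lemma nice_drho u : nice u -> nice (drho u).
Proof.
move=> nu; have -> : drho u = (fun z => (rho z)^-1 * euler u z).
  by apply/funext => z; exact: drhoE.
by apply: niceM; [exact: smooth_rhoV|exact: nice_euler].
Qed.

Lemma nice_radial_lap u : nice u -> nice (radial_lap u).
Proof.
move=> nu; apply: niceM; first exact: smooth_psi.
apply: niceD; first exact/nice_drho/nice_drho.
apply: niceM; last exact: nice_drho.
apply: smooth_onM; [exact: open_punctured|exact: smooth_on_cst|exact: smooth_rhoV].
Qed.

Lemma nice_iter l u : nice u -> nice (iter l radial_lap u).
Proof. by move=> nu; elim: l => //= l; exact: nice_radial_lap. Qed.

End nice.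

Section rays.
Context {R : realType} {n : nat}.
Local Notation G := (grushin R n).
Local Notation punctured := (@punctured R n).
Implicit Types (u : G -> R) (z w : G).

Lemma is_Ck_on (A : set G) k u : is_Ck k u -> Ck_on A k u.
Proof.
elim: k u => [|k IH] u [cu Du]; split=> //; try by move=> z _; exact: cu.
by move=> v; have [dv Cv] := Du v; split=> [z _|]; [exact: dv|exact: IH].
Qed.

Lemma Ck_on_is_Ck k u : Ck_on setT k u -> is_Ck k u.
Proof.
elim: k u => [|k IH] u [cu Du]; split=> //; try by move=> z; exact: cu.
by move=> v; have [dv Cv] := Du v; split=> [z|]; [exact: dv|exact: IH].
Qed.

Lemma test_function0 u : test_function u -> u 0 = 0.
Proof.
move=> [_ _ s0]; apply/eqP; rewrite -[_ == 0]negbK; apply/negP => u0; apply: s0.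
exact: subset_closure.
Qed.

Lemma compact_abs_bound (K : set G) (f : G -> R) : compact K ->
  {in K, forall z, {for z, continuous f}} -> exists M, forall z, K z -> `|f z| <= M.
Proof.
move=> cK cf; have cfK : compact (f @` K).
  apply: continuous_compact => //; apply: continuous_in_subspaceT => z zK.
  exact: cf.
have [M [_ MP]] := compact_bounded cfK.
exists (M + 1) => z Kz; apply: (MP (M + 1)); first by rewrite ltrDl.
by exists z.
Qed.

Lemma test_function_nice u : test_function u -> nice u.
Proof.
move=> [su cu s0]; split; first by move=> k; exact: is_Ck_on.
have sP z : support_of u z -> z != 0 by apply: contraPneq => ->.
have Sl := smooth_on_ln open_punctured (fun y (y0 : punctured y) => rho_gt0 y0) smooth_rho.
have [|M MP] := @compact_abs_bound (support_of u) (fun z => ln (rho z)) cu.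
  by move=> z /set_mem /sP zP; have [c _] := Sl 0; exact: c.
exists M => z z0 Mz; apply/eqP; rewrite -[_ == 0]negbK; apply/negP => uz.
have zS : support_of u z by exact: subset_closure.
by have := MP z zS; rewrite leNgt Mz.
Qed.

Lemma dil_neq0 s z : z != 0 -> dil s z != 0.
Proof.
apply: contra_neq => E; rewrite -(dil0 z) -(addNr s) -dilD E /dil /=.
by rewrite scaler0 mulr0.
Qed.

Definition ray u w : R -> R := fun s => u (dil s w).

Lemma is_derive_ray u w (s : R) : nice u -> w != 0 ->
  is_derive s 1 (ray u w) (euler u (dil s w)).
Proof.
move=> [Su _] w0.
(* The orbit is written in coordinates for [is_derive_curve]: [None] stands for the direction of [t]
   and [Some j] for that of [x_j]. *)
pose I := option 'I_n; pose r : seq I := None :: map Some (index_enum 'I_n).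
pose c (i : I) (s : R) : R := if i is Some j then expR s * w.1 0 j else expR s ^+ 2 * w.2.
pose dc (i : I) : R := if i is Some j then expR s * w.1 0 j else 2 * (expR s ^+ 2 * w.2).
pose v (i : I) : G := if i is Some j then (delta_mx 0 j, 0) else (0, 1).
have E (t : R) : \sum_(i <- r) c i t *: v i = dil t w.
  rewrite /r big_cons big_map /= /dil [LHS]surjective_pairing.
  have fS (F : 'I_n -> G) : (\sum_i F i).1 = \sum_i (F i).1.
    exact: (big_morph fst (id1 := 0) (op1 := +%R)).
  have sS (F : 'I_n -> G) : (\sum_i F i).2 = \sum_i (F i).2.
    exact: (big_morph snd (id1 := 0) (op1 := +%R)).
  congr pair; rewrite /= ?fS ?sS /=.
    rewrite scaler0 add0r [in RHS](row_sum_delta w.1) scaler_sumr.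
    by apply: eq_bigr => i _; rewrite scalerA.
  by rewrite big1 ?addr0 => [|i _]; rewrite /GRing.scale /= ?mulr1 ?mulr0.
have Dc i : is_derive s 1 (c i) (dc i).
  have De : is_derive s 1 (@expR R) (expR s) := is_derive_expR s.
  case: i => [i|] /=.
    have := is_deriveM De (is_derive_cst (w.1 0 i) s 1).
    by rewrite scaler0 add0r => H; apply: (is_derive_eq H); exact: mulrC.
  have := is_deriveM (is_deriveM De De) (is_derive_cst w.2 s 1).
  rewrite scaler0 add0r /GRing.scale /=.
  have -> : (expR : R -> R) * expR * cst w.2 = (fun s => expR s ^+ 2 * w.2).
    by apply/funext => t; rewrite expr2.
  by move=> H; apply: (is_derive_eq H); rewrite /=; ring.
have EE : (fun t : R => u (\sum_(i <- r) c i t *: v i)) = ray u w.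
  by apply/funext => t; rewrite E.
have := @is_derive_curve R G punctured u open_punctured (Su 1%N) I r c dc v s Dc.
rewrite EE E => /(_ (dil_neq0 s w0)).
rewrite /r big_cons big_map /= => H; apply: (is_derive_eq H).
by rewrite addrC /euler /dt /= mulrA; congr (_ + _); apply: eq_bigr => i _; rewrite /dx !mxE.
Qed.

(** The derivative of a ray is the ray of [euler u], which is again nice, so induction on the order
    over all nice functions applies. *)
Lemma smooth_ray u w : nice u -> w != 0 -> smooth_on [set: R] (ray u w).
Proof.
move=> + w0 k; elim: k u => [|k IH] u nu.
  split=> // s _; apply: differentiable_continuous; apply/derivable1_diffP.
  by have [] := is_derive_ray s nu w0.
apply: (@Ck_on1 _ _ _ (ray (euler u) w)); first exact: openT.
  by move=> s _; exact: is_derive_ray.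
by apply: IH; exact: nice_euler.
Qed.

Lemma ray_support u w : nice u -> w != 0 ->
  exists2 M, 0 < M & forall s, M < `|s| -> ray u w s = 0.
Proof.
move=> [_ [M uM]] w0; exists (`|M| + `|ln (rho w)| + 1).
  by rewrite ltr_wpDl// addr_ge0.
move=> s Ms; apply: uM; first exact: dil_neq0.
rewrite rho_dil lnM ?posrE ?expR_gt0 ?rho_gt0// expRK.
apply: (le_lt_trans (ler_norm M)).
have := ler_normB (s + ln (rho w)) (ln (rho w)); rewrite addrK => H.
by move: Ms H; lra.
Qed.

Lemma psi_dil s w : psi (dil s w) = psi w.
Proof.
rewrite /psi rho_dil /= enormZ ger0_norm ?expR_ge0// !exprMn.
by rewrite -mulf_div divff ?mul1r// expf_neq0// gt_eqF// expR_gt0.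
Qed.

End rays.

(** * The Grushin gradient of the homogeneous norm *)

Section gradient_of_rho.
Context {R : realType} {n : nat}.
Local Notation G := (grushin R n).
Implicit Types (u : G -> R) (z w v : G).

Lemma is_derive_rho z v : z != 0 ->
  is_derive z v (@rho R n)
    (4^-1 * (enorm z.1 ^+ 4 + 4 * z.2 ^+ 2) `^ (4^-1 - 1) *
     (2 * enorm z.1 ^+ 2 * (2 * \sum_i z.1 0 i * v.1 0 i) + 8 * z.2 * v.2)).
Proof.
move=> z0; have F0 := rho4_gt0 z0.
have Dc i : is_derive z v (fun y : G => y.1 0 i) (v.1 0 i).
  apply: is_derive_linear => [y|h a b]; last by rewrite /= !mxE.
  by have [+ _] := @smooth_coord R n setT i 0%N; exact.
have Dt : is_derive z v (fun y : G => y.2) v.2.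
  apply: is_derive_linear => [y|h a b] //.
  by have [+ _] := @smooth_snd R n setT 0%N; exact.
have DS : is_derive z v (fun y : G => enorm y.1 ^+ 2) (2 * \sum_i z.1 0 i * v.1 0 i).
  have -> : (fun y : G => enorm y.1 ^+ 2) = \sum_(i < n) (fun y : G => y.1 0 i ^+ 2).
    by apply/funext => y; rewrite enorm_sqr fct_sumE.
  have D i : is_derive z v (fun y : G => y.1 0 i ^+ 2) (2 * z.1 0 i * v.1 0 i).
    have -> : (fun y : G => y.1 0 i ^+ 2) = (fun y : G => y.1 0 i) * (fun y : G => y.1 0 i).
      by apply/funext => y; rewrite expr2.
    by apply: (is_derive_eq (is_deriveM (Dc i) (Dc i))); rewrite /GRing.scale /=; ring.
  apply: (is_derive_eq (is_derive_sum D)).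
  by rewrite mulr_sumr; apply: eq_bigr => i _; rewrite mulrA.
have DF : is_derive z v (fun y : G => enorm y.1 ^+ 4 + 4 * y.2 ^+ 2)
    (2 * enorm z.1 ^+ 2 * (2 * \sum_i z.1 0 i * v.1 0 i) + 8 * z.2 * v.2).
  have -> : (fun y : G => enorm y.1 ^+ 4 + 4 * y.2 ^+ 2) =
     (fun y : G => enorm y.1 ^+ 2) * (fun y : G => enorm y.1 ^+ 2) +
     4 *: ((fun y : G => y.2) * (fun y : G => y.2)).
    apply/funext => y.
    change (enorm y.1 ^+ 4 + 4 * y.2 ^+ 2 = enorm y.1 ^+ 2 * enorm y.1 ^+ 2 + 4 * (y.2 * y.2)).
    ring.
  apply: (is_derive_eq (is_deriveD (is_deriveM DS DS) (is_deriveZ 4 (is_deriveM Dt Dt)))).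
  rewrite /GRing.scale /=; ring.
have := is_derive_comp1 DF (is_derive1_powR 4^-1 F0).
rewrite (_ : _ \o _ = @rho R n)//.
by apply/funext => y; rewrite /rho /= div1r.
Qed.

Lemma psi_ge0 z : 0 <= psi z.
Proof. by rewrite divr_ge0 ?sqr_ge0. Qed.

(** With [F = rho^4] and [c = F^(- 3 / 4)], the [x] part contributes [c^2 |x|^6] and the [t] part
    [4 c^2 |x|^2 t^2]. They add up to [c^2 |x|^2 F = |x|^2 / rho^2]. *)
Lemma grad_norm_rho z : z != 0 -> grad_norm (@rho R n) z = Num.sqrt (psi z).
Proof.
move=> z0; have F0 := rho4_gt0 z0; set F := enorm z.1 ^+ 4 + 4 * z.2 ^+ 2 in F0.
rewrite /grad_norm; congr Num.sqrt.
set c := F `^ (4^-1 - 1).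
have Dx i : dx i (@rho R n) z = c * (enorm z.1 ^+ 2 * z.1 0 i).
  rewrite /dx (is_deriveW (is_derive_rho _ z0)) -/F -/c /= mulr0 addr0.
  rewrite (bigD1 i)//= big1 => [|j ji]; last by rewrite mxE (negbTE ji) andbF mulr0.
  by rewrite mxE !eqxx mulr1 addr0; field.
have Dt : dt (@rho R n) z = c * (2 * z.2).
  rewrite /dt (is_deriveW (is_derive_rho _ z0)) -/F -/c /= mulr1.
  by rewrite big1 => [|j ji]; [field|rewrite mxE mulr0].
rewrite Dt; under eq_bigr do rewrite Dx !exprMn.
rewrite -mulr_sumr -mulr_sumr -enorm_sqr.
have -> : c ^+ 2 * ((enorm z.1 ^+ 2) ^+ 2 * enorm z.1 ^+ 2) + (enorm z.1 * (c * (2 * z.2))) ^+ 2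
  = enorm z.1 ^+ 2 * (c ^+ 2 * F) by rewrite /F -exprM; ring.
rewrite /psi; congr (_ * _).
rewrite -powR_mulrn ?powR_ge0// -powRrM -[X in _ * X](powRr1 (ltW F0)).
rewrite -powRD ?(gt_eqF F0) ?implybT// /rho -/F -powR_mulrn ?powR_ge0// -powRrM -powRN.
by congr (_ `^ _); field.
Qed.

End gradient_of_rho.

Section ray_operators.
Context {R : realType} {n : nat}.
Local Notation G := (grushin R n).
Local Notation Q := (hdim R n).
Implicit Types (u : G -> R) (z w v : G) (a b : R).

Definition twist a u w : R -> R := fun s => expR (a * s) * ray u w s.

Lemma is_derive_twist a u w (s : R) : nice u -> w != 0 ->
  is_derive s 1 (twist a u w) (a * twist a u w s + twist a (euler u) w s).
Proof.
move=> nu w0.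
have De : is_derive s 1 (fun s => expR (a * s)) (expR (a * s) * a).
  have Da : is_derive s 1 (fun s : R => a * s) a.
    by rewrite -[X in is_derive _ _ _ X]mulr1; exact: is_deriveZ.
  exact: (@is_derive1_comp R (@expR R) (fun s => a * s) s _ _ (is_derive_expR _) Da).
apply: (is_derive_eq (is_deriveM De (is_derive_ray s nu w0))).
rewrite /GRing.scale /= /twist /ray; ring.
Qed.

Lemma test1_twist a u w : nice u -> w != 0 -> test1 (twist a u w).
Proof.
move=> nu w0; have oT : open [set: R] by exact: openT.
split; last first.
  have [M M0 uM] := ray_support nu w0.
  by exists M => // s /uM us; rewrite /twist us mulr0.
apply: smooth_onM => //; last exact: smooth_ray.
apply: (smooth_on_comp oT (h := @expR R)); first by move=> k; exact: Ck_on_expR.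
by move=> k; apply: Ck_on_linear => [x|h v z]; [exact: mulrl_continuous|rewrite /GRing.scale /=; ring].
Qed.

Lemma op_twist b a u w : nice u -> w != 0 ->
  op b (twist a u w) = (fun s => (a - b) * twist a u w s + twist a (euler u) w s).
Proof.
move=> nu w0; apply/funext => s; rewrite /op (is_deriveW (is_derive_twist a s nu w0)).
ring.
Qed.

(** Conjugating the generator of dilations by [expR (a s)] turns it into [D - a]. The division by
    [rho] costs a factor [expR (- s)], absorbed by passing from the twist [a] to [a + 1]. *)
Lemma twist_drho a u w : nice u -> w != 0 ->
  twist (a + 1) (drho u) w = (fun s => (rho w)^-1 * op a (twist a u w) s).
Proof.
move=> nu w0; apply/funext => s; rewrite op_twist// subrr mul0r add0r /twist /ray drhoE.
rewrite rho_dil mulrDl mul1r expRD invfM.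
have : expR s != 0 by rewrite gt_eqF// expR_gt0.
have : rho w != 0 by rewrite gt_eqF// rho_gt0.
by move=> r0 e0; field; rewrite r0 e0.
Qed.

Lemma opZ (c : R) a (g : R -> R) : smooth_on setT g ->
  op a (fun s => c * g s) = (fun s => c * op a g s).
Proof.
move=> Sg; apply/funext => s; rewrite /op.
have D := is_deriveZ c (smooth_derivable s Sg).
rewrite (is_deriveW D) /GRing.scale /=; ring.
Qed.

(** After two applications of [drho] the first-order term [(Q - 1) / rho] only shifts the root of
    the outer factor, from [a + 1] to [a + 2 - Q]. The factor [psi w] comes out because [psi] is
    invariant under dilations. *)
Lemma twist_radial_lap a u w : nice u -> w != 0 ->
  twist (a + 2) (radial_lap u) w =
  (fun s => psi w / rho w ^+ 2 * op (a + 2 - Q) (op a (twist a u w)) s).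
Proof.
move=> nu w0; have nd := nice_drho nu.
have r0 : rho w != 0 by rewrite gt_eqF// rho_gt0.
have E : op a (twist a u w) = (fun s => rho w * twist (a + 1) (drho u) w s).
  by apply/funext => s; rewrite twist_drho// mulrA divff// mul1r.
have St : smooth_on setT (twist (a + 1) (drho u) w) by have [] := test1_twist (a + 1) nd w0.
apply/funext => s; rewrite E opZ//.
have -> : op (a + 2 - Q) (twist (a + 1) (drho u) w) s =
   op (a + 1) (twist (a + 1) (drho u) w) s + (Q - 1) * twist (a + 1) (drho u) w s.
  by rewrite /op; ring.
have -> : op (a + 1) (twist (a + 1) (drho u) w) s = rho w * twist (a + 1 + 1) (drho (drho u)) w s.
  by rewrite (twist_drho (a + 1) nd w0) mulrA divff// mul1r.
rewrite /twist /ray /radial_lap psi_dil rho_dil.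
have -> : (a + 2) * s = (a + 1 + 1) * s by ring.
rewrite [(a + 1 + 1) * s]mulrDl mul1r expRD.
have e0 : expR s != 0 by rewrite gt_eqF// expR_gt0.
by field; rewrite r0 e0.
Qed.

Fixpoint roots a (l : nat) : seq R :=
  if l is j.+1 then [:: a + 2 * j%:R + 2 - Q, a + 2 * j%:R & roots a j] else [::].

Lemma size_roots a l : size (roots a l) = (2 * l)%N.
Proof. by elim: l => //= l ->; rewrite mulnS. Qed.

Lemma twist_iter a u w l : nice u -> w != 0 ->
  twist (a + 2 * l%:R) (iter l radial_lap u) w =
  (fun s => (psi w / rho w ^+ 2) ^+ l * ops (roots a l) (twist a u w) s).
Proof.
move=> nu w0; elim: l => [|l IH]; apply/funext => s.
  by rewrite mulr0 addr0 expr0 mul1r.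
have -> : a + 2 * l.+1%:R = a + 2 * l%:R + 2 by rewrite -natr1; ring.
have tt := test1_twist a nu w0.
rewrite /= twist_radial_lap//; last exact: nice_iter.
rewrite IH opZ; last by have [] := test1_ops (roots a l) tt.
rewrite opZ; last by have [] := test1_op (a + 2 * l%:R) (test1_ops (roots a l) tt).
by rewrite mulrA -exprS.
Qed.

End ray_operators.

(** * The three integrands in normal form along an orbit *)

Section ray_integrands.
Context {R : realType} {n : nat}.
Local Notation G := (grushin R n).
Local Notation Q := (hdim R n).
Implicit Types (u : G -> R) (z w v : G).
Variables (p beta : R) (k : nat).
Hypothesis p0 : 0 < p.

(** The exponent for which the Jacobian [expR s ^+ (n + 2)], the weight [rho^(- (k p + beta))] and
    [expR (- (a p s))] cancel, so that the Hardy integrand along an orbit is a constant multiple of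
    [|g|^p]. *)
Definition expo : R := (Q - k%:R * p - beta) / p.

Local Notation a := expo.

(** The factor that does not depend on the position along the orbit. It is the same for the Hardy
    term, the energies and the distance, so an inequality on the line transfers after multiplication
    by it. *)
Definition weight w : R := Num.sqrt (psi w) `^ p / rho w `^ (k%:R * p + beta).

Definition hardy_integrand u z : R :=
  `|u z| `^ p * grad_norm (@rho R n) z `^ p / rho z `^ (k%:R * p + beta).

Definition even_integrand (l : nat) u z : R := `|iter l radial_lap u z| `^ p
  / (grad_norm (@rho R n) z `^ ((2 * l%:R - 1) * p) * rho z `^ beta).

Definition odd_integrand (l : nat) u z : R := radial_grad_norm (iter l radial_lap u) z `^ p
  / (grad_norm (@rho R n) z `^ (2 * l%:R * p) * rho z `^ beta).

Lemma norm_twist b u w s :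
  `|ray u w s| `^ p = expR (- (b * p * s)) * `|twist b u w s| `^ p.
Proof.
rewrite /twist normrM powRM// ger0_norm ?expR_ge0// -expRM mulrA -expRD.
by rewrite [b * s * p]mulrAC addNr expR0 mul1r.
Qed.

Lemma rho_dil_powR s w c : rho (dil s w) `^ c = expR (c * s) * rho w `^ c.
Proof. by rewrite rho_dil powRM ?expR_ge0 ?rho_ge0// -expRM [s * c]mulrC. Qed.

Lemma expo_scale s : expR (- (a * p * s)) * expR s ^+ (n + 2) = expR ((k%:R * p + beta) * s).
Proof.
rewrite -expRM_natl -expRD /expo /hdim divfK ?gt_eqF//; congr expR; ring.
Qed.

Lemma hardy_ray u w s : w != 0 ->
  hardy_integrand u (dil s w) * expR s ^+ (n + 2) = weight w * `|twist a u w s| `^ p.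
Proof.
move=> w0; rewrite /hardy_integrand grad_norm_rho ?dil_neq0// psi_dil rho_dil_powR.
rewrite -/(ray u w s) (norm_twist a) /weight.
have E := expo_scale s.
have e0 : expR ((k%:R * p + beta) * s) != 0 by rewrite gt_eqF// expR_gt0.
have r0 : rho w `^ (k%:R * p + beta) != 0 by rewrite gt_eqF// powR_gt0// rho_gt0.
set X := `|twist _ _ _ _| `^ _; set c := Num.sqrt _ `^ _.
transitivity ((expR (- (a * p * s)) * expR s ^+ (n + 2)) * (X * c) /
  (expR ((k%:R * p + beta) * s) * rho w `^ (k%:R * p + beta))); first by ring.
by rewrite E; field; rewrite e0 r0.
Qed.

Lemma psi_rho_powR (m : nat) w : w != 0 ->
  ((psi w / rho w ^+ 2) ^+ m) `^ p = Num.sqrt (psi w) `^ (2 * m%:R * p) / rho w `^ (2 * m%:R * p).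
Proof.
move=> w0; have r0 := rho_gt0 w0.
have -> : psi w / rho w ^+ 2 = (Num.sqrt (psi w) / rho w) ^+ 2.
  by rewrite expr_div_n sqr_sqrtr ?psi_ge0.
have q0 : 0 <= Num.sqrt (psi w) / rho w by rewrite divr_ge0 ?sqrtr_ge0 ?ltW.
rewrite -exprM -powR_mulrn// -powRrM natrM powRM ?sqrtr_ge0 ?invr_ge0 ?(ltW r0)//.
by congr (_ * _); rewrite -powR_inv1 ?(ltW r0)// -powRrM mulN1r powRN.
Qed.

Lemma even_ray l u w s : k = (2 * l)%N -> (1 <= l)%N -> nice u -> w != 0 ->
  even_integrand l u (dil s w) * expR s ^+ (n + 2) =
  weight w * `|ops (@roots R n a l) (twist a u w) s| `^ p.
Proof.
move=> kl l1 nu w0; have r0 := rho_gt0 w0.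
rewrite /even_integrand grad_norm_rho ?dil_neq0// psi_dil rho_dil_powR /weight.
rewrite -/(ray (iter l radial_lap u) w s) (norm_twist (a + 2 * l%:R)) twist_iter// normrM.
rewrite powRM// [`|(_ / _) ^+ l|]ger0_norm ?exprn_ge0 ?divr_ge0 ?psi_ge0 ?sqr_ge0//.
rewrite psi_rho_powR//.
set X := `|ops _ _ _| `^ p; set q := Num.sqrt (psi w).
have l2 : (1 : R) <= l%:R by rewrite ler1n.
(* On the axis [x = 0] the gradient of [rho] vanishes. The integrand is then 0 because its
   denominator is, its exponent [(2 l - 1) p] being positive; the right side is 0 because [weight]
   is. *)
have [q0|qn0] := eqVneq q 0.
  have h1 : (2 * l%:R - 1) * p != 0 by rewrite gt_eqF// mulr_gt0//; lra.
  by rewrite q0 (powR0 h1) (powR0 (lt0r_neq0 p0)) !mul0r invr0 mulr0 mul0r.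
have qg : 0 < q by rewrite lt_neqAle eq_sym qn0 sqrtr_ge0.
have -> : q `^ (2 * l%:R * p) = q `^ ((2 * l%:R - 1) * p) * q `^ p.
  by rewrite -powRD ?qn0 ?implybT//; congr (_ `^ _); ring.
have -> : rho w `^ (k%:R * p + beta) = rho w `^ (2 * l%:R * p) * rho w `^ beta.
  by rewrite -powRD ?(gt_eqF r0) ?implybT// kl natrM.
have E : expR (- ((a + 2 * l%:R) * p * s)) * expR s ^+ (n + 2) = expR (beta * s).
  transitivity (expR (- (2 * l%:R * p * s)) * (expR (- (a * p * s)) * expR s ^+ (n + 2))).
    by rewrite mulrA -expRD; congr (expR _ * _); ring.
  by rewrite expo_scale -expRD kl natrM; congr expR; ring.
have e0 : expR (beta * s) != 0 by rewrite gt_eqF// expR_gt0.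
have g1 : q `^ ((2 * l%:R - 1) * p) != 0 by rewrite gt_eqF// powR_gt0.
have g2 : rho w `^ (2 * l%:R * p) != 0 by rewrite gt_eqF// powR_gt0.
have g3 : rho w `^ beta != 0 by rewrite gt_eqF// powR_gt0.
move: E; set e1 := expR (- _); set e2 := expR s ^+ _ => E.
transitivity ((e1 * e2) * (q `^ p * X) / (expR (beta * s) * (rho w `^ (2 * l%:R * p) * rho w `^ beta))).
  by field; rewrite e0 g1 g2 g3.
by rewrite E; field; rewrite e0 g2 g3.
Qed.

Lemma odd_ray l u w s : k = (2 * l + 1)%N -> nice u -> w != 0 ->
  odd_integrand l u (dil s w) * expR s ^+ (n + 2) =
  weight w * `|ops (a + 2 * l%:R :: @roots R n a l) (twist a u w) s| `^ p.
Proof.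
move=> kl nu w0; have r0 := rho_gt0 w0; have rn0 : rho w != 0 by rewrite gt_eqF.
have nl := nice_iter l nu.
rewrite /odd_integrand /radial_grad_norm grad_norm_rho ?dil_neq0// psi_dil rho_dil_powR /weight.
rewrite -/(ray (drho (iter l radial_lap u)) w s).
rewrite powRM ?sqrtr_ge0// (norm_twist (a + 2 * l%:R + 1)) twist_drho// twist_iter//.
rewrite opZ; last by have [] := test1_ops (@roots R n a l) (test1_twist a nu w0).
rewrite -/(ops (a + 2 * l%:R :: @roots R n a l) (twist a u w) s).
rewrite [`|(rho w)^-1 * _|]normrM [`|(psi w / _) ^+ _ * _|]normrM !powRM// ?mulr_ge0//.
rewrite [`|(_ / _) ^+ l|]ger0_norm ?exprn_ge0 ?divr_ge0 ?psi_ge0 ?sqr_ge0//.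
rewrite psi_rho_powR// ger0_norm ?invr_ge0 ?(ltW r0)//.
set X := `|ops _ _ _| `^ p; set q := Num.sqrt (psi w).
have [q0|qn0] := eqVneq q 0.
  by rewrite q0 (powR0 (lt0r_neq0 p0)) !mul0r.
have qg : 0 < q by rewrite lt_neqAle eq_sym qn0 sqrtr_ge0.
have -> : (rho w)^-1 `^ p = (rho w `^ p)^-1.
  by rewrite -powR_inv1 ?(ltW r0)// -powRrM mulN1r powRN.
have -> : rho w `^ (k%:R * p + beta) = rho w `^ (2 * l%:R * p) * rho w `^ p * rho w `^ beta.
  rewrite -!powRD ?(negbTE rn0) ?implybT// kl natrD natrM; congr (_ `^ _); ring.
have E : expR (- ((a + 2 * l%:R + 1) * p * s)) * expR s ^+ (n + 2) = expR (beta * s).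
  transitivity (expR (- ((2 * l%:R + 1) * p * s)) * (expR (- (a * p * s)) * expR s ^+ (n + 2))).
    by rewrite mulrA -expRD; congr (expR _ * _); ring.
  by rewrite expo_scale -expRD kl natrD natrM; congr expR; ring.
have e0 : expR (beta * s) != 0 by rewrite gt_eqF// expR_gt0.
have g1 : q `^ (2 * l%:R * p) != 0 by rewrite gt_eqF// powR_gt0.
have g2 : rho w `^ (2 * l%:R * p) != 0 by rewrite gt_eqF// powR_gt0.
have g3 : rho w `^ beta != 0 by rewrite gt_eqF// powR_gt0.
have g4 : rho w `^ p != 0 by rewrite gt_eqF// powR_gt0.
move: E; set e1 := expR (- _); set e2 := expR s ^+ _ => E.
transitivity ((e1 * e2) * (q `^ p * X) /
    (expR (beta * s) * (rho w `^ (2 * l%:R * p) * rho w `^ p * rho w `^ beta))).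
  by field; rewrite e0 g1 g2 g3 g4.
by rewrite E; field; rewrite e0 g2 g3 g4.
Qed.

Lemma signed_powM (c x : R) : 0 < c -> signed_pow p (c * x) = c `^ (p / 2) * signed_pow p x.
Proof.
move=> c0; rewrite /signed_pow normrM (ger0_norm (ltW c0)) powRM ?(ltW c0)//.
have -> : c `^ (p / 2) = c `^ ((p - 2) / 2) * c.
  rewrite -[X in _ = _ * X](powRr1 (ltW c0)) -powRD ?(gt_eqF c0) ?implybT//.
  by congr (_ `^ _); field.
ring.
Qed.

(** The comparison point in the distance lies on the same orbit, at the time where [rho = r]. That
    time is the same for all points of the orbit, so the distance becomes a problem on the line with
    one fixed singular point. *)
Lemma radial_value_dil u (r : R) w s : 0 < r -> w != 0 ->
  radial_value u r (dil s w) = ray u w (ln r - ln (rho w)).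
Proof.
move=> r0 w0; have rw := rho_gt0 w0.
rewrite /radial_value /ray /dil /= rho_dil expRD expRN !lnK ?posrE//.
have e0 : expR s != 0 by rewrite gt_eqF// expR_gt0.
have rn0 : rho w != 0 by rewrite gt_eqF.
congr (u _); congr pair.
  by rewrite scalerA; congr (_ *: _); field; rewrite e0 rn0.
by field; rewrite e0 rn0.
Qed.

(** The power of [rho / r] equals [expR (- (a p / 2) (s - s0))], just what turns the signed powers
    of [u] at the times [s] and [s0] into those of [g]. The logarithm is [s0 - s], which produces
    Hardy's weight; at [s = s0] both sides are 0. *)
Lemma dist_ray u (r : R) w s : 0 < r -> w != 0 ->
  let s0 := ln r - ln (rho w) in
  dist_integrand p beta k u r (dil s w) * expR s ^+ (n + 2) =
  weight w * ((signed_pow p (twist a u w s) - signed_pow p (twist a u w s0)) ^+ 2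
    / (s - s0) ^+ 2).
Proof.
move=> r0 w0 s0; have rw := rho_gt0 w0; have rn0 : rho w != 0 by rewrite gt_eqF.
rewrite /dist_integrand radial_value_dil// grad_norm_rho ?dil_neq0// psi_dil rho_dil_powR.
rewrite -/(ray u w s) -/s0.
have rE : rho (dil s w) / r = expR (s - s0).
  by rewrite rho_dil /s0 opprB addrA expRB expRD !lnK ?posrE.
have lE : ln (r / rho (dil s w)) = s0 - s.
  by rewrite -[r / _]invf_div rE -expRN expRK opprB.
have TE t : signed_pow p (twist a u w t) = expR (a * p / 2 * t) * signed_pow p (ray u w t).
  by rewrite /twist signed_powM ?expR_gt0// -expRM; congr (expR _ * _); ring.
rewrite rE lE !TE -expRM /weight.
have -> : (Q - k%:R * p - beta) / 2 = a * p / 2 by rewrite /expo divfK ?gt_eqF.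
rewrite real_normK ?num_real//.
have key (A B : R) : A - B * expR ((s - s0) * - (a * p / 2)) =
    expR (- (a * p / 2 * s)) * (expR (a * p / 2 * s) * A - expR (a * p / 2 * s0) * B).
  rewrite mulrBr !mulrA -!expRD addNr expR0 mul1r; congr (_ - _).
  by rewrite [LHS]mulrC; congr (expR _ * _); ring.
rewrite key.
set D := _ - _; rewrite exprMn.
have -> : expR (- (a * p / 2 * s)) ^+ 2 = expR (- (a * p * s)).
  by rewrite expr2 -expRD; congr expR; field.
have E := expo_scale s.
have e0 : expR ((k%:R * p + beta) * s) != 0 by rewrite gt_eqF// expR_gt0.
have g0 : rho w `^ (k%:R * p + beta) != 0 by rewrite gt_eqF// powR_gt0.
have -> : (s0 - s) ^+ 2 = (s - s0) ^+ 2 by rewrite -sqrrN opprB.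
rewrite -[in LHS](mulrA (expR _)) invfM invfM.
set e1 := expR (- _) in E *; set e2 := expR s ^+ _ in E *; set e3 := expR (_ * s) in E e0 *.
set I := ((s - s0) ^+ 2)^-1; set g := rho w `^ _ in g0 *.
transitivity ((e1 * e2) * (D ^+ 2 * I * Num.sqrt (psi w) `^ p) / (e3 * g)).
  by rewrite invfM; ring.
by rewrite E; field; rewrite e0 g0.
Qed.

End ray_integrands.

(** * Measurability and the energy inequality *)

Section box_measure.
Context {R : realType}.
Local Notation mR := (measurableTypeR R).
Local Notation leb := (@lebesgue_measure R).

Definition tuple_box (n : nat) (b1 b2 : R) : set (n.-tuple mR) :=
  [set v | forall i, b1 <= tnth v i <= b2].
Arguments tuple_box : clear implicits.

Lemma measurable_tuple_box n b1 b2 : measurable (tuple_box n b1 b2).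
Proof.
have -> : tuple_box n b1 b2 = \bigcap_(i in [set: 'I_n])
    ((tnth (T:=mR))^~ i @^-1` `[b1, b2]%classic).
  apply/seteqP; split => v /= H i; first by move=> _; rewrite /= in_itv /=; exact: H.
  by have := H i I; rewrite /= in_itv.
apply: fin_bigcap_measurable => // i _; rewrite -[X in measurable X]setTI.
by apply: measurable_tnth => //; exact: measurable_itv.
Qed.

Lemma lebesgue_tuple_box n b1 b2 : b1 <= b2 ->
  lebesgue_tuple R n (tuple_box n b1 b2) = ((b2 - b1) ^+ n)%:E.
Proof.
move=> b12; elim: n => [|n IH].
  rewrite /= expr0 diracE mem_set// => i; by case: i.
have -> : lebesgue_tuple R n.+1 (tuple_box n.+1 b1 b2) =
    (leb \x lebesgue_tuple R n)%E (`[b1, b2]%classic `*` tuple_box n b1 b2).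
  rewrite /= /cons_measure /pushforward; congr (_ _); apply/seteqP; split.
    move=> [x v] /= H; split => /=.
      by have := H ord0; rewrite (tnth_nth 0) /= in_itv.
    by move=> i; have := H (lift ord0 i); rewrite !(tnth_nth 0).
  move=> [x v] [/= xb vb] i; rewrite (tnth_nth 0) /=.
  case: (unliftP ord0 i) => [j ->|->] /=.
    by have := vb j; rewrite (tnth_nth 0).
  by rewrite in_itv in xb.
rewrite product_measure1E//; last exact: measurable_tuple_box.
rewrite IH /= lebesgue_measure_itv /= lte_fin exprS EFinM.
case: ltP => [_|b21]; first by rewrite -EFinB.
have -> : b2 = b1 by apply/eqP; rewrite eq_le b12 b21.
by rewrite subrr !mul0e.
Qed.

Lemma grushin_box n b1 b2 c1 c2 : b1 <= b2 -> c1 <= c2 ->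
  grushin_measure (tuple_box n b1 b2 `*` `[c1, c2]%classic) =
  ((b2 - b1) ^+ n * (c2 - c1))%:E :> \bar R.
Proof.
move=> b12 c12; rewrite /grushin_measure product_measure1E//; last exact: measurable_tuple_box.
transitivity (lebesgue_tuple R n (tuple_box n b1 b2) * lebesgue_measure `[c1, c2]%classic)%E => //.
rewrite lebesgue_tuple_box// lebesgue_measure_itv /= lte_fin EFinM.
case: ltP => [_|c21]; first by rewrite -EFinB.
have -> : c2 = c1 by apply/eqP; rewrite eq_le c12 c21.
by rewrite subrr mule0.
Qed.

End box_measure.
Arguments tuple_box {R} n b1 b2.

Section measurability.
Context {R : realType} {n : nat}.
Local Notation mR := (measurableTypeR R).
Local Notation leb := (@lebesgue_measure R).
Local Notation G := (grushin R n).
Local Notation pt := (@grushin_pt R n).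
Local Notation punctured := (@punctured R n).
Implicit Types (u f : G -> R).

Definition gmeas f := measurable_fun setT (f \o pt).

Lemma gmeas_smooth f : smooth_on punctured f -> gmeas f.
Proof. by move=> /(_ 0%N) [cf _]; apply: measurable_pt => z z0; exact: cf. Qed.

Lemma gmeas_grad_norm : gmeas (grad_norm (@rho R n)).
Proof.
apply: measurable_pt => z z0.
have [Cp _] := @smooth_psi R n 0%N.
have C : Ck_on punctured 0 (fun z => Num.sqrt (psi z)).
  split => // y y0; apply: (@continuous_comp _ _ _ (@psi R n) (@Num.sqrt R)).
    exact: Cp.
  exact: sqrt_continuous.
have [+ _] : Ck_on punctured 0 (grad_norm (@rho R n)).
  by apply: Ck_on_eq C; [exact: open_punctured|move=> y y0; rewrite grad_norm_rho].
by apply.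
Qed.

Lemma gmeas_rho : gmeas (@rho R n).
Proof. by apply: gmeas_smooth; exact: smooth_rho. Qed.

Lemma gmeas_powR f c : gmeas f -> gmeas (fun z => f z `^ c).
Proof. by move=> mf; exact: (measurableT_comp (@measurable_powR R c) mf). Qed.

Lemma gmeas_norm f : gmeas f -> gmeas (fun z => `|f z|).
Proof. by move=> mf; exact: (measurableT_comp (@normr_measurable R setT) mf). Qed.

Lemma gmeasM f g : gmeas f -> gmeas g -> gmeas (fun z => f z * g z).
Proof. by move=> mf mg; exact: (measurable_funM mf mg). Qed.

Lemma gmeasV f : (forall z, 0 <= f z) -> gmeas f -> gmeas (fun z => (f z)^-1).
Proof.
move=> f0 mf; have -> : (fun z => (f z)^-1) = (fun z => f z `^ (-1)).
  by apply/funext => z; rewrite powR_inv1.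
exact: gmeas_powR.
Qed.

Lemma polar_le (f g : G -> R) : gmeas f -> gmeas g ->
  (forall z, 0 <= f z) -> (forall z, 0 <= g z) -> f 0 = 0 -> g 0 = 0 ->
  (forall w : G, w != 0 ->
     (\int[leb]_s (f (dil s w) * expR s ^+ (n + 2))%:E <=
      \int[leb]_s (g (dil s w) * expR s ^+ (n + 2))%:E)%E) ->
  (gintegral f <= gintegral g)%E.
Proof.
move=> mf mg f0 g0 f00 g00 H.
have [mF ->] := polar gmeas_rho mf f0 f00; have [mG ->] := polar gmeas_rho mg g0 g00.
have e0 s : 0 <= expR s ^+ (n + 2) :> R by rewrite exprn_ge0 ?expR_ge0.
apply: ge0_le_integral => //.
  by move=> z _; apply: integral_ge0 => s _; rewrite lee_fin !mulr_ge0 ?shell_ge0.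
move=> z _; rewrite /shell; case: ifP => [/andP[rz _]|_]; last first.
  by under eq_integral do rewrite mul0r; under [leRHS]eq_integral do rewrite mul0r.
under eq_integral do rewrite mul1r; under [leRHS]eq_integral do rewrite mul1r.
by apply: H; apply: contraTneq rz => ->; rewrite rho0 ltxx.
Qed.

End measurability.

Section energy_inequality.
Context {R : realType} {n : nat}.
Local Notation mR := (measurableTypeR R).
Local Notation leb := (@lebesgue_measure R).
Local Notation gm := (@grushin_measure R n).
Local Notation T := (n.-tuple mR * mR)%type.
Local Notation G := (grushin R n).
Local Notation pt := (@grushin_pt R n).
Local Notation punctured := (@punctured R n).
Implicit Types (u f : G -> R) (z w : G).
Variables (p beta : R) (k : nat).
Hypothesis p2 : 2 <= p.
Local Notation a := (@expo R n p beta k).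

Let p0 : 0 < p. Proof. exact: lt_le_trans p2. Qed.

Lemma gmeasD (f g : G -> R) : gmeas f -> gmeas g -> gmeas (fun z => f z + g z).
Proof. by move=> mf mg; exact: (measurable_funD mf mg). Qed.

Lemma gmeasB (f g : G -> R) : gmeas f -> gmeas g -> gmeas (fun z => f z - g z).
Proof. by move=> mf mg; exact: (measurable_funB mf mg). Qed.

Lemma gmeas_ln (f : G -> R) : gmeas f -> gmeas (fun z => ln (f z)).
Proof. by move=> mf; exact: (measurableT_comp (@measurable_ln R) mf). Qed.

Lemma nice_gmeas u : nice u -> gmeas u.
Proof. by move=> [Su _]; exact: gmeas_smooth. Qed.

Lemma hardy_integrand_ge0 u z : 0 <= hardy_integrand p beta k u z.
Proof. by rewrite /hardy_integrand divr_ge0 ?mulr_ge0 ?powR_ge0. Qed.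

Lemma gmeas_hardy u : nice u -> gmeas (hardy_integrand p beta k u).
Proof.
move=> nu; apply: gmeasM; first apply: gmeasM.
- by apply: gmeas_powR; apply: gmeas_norm; exact: nice_gmeas.
- by apply: gmeas_powR; exact: gmeas_grad_norm.
- by apply: gmeasV => [z|]; [exact: powR_ge0|apply: gmeas_powR; exact: gmeas_rho].
Qed.

Lemma gmeas_signed_pow f : gmeas f -> gmeas (fun z => signed_pow p (f z)).
Proof. by move=> mf; apply: gmeasM => //; apply: gmeas_powR; exact: gmeas_norm. Qed.

Lemma gmeas_radial_value u (r : R) : 0 < r -> nice u -> u 0 = 0 ->
  gmeas (radial_value u r).
Proof.
move=> r0 nu u0.
have -> : radial_value u r = (fun z => u (dil (ln r - ln (rho z)) z)).
  apply/funext => z; have [->|z0] := eqVneq z 0.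
    by rewrite /radial_value /dil /= !scaler0 !mulr0 mul0r.
  by have := radial_value_dil u 0 r0 z0; rewrite dil0.
rewrite /gmeas; have -> : (fun z => u (dil (ln r - ln (rho z)) z)) \o pt =
   (u \o pt) \o ((fun zs : T * mR => dilT zs.2 zs.1) \o (fun z : T => (z, ln r - ln (rho (pt z)) : mR))).
  by apply/funext => z; rewrite /= pt_dilT.
apply: (measurableT_comp (nice_gmeas nu)); apply: (measurableT_comp measurable_dilT2).
apply: measurable_fun_pair; first exact: measurable_id.
apply: measurable_funB => //.
exact: (gmeas_ln gmeas_rho).
Qed.

Lemma dist_integrand_ge0 u r z : 0 <= dist_integrand p beta k u r z.
Proof.
rewrite /dist_integrand mulr_ge0 ?powR_ge0// divr_ge0 ?sqr_ge0//.
by rewrite mulr_ge0 ?powR_ge0 ?sqr_ge0.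
Qed.

Lemma gmeas_dist u (r : R) : 0 < r -> nice u -> u 0 = 0 ->
  gmeas (dist_integrand p beta k u r).
Proof.
move=> r0 nu u0.
have mX f : gmeas f -> gmeas (fun z => f z ^+ 2).
  by move=> mf; under eq_fun do rewrite expr2; exact: gmeasM.
apply: gmeasM; last by apply: gmeas_powR; exact: gmeas_grad_norm.
apply: gmeasM.
  apply: mX; apply: gmeas_norm; apply: gmeasB.
    by apply: gmeas_signed_pow; exact: nice_gmeas.
  apply: gmeasM; first by apply: gmeas_signed_pow; exact: gmeas_radial_value.
  apply: gmeas_powR; apply: gmeasM; first exact: gmeas_rho.
  exact: measurable_cst.
apply: gmeasV => [z|]; first by rewrite mulr_ge0 ?powR_ge0 ?sqr_ge0.
apply: gmeasM; first by apply: gmeas_powR; exact: gmeas_rho.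
apply: mX; apply: gmeas_ln.
apply: gmeasM; first exact: measurable_cst.
by apply: gmeasV => [z|]; [exact: rho_ge0|exact: gmeas_rho].
Qed.

Lemma hardy_integrand0 u : u 0 = 0 -> hardy_integrand p beta k u 0 = 0.
Proof. by move=> u0; rewrite /hardy_integrand u0 normr0 powR0 ?gt_eqF// !mul0r. Qed.

Lemma dist_integrand0 u r : u 0 = 0 -> dist_integrand p beta k u r 0 = 0.
Proof.
move=> u0; rewrite /dist_integrand /radial_value /= !scaler0 !mulr0 mul0r u0.
by rewrite /signed_pow !mulr0 mul0r subr0 normr0 expr0n /= !mul0r.
Qed.

Lemma dist_sqr u r : (dist p beta k u r ^+ 2 = gintegral (dist_integrand p beta k u r))%E.
Proof.
have : (0 <= gintegral (dist_integrand p beta k u r))%E.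
  by apply: integral_ge0 => z _; rewrite lee_fin dist_integrand_ge0.
rewrite /dist; case: gintegral => [x| |] //; rewrite ?lee_fin => x0.
  rewrite poweR_EFin -EFin_expe -powR_mulrn ?powR_ge0// -powRrM.
  by rewrite div1r mulVf// powRr1.
by rewrite poweRyr// div1r invr_eq0.
Qed.

Lemma rho_pow4 z : rho (z : G) ^+ 4 = enorm z.1 ^+ 4 + 4 * z.2 ^+ 2.
Proof.
rewrite -powR_mulrn ?rho_ge0// -powRrM.
have -> : 1 / 4 * 4%:R = 1 :> R by field.
by rewrite powRr1// rho4_ge0.
Qed.

Lemma rho_le_box (z : T) (b : R) : 0 < b -> rho (pt z) <= b ->
  (tuple_box n (- b) b `*` `[- b ^+ 2, b ^+ 2]%classic) z.
Proof.
move=> b0 zb; have H : enorm (pt z).1 ^+ 4 + 4 * (pt z).2 ^+ 2 <= b ^+ 4.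
  by rewrite -rho_pow4 ler_pXn2r ?nnegrE ?rho_ge0 ?(ltW b0).
split => [i|] /=.
  have : tnth z.1 i ^+ 2 <= enorm (pt z).1 ^+ 2.
    rewrite enorm_sqr (bigD1 i)//= mxE lerDl sumr_ge0// => j _; exact: sqr_ge0.
  have : (enorm (pt z).1 ^+ 2) ^+ 2 <= (b ^+ 2) ^+ 2.
    by rewrite -!exprM; apply: le_trans H; rewrite lerDl mulr_ge0 ?sqr_ge0.
  rewrite ler_pXn2r ?nnegrE ?sqr_ge0// => H1 H2.
  by rewrite -ler_norml -ler_sqr ?nnegrE ?(ltW b0)// real_normK ?num_real// (le_trans H2).
rewrite in_itv /= -ler_norml -ler_sqr ?nnegrE ?sqr_ge0// real_normK ?num_real//.
have : 4 * z.2 ^+ 2 <= b ^+ 4 by apply: le_trans H; rewrite lerDr exprn_ge0 ?enorm_ge0.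
by rewrite -exprM; have := sqr_ge0 z.2; lra.
Qed.

(** Finiteness allows the Hardy term to be moved across the subtraction in the extended reals. The
    integrand is continuous on the compact support, hence bounded, and that support lies in a box of
    finite measure. *)
Lemma hardy_fin u : test_function u -> (hardy_term p beta k u \is a fin_num)%E.
Proof.
move=> tu; have nu := test_function_nice tu; have u0 := test_function0 tu.
have [su cu s0] := tu.
have [|M MP] := @compact_abs_bound R n (support_of u) (hardy_integrand p beta k u) cu.
  move=> z /set_mem zS; have z0 : z != 0 by apply: contraPneq zS => ->.
  have oP := @open_punctured R n.
  have C : Ck_on punctured 0 (hardy_integrand p beta k u).
    have Cp : Ck_on punctured 0 (fun z => Num.sqrt (psi z)).
      split => // y y0; apply: (@continuous_comp _ _ _ (@psi R n) (@Num.sqrt R)).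
        by have [+ _] := @smooth_psi R n 0%N; apply.
      exact: sqrt_continuous.
    have cpow (f : G -> R) : Ck_on punctured 0 f -> Ck_on punctured 0 (fun z => `|f z| `^ p).
      move=> [cf _]; split => // y y0.
      apply: (@continuous_comp _ _ _ f (fun x : R => `|x| `^ p)); first exact: cf.
      by apply: continuous_normr_powR; exact: ltW.
    apply: (@Ck_on_eq _ _ _ _ (fun z => `|u z| `^ p * `|Num.sqrt (psi z)| `^ p *
        (rho z `^ (k%:R * p + beta))^-1)) => //.
      by move=> y y0; rewrite /hardy_integrand grad_norm_rho// [`|Num.sqrt _|]ger0_norm ?sqrtr_ge0.
    apply: Ck_onM => //; first apply: Ck_onM => //.
    - by apply: cpow; have [Su _] := nu; exact: Su.
    - exact: cpow.
    - have := @smooth_on_powR _ _ _ oP _ (- (k%:R * p + beta)) (fun y (y0 : punctured y) => rho_gt0 y0) smooth_rho 0%N.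
      by under eq_fun do rewrite powRN.
  by have [+ _] := C; apply.
have [_ [B uB]] := nu; pose b := expR B.
have b0 : 0 < b := expR_gt0 B.
pose box := tuple_box n (- b) b `*` `[- b ^+ 2, b ^+ 2]%classic : set T.
have mbox : measurable box by apply: measurableX => //; exact: measurable_tuple_box.
have inbox (z : T) : ~ box z -> u (pt z) = 0.
  move=> nz; apply/eqP; rewrite -[_ == 0]negbK; apply/negP => uz; apply: nz.
  have z0 : pt z != 0 by apply: contra_neq uz => ->.
  have : `|ln (rho (pt z))| <= B by rewrite leNgt; apply: contra_neqN uz; exact: uB.
  rewrite ler_norml => /andP[_]; rewrite -ler_expR lnK ?posrE ?rho_gt0// => rb.
  exact: rho_le_box.
have -> : hardy_term p beta k u =
    (\int[gm]_(z in box) (hardy_integrand p beta k u (pt z))%:E)%E.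
  rewrite [RHS]integral_mkcond; apply: eq_integral => z _; rewrite patchE.
  case: ifPn => //; rewrite notin_setE => /inbox uz.
  by rewrite /hardy_integrand uz normr0 powR0 ?gt_eqF// !mul0r.
rewrite ge0_fin_numE; last first.
  by apply: integral_ge0 => z _; rewrite lee_fin hardy_integrand_ge0.
apply: (@le_lt_trans _ _ (\int[gm]_(z in box) (cst `|M|%:E) z)%E).
  apply: ge0_le_integral => //.
  - by move=> z _; rewrite lee_fin hardy_integrand_ge0.
  - apply: measurable_funTS; apply/measurable_EFinP; exact: gmeas_hardy.
  - move=> z _; rewrite lee_fin.
    have [zS|zS] := pselect (support_of u (pt z)).
      by rewrite (le_trans (ler_norm _))// (le_trans (MP _ zS))// ler_norm.
    have uz : u (pt z) = 0.
      by apply/eqP; rewrite -[_ == 0]negbK; apply/negP => uz; apply: zS; exact: subset_closure.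
    by rewrite /hardy_integrand uz normr0 powR0 ?gt_eqF// !mul0r.
have gb : grushin_measure box = ((b - - b) ^+ n * (b ^+ 2 - - b ^+ 2))%:E :> \bar R.
  apply: grushin_box; first by rewrite (le_trans _ (ltW b0))// oppr_le0 ltW.
  by rewrite (le_trans _ (sqr_ge0 b))// oppr_le0 sqr_ge0.
rewrite integral_cst//; suff : (`|M|%:E * grushin_measure box < +oo)%E by [].
by rewrite gb -EFinM ltry.
Qed.

(** Serves both parities: the energy enters only through its normal form [fray] on orbits, as a list
    of roots. *)
Lemma energy_ineq (d : R) (rs : seq R) (f : G -> R) u :
  test_function u -> gmeas f -> (forall z, 0 <= f z) -> f 0 = 0 ->
  (forall w s, w != 0 -> f (dil s w) * expR s ^+ (n + 2) =
    weight p beta k w * `|ops rs (twist a u w) s| `^ p) ->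
  0 < d <= 1 -> rs != [::] -> (forall b, b \in rs -> b != 0 -> d <= `|b|) ->
  (count_mem (0%R : R) rs <= 1)%N -> (2 < p -> 0 \notin rs) ->
  ((d `^ p ^+ size rs / (2 * p))%:E * sup_dist2 p beta k u <=
   gintegral f - (\prod_(b <- rs) `|b| `^ p)%:E * hardy_term p beta k u)%E.
Proof.
move=> tu mf f0 f00 fray d01 rs0 dr cr pr.
have nu := test_function_nice tu; have u0 := test_function0 tu.
set C := d `^ p ^+ size rs / (2 * p); set P := \prod_(b <- rs) _.
have C0 : 0 < C.
  by rewrite divr_gt0 ?mulr_gt0// exprn_gt0// powR_gt0//; case/andP: d01.
have P0 : 0 <= P by apply: prodr_ge0 => b _; exact: powR_ge0.
rewrite leeBrDr; last by rewrite fin_numM// hardy_fin.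
(* The estimate for one radius, with the subtracted term on the other side: both sides are then
   integrals of nonnegative functions and can be compared orbit by orbit. [C] does not depend on
   [r], so the supremum may be taken at the end. *)
have {}H r : 0 < r -> (C%:E * gintegral (dist_integrand p beta k u r) +
    P%:E * hardy_term p beta k u <= gintegral f)%E.
  move=> r0; rewrite /gintegral ge0_integral_comb//; last 5 first.
  - exact: gmeas_dist.
  - exact: gmeas_hardy.
  - by move=> z; exact: dist_integrand_ge0.
  - by move=> z; exact: hardy_integrand_ge0.
  - exact: ltW.
  apply: (@polar_le R n (fun z => C * dist_integrand p beta k u r z + P * hardy_integrand p beta k u z) f) => //.
  - apply: gmeasD; apply: gmeasM; try exact: measurable_cst.
      exact: gmeas_dist.
    exact: gmeas_hardy.
  - move=> z; apply: addr_ge0; apply: mulr_ge0 => //; first exact: ltW.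
      exact: dist_integrand_ge0.
    exact: hardy_integrand_ge0.
  - by rewrite dist_integrand0// hardy_integrand0// !mulr0 addr0.
  - move=> w w0; pose s0 := ln r - ln (rho w); pose g := twist a u w.
    have tg : test1 g by exact: test1_twist.
    pose h s := (signed_pow p (g s) - signed_pow p (g s0)) ^+ 2 / (s - s0) ^+ 2.
    have cg : continuous g by apply: smooth_continuous; exact: tg.1.
    have msg : measurable_fun setT (fun s => signed_pow p (g s)).
      have mg : measurable_fun setT g by exact: continuous_measurable_fun.
      apply: measurable_funM => //.
      apply: (measurableT_comp (@measurable_powR R ((p - 2) / 2))).
      exact: (measurableT_comp (@normr_measurable R setT) mg).
    have mh : measurable_fun setT h.
      apply: measurable_funM.
        by apply: measurable_funX; exact: measurable_funB.
      have -> : (fun s => ((s - s0) ^+ 2)^-1) = (fun s => ((s - s0) ^+ 2) `^ (-1)).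
        by apply/funext => s; rewrite powR_inv1 ?sqr_ge0.
      apply: (measurableT_comp (@measurable_powR R (-1))).
      by apply: measurable_funX; exact: measurable_funB.
    have h0 s : 0 <= h s by rewrite divr_ge0 ?sqr_ge0.
    have mgp : measurable_fun setT (fun s => `|g s| `^ p).
      apply: continuous_measurable_fun => s.
      apply: (@continuous_comp _ _ _ g (fun x : R => `|x| `^ p)); first exact: cg.
      by apply: continuous_normr_powR; exact: ltW.
    have mop : measurable_fun setT (fun s => `|ops rs g s| `^ p).
      have [So _] := test1_ops rs tg; have co := smooth_continuous So.
      apply: continuous_measurable_fun => s.
      apply: (@continuous_comp _ _ _ (ops rs g) (fun x : R => `|x| `^ p)); first exact: co.
      by apply: continuous_normr_powR; exact: ltW.
    have W0 : 0 <= weight p beta k w by rewrite divr_ge0 ?powR_ge0.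
    have hs0 : h s0 = 0 by rewrite /h !subrr expr0n /= mul0r.
    have hh x : x != s0 -> h x <= (signed_pow p (g x) - signed_pow p (g s0)) ^+ 2 / (x - s0) ^+ 2.
      by [].
    have := ops_remainder p2 tg d01 rs0 dr cr pr mh h0 hs0 hh.
    rewrite -/C -/P ge0_integral_comb//; last exact: ltW.
    have E1 s : (C * dist_integrand p beta k u r (dil s w) +
         P * hardy_integrand p beta k u (dil s w)) * expR s ^+ (n + 2) =
       weight p beta k w * (C * h s + P * `|g s| `^ p).
      have key (A B D : R) : (C * A + P * B) * D = C * (A * D) + P * (B * D) by ring.
      have key' (V A B : R) : C * (V * A) + P * (V * B) = V * (C * A + P * B) by ring.
      apply: etrans (key _ _ _) _; apply: etrans (key' _ _ _).
      by congr (C * _ + P * _); [exact: dist_ray|exact: hardy_ray].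
    move=> H; apply: (@le_trans _ _ (\int[leb]_s ((weight p beta k w)%:E * (C * h s + P * `|g s| `^ p)%:E))%E).
      rewrite le_eqVlt; apply/orP; left; apply/eqP; apply: eq_integral => s _.
      by rewrite -EFinM; congr EFin; exact: E1.
    apply: (@le_trans _ _ (\int[leb]_s ((weight p beta k w)%:E * (`|ops rs g s| `^ p)%:E))%E); last first.
      rewrite le_eqVlt; apply/orP; left; apply/eqP; apply: eq_integral => s _.
      by rewrite -EFinM; congr EFin; exact/esym/fray.
    have pull (X : mR -> mR) : measurable_fun setT X -> (forall s, 0 <= X s) ->
        (\int[leb]_s ((weight p beta k w)%:E * (X s)%:E) = (weight p beta k w)%:E * \int[leb]_s (X s)%:E)%E.
      move=> mX X0; rewrite ge0_integralZl_EFin// => [s _|]; first by rewrite lee_fin.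
      exact/measurable_EFinP.
    rewrite (pull _ mop) => [|s]; last exact: powR_ge0.
    rewrite (pull (fun s => C * h s + P * `|g s| `^ p)).
    + by apply: lee_wpmul2l H; rewrite lee_fin.
    + by apply: measurable_funD; apply: measurable_funM.
    + by move=> s; apply: addr_ge0; apply: mulr_ge0; rewrite ?powR_ge0// ltW.
have H0 : (0 <= hardy_term p beta k u)%E.
  by apply: integral_ge0 => z _; rewrite lee_fin hardy_integrand_ge0.
have hf := hardy_fin tu.
have PH : ((P%:E * hardy_term p beta k u)%E \is a fin_num) by rewrite fin_numM.
rewrite -leeBrDr// -lee_pdivlMl//; apply: ub_ereal_sup => _ [r r0 <-].
by rewrite dist_sqr lee_pdivlMl// leeBrDr//; exact: H.
Qed.

End energy_inequality.

(** * Sharpness *)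

Section plateau.
Context {R : realType}.
Local Notation mR := (measurableTypeR R).
Local Notation leb := (@lebesgue_measure R).
Implicit Types (g f : R -> R) (rs : seq R).

Lemma ops_local rs (A : set R) f g : open A -> (forall x, A x -> f x = g x) ->
  forall x, A x -> ops rs f x = ops rs g x.
Proof.
move=> oA fg; elim: rs => [|b rs IH] x Ax /=; first exact: fg.
rewrite /op IH//; congr (_ - _); apply: near_eq_derive.
by have := open_nbhs_nbhs (conj oA Ax); apply: filterS => y /IH.
Qed.

Lemma op_shift b (c l : R) f : smooth_on setT f ->
  op b (fun s => c * f (s + l)) = (fun s => c * op b f (s + l)).
Proof.
move=> Sf; apply/funext => s; rewrite /op.
have Ds : is_derive s 1 (fun s : R => s + l) 1.
  by rewrite -[X in is_derive _ _ _ X]addr0; apply: is_deriveD.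
have D := @is_derive1_comp R f (fun s => s + l) s _ _ (smooth_derivable (s + l) Sf) Ds.
rewrite (is_deriveW (is_deriveZ c D)) /GRing.scale /=; ring.
Qed.

Lemma smooth_on_ops rs f : smooth_on setT f -> smooth_on setT (ops rs f).
Proof. by move=> Sf; elim: rs => //= b rs; exact: smooth_on_op. Qed.

Lemma ops_shift rs (c l : R) f : smooth_on setT f ->
  ops rs (fun s => c * f (s + l)) = (fun s => c * ops rs f (s + l)).
Proof.
by move=> Sf; elim: rs => //= b rs ->; rewrite op_shift//; exact: smooth_on_ops.
Qed.

Lemma ops_cst rs (c : R) : ops rs (fun=> c) = (fun=> (\prod_(b <- rs) - b) * c).
Proof.
elim: rs => [|b rs /= ->]; first by rewrite big_nil mul1r.
apply/funext => x; rewrite /op big_cons.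
have -> : 'D_1 (fun=> (\prod_(b0 <- rs) - b0) * c) x = 0 by exact: derive_cst.
by rewrite sub0r mulrA !mulNr.
Qed.

Definition step_rev (x : R) : R := step (- x).

Lemma smooth_step_rev : smooth_on setT step_rev.
Proof.
apply: (smooth_on_comp openT smooth_step) => k.
by apply: Ck_on_linear => [x|h v z]; [exact: opp_continuous|rewrite opprD mulrN].
Qed.

Definition plateau (N : R) (x : R) : R := step (x + (N + 1)) * step_rev (x - (N + 1)).

Lemma smooth_shift (l : R) f : smooth_on setT f -> smooth_on setT (fun x => f (x + l)).
Proof.
move=> Sf; apply: (smooth_on_comp openT Sf); apply: smooth_onD; first exact: openT.
  by move=> k; apply: Ck_on_linear => // x; exact: cvg_id.
exact: smooth_on_cst.
Qed.

Lemma smooth_plateau N : smooth_on setT (plateau N).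
Proof.
by apply: smooth_onM; [exact: openT|exact/smooth_shift/smooth_step|exact/smooth_shift/smooth_step_rev].
Qed.

Lemma plateau1 (N x : R) : - N <= x <= N -> plateau N x = 1.
Proof.
by move=> /andP[x1 x2]; rewrite /plateau /step_rev !step_eq1 ?mulr1//; lra.
Qed.

Lemma plateau0 (N x : R) : N + 1 <= `|x| -> plateau N x = 0.
Proof.
rewrite ler_normr /plateau /step_rev => /orP[] H.
  by rewrite [step (- _)]step_eq0 ?mulr0//; lra.
by rewrite step_eq0 ?mul0r//; lra.
Qed.

Lemma plateau_left (N x : R) : x < N -> plateau N x = step (x + (N + 1)).
Proof. by move=> xN; rewrite /plateau /step_rev [step (- _)]step_eq1 ?mulr1//; lra. Qed.

Lemma plateau_right (N x : R) : - N < x -> plateau N x = step_rev (x - (N + 1)).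
Proof. by move=> xN; rewrite /plateau step_eq1 ?mul1r//; lra. Qed.

(** The constant [M] serves all [N >= 1]: near each end the plateau is a translate of a fixed step,
    and the operators commute with translations. In the middle the plateau is 1, on which each
    factor [D - b] acts as multiplication by [- b]. *)
Lemma plateau_bound rs (p : R) : 0 < p -> exists2 M : R, 0 <= M & forall N x : R, 1 <= N ->
  `|ops rs (plateau N) x| `^ p <= (\prod_(b <- rs) `|b| `^ p) * \1_(`[- N, N]%classic : set R) x
    + M * \1_(`[- N - 1, - N]%classic : set R) x + M * \1_(`[N, N + 1]%classic : set R) x.
Proof.
move=> p0.
have bnd f (a b : R) : a <= b -> smooth_on setT f ->
    exists M, forall x, a <= x <= b -> `|ops rs f x| `^ p <= M.
  move=> ab Sf; have cf := smooth_continuous (smooth_on_ops rs Sf).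
  have cF : {within `[a, b], continuous (fun x => `|ops rs f x| `^ p)}.
    apply: continuous_subspaceT => x.
    apply: (@continuous_comp _ _ _ (ops rs f) (fun x : R => `|x| `^ p)); first exact: cf.
    by apply: continuous_normr_powR; exact: ltW.
  have [c _ H] := EVT_max ab cF.
  by exists (`|ops rs f c| `^ p) => x xab; apply: H; rewrite in_itv.
have [M1 HM1] := bnd _ 0 1 ler01 smooth_step.
have [M2 HM2] := bnd _ (- 1) 0 (lerN10 R) smooth_step_rev.
have sh f (l : R) x : smooth_on setT f -> ops rs (fun x => f (x + l)) x = ops rs f (x + l).
  move=> Sf; have := ops_shift rs 1 l Sf.
  have -> : (fun s => 1 * f (s + l)) = (fun s => f (s + l)) by apply/funext => s; rewrite mul1r.
  by move=> ->; rewrite mul1r.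
pose M := `|M1| + `|M2|; have M0 : 0 <= M by rewrite addr_ge0.
have P0 : 0 <= \prod_(b <- rs) `|b| `^ p by apply: prodr_ge0 => b _; exact: powR_ge0.
have MI (A : set R) (x : R) : 0 <= M * \1_A x by rewrite mulr_ge0// indicE.
have PI (A : set R) (x : R) : 0 <= (\prod_(b <- rs) `|b| `^ p) * \1_A x.
  by rewrite mulr_ge0// indicE.
exists M => // N x N1.
have [xl|xl] := ltP x (- N - 1).
  have -> : ops rs (plateau N) x = 0.
    apply: etrans (_ : ops rs (fun=> 0) x = 0); last by rewrite ops_cst mulr0.
    apply: (@ops_local rs [set y | y < - N - 1]); [exact: open_lt| |exact: xl].
    by move=> y /= yN; apply: plateau0; rewrite ler_normr; apply/orP; right; lra.
  by rewrite normr0 powR0 ?gt_eqF// !addr_ge0.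
have [xr|xr] := ltP (N + 1) x.
  have -> : ops rs (plateau N) x = 0.
    apply: etrans (_ : ops rs (fun=> 0) x = 0); last by rewrite ops_cst mulr0.
    apply: (@ops_local rs [set y | N + 1 < y]); [exact: open_gt| |exact: xr].
    by move=> y /= yN; apply: plateau0; rewrite ler_normr; apply/orP; left; lra.
  by rewrite normr0 powR0 ?gt_eqF// !addr_ge0.
have [x1|x1] := leP x (- N).
  have -> : ops rs (plateau N) x = ops rs step (x + (N + 1)).
    rewrite -sh; last exact: smooth_step.
    apply: (@ops_local rs [set y | y < N]); first exact: open_lt.
      by move=> y /= yN; exact: plateau_left.
    by rewrite /=; lra.
  have -> : \1_(`[- N - 1, - N]%classic : set R) x = 1 :> R.
    by rewrite indicE mem_set//= in_itv /= xl x1.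
  rewrite mulr1 -addrA addrCA; apply: ler_wpDr; first by rewrite addr_ge0.
  apply: le_trans (HM1 _ _) _; first lra.
  by rewrite (le_trans (ler_norm _))// lerDl.
have [x2|x2] := leP N x.
  have -> : ops rs (plateau N) x = ops rs step_rev (x - (N + 1)).
    rewrite -sh; last exact: smooth_step_rev.
    apply: (@ops_local rs [set y | - N < y]); first exact: open_gt.
      by move=> y /= yN; exact: plateau_right.
    by rewrite /=; lra.
  have -> : \1_(`[N, N + 1]%classic : set R) x = 1 :> R.
    by rewrite indicE mem_set//= in_itv /= xr x2.
  rewrite mulr1; apply: ler_wpDl; first by rewrite addr_ge0.
  apply: le_trans (HM2 _ _) _; first lra.
  by rewrite (le_trans (ler_norm _))// lerDr.
have -> : ops rs (plateau N) x = \prod_(b <- rs) (- b).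
  have o : open [set y : R | - N < y < N].
    have -> : [set y : R | - N < y < N] = `]- N, N[%classic.
      by apply/seteqP; split => y /=; rewrite in_itv.
    exact: interval_open.
  apply: etrans (_ : ops rs (fun=> 1) x = _); last by rewrite ops_cst mulr1.
  apply: (@ops_local rs [set y | - N < y < N]) => //; last by rewrite /= x1 x2.
  by move=> y /andP[y1 y2]; apply: plateau1; rewrite !ltW.
have -> : \1_(`[- N, N]%classic : set R) x = 1 :> R.
  by rewrite indicE mem_set//= in_itv /= !ltW.
rewrite mulr1 -addrA; apply: ler_wpDr; first by rewrite addr_ge0.
rewrite le_eqVlt; apply/orP; left; apply/eqP.
elim: rs {P0 PI bnd HM1 HM2 sh} => [|b rs IH]; first by rewrite !big_nil normr1 powR1.
by rewrite !big_cons normrM powRM// normrN IH.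
Qed.

Lemma integral_indic_shift (c l a b : R) : 0 <= c -> a <= b ->
  (\int[leb]_s (c * \1_(`[a, b]%classic : set R) (s + l))%:E = (c * (b - a))%:E)%E.
Proof.
move=> c0 ab.
have E s : (\1_(`[a, b]%classic : set R) (s + l)) = \1_(`[a - l, b - l]%classic : set mR) s :> R.
  rewrite !indicE !mem_setE !in_itv /= lerBlDr lerBrDr //.
under eq_integral do rewrite E EFinM.
rewrite ge0_integralZl_EFin//; last first.
  by apply/measurable_EFinP; exact: measurable_indic.
rewrite integral_indic// setIT /= lebesgue_measure_itv /= lte_fin EFinM; congr (_ * _)%E.
rewrite ltrD2r; case: ltP => [_|ba]; first by rewrite -EFinB; congr EFin; ring.
have -> : b = a by apply/eqP; rewrite eq_le ab ba.
by rewrite subrr.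
Qed.

End plateau.

Section cutoff.
Context {R : realType} {n : nat}.
Local Notation mR := (measurableTypeR R).
Local Notation G := (grushin R n).
Local Notation T := (n.-tuple mR * mR)%type.
Local Notation pt := (@grushin_pt R n).
Local Notation punctured := (@punctured R n).
Variables (a N : R).
Hypothesis N0 : 0 <= N.

Definition cutoff (z : G) : R :=
  if z == 0 then 0 else rho z `^ (- a) * plateau N (ln (rho z)).

Lemma cutoff_nice : nice cutoff.
Proof.
have oP := @open_punctured R n.
split; last first.
  exists (N + 1) => z z0 zN; rewrite /cutoff (negbTE z0) plateau0 ?mulr0//; exact: ltW.
apply: (@smooth_on_eq _ _ _ oP (fun z => rho z `^ (- a) * plateau N (ln (rho z)))).
  by move=> z z0; rewrite /cutoff (negbTE z0).
apply: smooth_onM => //.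
  by apply: smooth_on_powR => //; [move=> z; exact: rho_gt0|exact: smooth_rho].
apply: (smooth_on_comp oP (@smooth_plateau R N)).
by apply: smooth_on_ln => //; [move=> z; exact: rho_gt0|exact: smooth_rho].
Qed.

Lemma cutoff_ray w s : w != 0 ->
  twist a cutoff w s = rho w `^ (- a) * plateau N (s + ln (rho w)).
Proof.
move=> w0; rewrite /twist /ray /cutoff (negbTE (dil_neq0 s w0)) rho_dil_powR rho_dil.
rewrite lnM ?posrE ?expR_gt0 ?rho_gt0// expRK !mulrA -expRD mulNr subrr expR0 mul1r.
by [].
Qed.

Lemma pt_surj (z : G) : exists y : T, z = pt y.
Proof.
exists ([tuple z.1 0 i | i < n], z.2); case: z => x t; congr pair.
by apply/rowP => i; rewrite mxE tnth_mktuple.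
Qed.

Lemma cutoff_test : test_function cutoff.
Proof.
have [Sc [M cM]] := cutoff_nice.
(* [B] is the set [rho < expR (- (N + 1))], where the cutoff vanishes. It is written with fourth
   powers because [rho^4] is a polynomial, continuous at the origin as well. *)
pose e := expR (- (N + 1)) ^+ 4; pose B := [set z : G | enorm z.1 ^+ 4 + 4 * z.2 ^+ 2 < e].
have e0 : 0 < e by rewrite exprn_gt0// expR_gt0.
have oB : open B.
  apply: (@open_comp _ _ (fun z : G => enorm z.1 ^+ 4 + 4 * z.2 ^+ 2) [set x : R | x < e]).
    by move=> z _; have [+ _] := @smooth_rho4 R n setT openT 0%N; exact.
  exact: open_lt.
have B0 : B 0 by have := rho_pow4 (0 : G); rewrite rho0 expr0n /= /B /= => <-.
have cB z : B z -> cutoff z = 0.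
  rewrite /B /= -rho_pow4 => zB; rewrite /cutoff; case: eqVneq => // z0.
  rewrite plateau0 ?mulr0// ler_normr; apply/orP; right.
  move: zB; rewrite /e ltr_pXn2r ?nnegrE ?rho_ge0 ?expR_ge0// -[X in X < _]lnK ?posrE ?rho_gt0//.
  by rewrite ltr_expR => /ltW; rewrite lerNr.
split.
- move=> k; apply: Ck_on_is_Ck; have -> : [set: G] = punctured `|` B.
    apply/seteqP; split => // z _; have [->|z0] := eqVneq z 0; [by right|by left].
  apply: Ck_onU; first exact: Sc.
  by apply: (@Ck_on_eq _ _ _ _ (fun=> 0)) => [|z /cB ->|]; [exact: oB| |exact: Ck_on_cst].
- pose b := expR (N + 1).
  pose K := [set x : 'rV[R]_n | forall i, `[- b, b]%classic (x 0 i)] `*` `[- b ^+ 2, b ^+ 2]%classic : set G.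
  have cK : compact K.
    apply: compact_setX; last exact: segment_compact.
    apply: (@rV_compact _ _ (fun=> `[- b, b]%classic)) => i; exact: segment_compact.
  apply: (subclosed_compact _ cK); first exact: closed_closure.
  have clK : closed K by apply: compact_closed cK; exact: norm_hausdorff.
  rewrite /support_of [X in _ `<=` X](iffLR (closure_id _) clK).
  apply: closureS => z /= uz.
  have z0 : z != 0 by apply: contra_neq uz => ->; rewrite /cutoff eqxx.
  have zN : `|ln (rho z)| <= N + 1.
    rewrite leNgt; apply: contra_neqN uz => zN.
    by rewrite /cutoff (negbTE z0) plateau0 ?mulr0// ltW.
  have rb : rho z <= b.
    move: zN; rewrite ler_norml => /andP[_ zN].
    by rewrite -[leLHS]lnK ?posrE ?rho_gt0// ler_expR.
  have [y yz] := pt_surj z; rewrite yz in rb *.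
  have [y1 y2] := rho_le_box (expR_gt0 _ : 0 < b) rb.
  by split => [i|//]; rewrite /= mxE in_itv; exact: y1.
- move=> s0; have [z [uz zB]] := s0 B (open_nbhs_nbhs (conj oB B0)).
  by move: uz; rewrite /= cB// eqxx.
Qed.

End cutoff.

Section angular_mass.
Context {R : realType} {n : nat}.
Local Notation mR := (measurableTypeR R).
Local Notation gm := (@grushin_measure R n).
Local Notation G := (grushin R n).
Local Notation T := (n.-tuple mR * mR)%type.
Local Notation pt := (@grushin_pt R n).
Variables (p beta : R) (k : nat).
Hypothesis p2 : 2 <= p.
Hypothesis n1 : (1 <= n)%N.
Local Notation a := (@expo R n p beta k).

Let p0 : 0 < p. Proof. exact: lt_le_trans p2. Qed.

(** The density on the shell that remains once the orbit variable is integrated out for a cutoff: on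
    each orbit the twisted cutoff is [rho^(- a)] times a translate of the plateau, and translations
    do not change integrals on the line. *)
Definition ang (z : G) : R :=
  shell z * (weight p beta k z * rho z `^ (- (a * p))).

Lemma gmeas_ang : gmeas ang.
Proof.
apply: gmeasM; first exact: (measurable_shell gmeas_rho).
apply: gmeasM; last by apply: gmeas_powR; exact: gmeas_rho.
apply: gmeasM; last first.
  by apply: gmeasV => [z|]; [exact: powR_ge0|apply: gmeas_powR; exact: gmeas_rho].
apply: gmeas_powR.
have -> : (fun z : G => Num.sqrt (psi z)) = (fun z => psi z `^ 2^-1).
  by apply/funext => z; rewrite powR12_sqrt// psi_ge0.
by apply: gmeas_powR; apply: gmeas_smooth; exact: smooth_psi.
Qed.

Lemma ang_ge0 z : 0 <= ang z.
Proof. by rewrite /ang mulr_ge0 ?shell_ge0// mulr_ge0 ?powR_ge0// divr_ge0 ?powR_ge0. Qed.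

Lemma psi_le1 (z : G) : psi z <= 1.
Proof.
have [->|z0] := eqVneq z 0; first by rewrite /psi rho0 expr0n invr0 mulr0.
rewrite /psi ler_pdivrMr ?exprn_gt0 ?rho_gt0// mul1r.
rewrite -ler_sqr ?nnegrE ?sqr_ge0// -!exprM rho_pow4 lerDl mulr_ge0 ?sqr_ge0//.
Qed.

Lemma rho_powR_shell z c : shell z != 0 -> expR (- `|c|) <= rho (z : G) `^ c <= expR `|c|.
Proof.
rewrite /shell; case: ifP => [/andP[rz /andP[l0 l1]] _|]; last by rewrite eqxx.
have -> : rho z `^ c = expR (c * ln (rho z)) by rewrite /powR gt_eqF.
rewrite !ler_expR -ler_norml normrM (ger0_norm l0).
by rewrite ler_piMr.
Qed.

(** The total mass of [ang], a common factor of the energy bound and of the Hardy bound for cutoffs.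
    It can be cancelled because it is finite and positive. *)
Definition kappa : \bar R := (\int[gm]_z (ang (pt z))%:E)%E.

Lemma kappa_fin : kappa \is a fin_num.
Proof.
have k0 : (0 <= kappa)%E by apply: integral_ge0 => z _; rewrite lee_fin ang_ge0.
rewrite ge0_fin_numE//.
pose b := expR 1 : R; have b0 : 0 < b := expR_gt0 1.
pose box := tuple_box n (- b) b `*` `[- b ^+ 2, b ^+ 2]%classic : set T.
have mbox : measurable box by apply: measurableX => //; exact: measurable_tuple_box.
have inbox (z : T) : shell (pt z) != 0 -> box z.
  rewrite /shell; case: ifP => [/andP[rz /andP[_ l1]] _|]; last by rewrite eqxx.
  by apply: rho_le_box => //; rewrite -[leLHS]lnK ?posrE// ler_expR.
pose K := expR `|- (k%:R * p + beta)| * expR `|- (a * p)|.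
have -> : kappa = (\int[gm]_(z in box) (ang (pt z))%:E)%E.
  rewrite [RHS]integral_mkcond; apply: eq_integral => z _; rewrite patchE.
  case: ifPn => //; rewrite notin_setE => nb.
  have s0 : shell (pt z) = 0 by apply/eqP; rewrite -[_ == 0]negbK; apply/negP => /inbox.
  by rewrite /ang s0 mul0r.
apply: (@le_lt_trans _ _ (\int[gm]_(z in box) (cst K%:E) z)%E).
  apply: ge0_le_integral => //.
  - by move=> z _; rewrite lee_fin ang_ge0.
  - by apply: measurable_funTS; apply/measurable_EFinP; exact: gmeas_ang.
  - move=> z _; rewrite lee_fin /ang.
    have [s0|s0] := eqVneq (shell (pt z)) 0.
      by rewrite s0 mul0r mulr_ge0 ?expR_ge0.
    have [_ h1] := andP (rho_powR_shell (- (k%:R * p + beta)) s0).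
    have [_ h2] := andP (rho_powR_shell (- (a * p)) s0).
    apply: (@le_trans _ _ (1 * (weight p beta k (pt z) * rho (pt z) `^ (- (a * p))))).
      apply: ler_wpM2r; first by rewrite mulr_ge0 ?powR_ge0// divr_ge0 ?powR_ge0.
      by rewrite /shell; case: ifP.
    rewrite mul1r; apply: ler_pM => //; rewrite ?divr_ge0 ?powR_ge0//.
    rewrite /weight -powRN; apply: le_trans h1; rewrite ler_piMl ?powR_ge0//.
    have -> : 1 = 1 `^ p :> R by rewrite powR1.
    apply: ge0_ler_powR; rewrite ?nnegrE ?sqrtr_ge0 ?(ltW p0)//.
    by rewrite -[leRHS]sqrtr1 ler_sqrt// psi_le1.
have gb : grushin_measure box = ((b - - b) ^+ n * (b ^+ 2 - - b ^+ 2))%:E :> \bar R.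
  apply: grushin_box; first by rewrite (le_trans _ (ltW b0))// oppr_le0 ltW.
  by rewrite (le_trans _ (sqr_ge0 b))// oppr_le0 sqr_ge0.
rewrite integral_cst//; suff : (K%:E * grushin_measure box < +oo)%E by [].
by rewrite gb -EFinM ltry.
Qed.

Lemma kappa_gt0 : (0 < kappa)%E.
Proof.
have n0 : 0 < n%:R :> R by rewrite ltr0n.
(* A box inside the shell on which [psi] is bounded below. For [x_i] between [c] and [11 / 10 * c]
   one has [1 <= |x|^2 <= 121 / 100]; with [0 <= t <= 1 / 2] this gives [1 <= rho^4 <= 16], so
   [1 <= rho <= 2 <= e] and [psi >= 1 / 4]. *)
pose c := (Num.sqrt n%:R)^-1 : R.
have c0 : 0 < c by rewrite invr_gt0 sqrtr_gt0.
have nc : n%:R * c ^+ 2 = 1 by rewrite /c exprVn sqr_sqrtr ?(ltW n0)// divff// gt_eqF.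
pose b2 := 11 / 10 * c; have b12 : c <= b2 by rewrite /b2; lra.
pose box := tuple_box n c b2 `*` `[0, 1 / 2]%classic : set T.
have mbox : measurable box by apply: measurableX => //; exact: measurable_tuple_box.
pose K := (1 / 2) `^ p * expR (- `|- (k%:R * p + beta)|) * expR (- `|- (a * p)|).
have K0 : 0 < K by rewrite !mulr_gt0 ?expR_gt0// powR_gt0.
have onbox (z : T) : box z -> K <= ang (pt z).
  move=> [zb /=]; rewrite in_itv /= => /andP[t0 t1].
  have S1 : 1 <= enorm (pt z).1 ^+ 2.
    rewrite enorm_sqr -nc mulr_natl -[n in _ *+ n]card_ord -sumr_const; apply: ler_sum => i _.
    by rewrite mxE ler_pXn2r ?nnegrE ?(ltW c0)//; have /andP[h1 h2] := zb i; rewrite // (le_trans (ltW c0)).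
  have S2 : enorm (pt z).1 ^+ 2 <= 121 / 100.
    have -> : 121 / 100 = n%:R * (b2 ^+ 2) :> R.
      by rewrite /b2 exprMn mulrCA nc; field.
    rewrite enorm_sqr mulr_natl -[n in _ *+ n]card_ord -sumr_const; apply: ler_sum => i _.
    have /andP[h1 h2] := zb i; rewrite mxE ler_pXn2r ?nnegrE//.
      by rewrite (le_trans (ltW c0)).
    by rewrite (le_trans (ltW c0)).
  have t2 : z.2 ^+ 2 <= 1 / 4.
    have -> : 1 / 4 = (1 / 2) ^+ 2 :> R by field.
    by rewrite ler_pXn2r ?nnegrE//; lra.
  have r4 : 1 <= rho (pt z) ^+ 4 <= 2 ^+ 4.
    rewrite rho_pow4 (exprM _ 2 2) /=; have := sqr_ge0 z.2; have := sqr_ge0 (enorm (pt z).1 ^+ 2 - 1).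
    move: S1 S2 t2; set S := enorm _ ^+ 2; set t := z.2 ^+ 2 => S1 S2 t2 _ t0'.
    by apply/andP; split; nra.
  have r1 : 1 <= rho (pt z).
    rewrite -(@ler_pXn2r _ 4) ?nnegrE ?rho_ge0// expr1n; by case/andP: r4.
  have r2 : rho (pt z) <= 2.
    rewrite -(@ler_pXn2r _ 4) ?nnegrE ?rho_ge0//; by case/andP: r4.
  have r0 : 0 < rho (pt z) by rewrite (lt_le_trans ltr01).
  have sh : shell (pt z) = 1.
    rewrite /shell r0 ln_ge0//= ifT// -ler_expR lnK ?posrE// (le_trans r2)//.
    by have := expR_ge1Dx (1 : R); rewrite (_ : 1 + 1 = 2).
  have s0 : shell (pt z) != 0 by rewrite sh oner_neq0.
  have [h1 _] := andP (rho_powR_shell (- (k%:R * p + beta)) s0).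
  have [h2 _] := andP (rho_powR_shell (- (a * p)) s0).
  rewrite /ang sh mul1r /K /weight -powRN.
  apply: ler_pM => //; rewrite ?mulr_ge0 ?powR_ge0 ?expR_ge0//.
  apply: ler_pM => //; rewrite ?powR_ge0 ?expR_ge0//.
  apply: ge0_ler_powR; rewrite ?nnegrE ?sqrtr_ge0 ?(ltW p0)//.
  have -> : 1 / 2 = Num.sqrt ((1 / 2) ^+ 2) :> R by rewrite sqrtr_sqr ger0_norm.
  rewrite ler_sqrt ?psi_ge0// /psi ler_pdivlMr ?exprn_gt0//.
  apply: le_trans S1; rewrite -exprMn -[leRHS](expr1n _ 2) ler_pXn2r ?nnegrE ?mulr_ge0 ?rho_ge0//.
  by lra.
apply: (@lt_le_trans _ _ (\int[gm]_(z in box) (cst K%:E) z)%E).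
  have gb : grushin_measure box = ((b2 - c) ^+ n * (1 / 2 - 0))%:E :> \bar R.
    by apply: grushin_box.
  rewrite integral_cst//; suff : (0 < K%:E * grushin_measure box)%E by [].
  rewrite gb -EFinM lte_fin; apply: mulr_gt0 => //; apply: mulr_gt0.
    by rewrite exprn_gt0// /b2; lra.
  by rewrite subr0 divr_gt0.
apply: (@le_trans _ _ (\int[gm]_(z in box) (ang (pt z))%:E)%E).
  apply: ge0_le_integral => //.
  - by move=> z _; rewrite lee_fin ltW.
  - by apply: measurable_funTS; apply/measurable_EFinP; exact: gmeas_ang.
rewrite /kappa; apply: ge0_subset_integral => //.
- by apply/measurable_EFinP; exact: gmeas_ang.
- by move=> z _; rewrite lee_fin ang_ge0.
Qed.

End angular_mass.

Section cutoff_energy.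
Context {R : realType} {n : nat}.
Local Notation mR := (measurableTypeR R).
Local Notation leb := (@lebesgue_measure R).
Local Notation G := (grushin R n).
Local Notation pt := (@grushin_pt R n).
Variables (p beta : R) (k : nat).
Hypothesis p2 : 2 <= p.
Local Notation a := (@expo R n p beta k).
Local Notation ang := (@ang R n p beta k).
Local Notation kappa := (@kappa R n p beta k).

Let p0 : 0 < p. Proof. exact: lt_le_trans p2. Qed.

Lemma cutoff_ops rs N (w : G) s : w != 0 ->
  weight p beta k w * `|ops rs (twist a (cutoff a N) w) s| `^ p =
  weight p beta k w * rho w `^ (- (a * p)) * `|ops rs (plateau N) (s + ln (rho w))| `^ p.
Proof.
move=> w0; have -> : twist a (cutoff a N) w = (fun s => rho w `^ (- a) * plateau N (s + ln (rho w))).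
  by apply/funext => t; rewrite cutoff_ray.
rewrite ops_shift; last exact: smooth_plateau.
rewrite normrM powRM// (ger0_norm (powR_ge0 _ _)) -powRrM mulNr mulrA.
by [].
Qed.

(** The middle of the plateau has length [2 N], and each of the two transitions has length one and
    costs at most [M], so the error stays bounded as [N] grows. *)
Lemma cutoff_energy rs (M N : R) (f : G -> R) : 0 <= N ->
  gmeas f -> (forall z, 0 <= f z) -> f 0 = 0 ->
  (forall (w : G) s, w != 0 -> f (dil s w) * expR s ^+ (n + 2) =
    weight p beta k w * `|ops rs (twist a (cutoff a N) w) s| `^ p) ->
  0 <= M ->
  (forall x : R, `|ops rs (plateau N) x| `^ p <=
    \prod_(b <- rs) `|b| `^ p * \1_(`[- N, N]%classic : set R) x
    + M * \1_(`[- N - 1, - N]%classic : set R) x + M * \1_(`[N, N + 1]%classic : set R) x) ->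
  (gintegral f <= (\prod_(b <- rs) `|b| `^ p * (2 * N) + 2 * M)%:E * kappa)%E.
Proof.
move=> N0 mf f0 f00 fray M0 HM.
set P := \prod_(b <- rs) _; have P0 : 0 <= P by apply: prodr_ge0 => b _; exact: powR_ge0.
have D0 : 0 <= P * (2 * N) + 2 * M by rewrite addr_ge0// mulr_ge0// mulr_ge0.
have [mF ->] := polar gmeas_rho mf f0 f00.
have e0 s : 0 <= expR s ^+ (n + 2) :> R by rewrite exprn_ge0 ?expR_ge0.
rewrite /kappa -ge0_integralZl_EFin//; last 2 first.
- by move=> z _; rewrite lee_fin ang_ge0.
- by apply/measurable_EFinP; exact: gmeas_ang.
apply: ge0_le_integral => //.
- by move=> z _; apply: integral_ge0 => s _; rewrite lee_fin !mulr_ge0 ?shell_ge0.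
- apply: measurable_funeM; apply/measurable_EFinP; exact: gmeas_ang.
move=> z _; have [s0|s0] := eqVneq (shell (pt z)) 0.
  rewrite /ang s0 mul0r mule0.
  by under eq_integral do rewrite mul0r; rewrite integral0.
have w0 : pt z != 0 by apply: contra_neq s0 => ->; rewrite /shell rho0 ltxx.
set w := pt z in w0 s0 *; set l := ln (rho w).
pose c := ang w; have c0 : 0 <= c by exact: ang_ge0.
have mI (A : set mR) : measurable A -> measurable_fun setT (fun s : mR => \1_A (s + l) : mR).
  move=> mA; have mi : measurable_fun setT (\1_A : mR -> mR) by exact: measurable_indic.
  apply: (measurableT_comp mi); apply: measurable_funD => //; exact: measurable_cst.
have I0 (A : set R) (x : R) : 0 <= \1_A x :> R by rewrite indicE.
have mcI (A : set mR) (q : R) : measurable A -> measurable_fun setT (fun s : mR => q * \1_A (s + l) : mR).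
  by move=> mA; apply: measurable_funM; [exact: measurable_cst|exact: mI].
pose A1 : set mR := `[- N, N]%classic; pose A2 : set mR := `[- N - 1, - N]%classic.
pose A3 : set mR := `[N, N + 1]%classic.
apply: (@le_trans _ _ (\int[leb]_s ((c * P) * \1_A1 (s + l) + (c * M) * \1_A2 (s + l) + (c * M) * \1_A3 (s + l))%:E)%E).
  apply: ge0_le_integral => //.
  - by move=> s _; rewrite lee_fin !mulr_ge0 ?shell_ge0.
  - apply/measurable_EFinP.
    have -> : (fun s => shell w * (f (dil s w) * expR s ^+ (n + 2))) =
        (fun s => c * `|ops rs (plateau N) (s + l)| `^ p).
      by apply/funext => s; rewrite fray// cutoff_ops// -/l /c /ang !mulrA.
    apply: measurable_funM; first exact: measurable_cst.
    apply: continuous_measurable_fun => s.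
    have So := smooth_shift l (smooth_on_ops rs (@smooth_plateau R N)).
    apply: (@continuous_comp _ _ _ (fun s => ops rs (plateau N) (s + l)) (fun x : R => `|x| `^ p)).
      exact: smooth_continuous So s.
    by apply: continuous_normr_powR; exact: ltW.
  - by apply/measurable_EFinP; apply: measurable_funD; [apply: measurable_funD|]; apply: mcI; exact: measurable_itv.
  - move=> s _; rewrite lee_fin fray// cutoff_ops// -/l.
    have -> : shell w * (weight p beta k w * rho w `^ (- (a * p)) * `|ops rs (plateau N) (s + l)| `^ p)
      = c * `|ops rs (plateau N) (s + l)| `^ p by rewrite /c /ang !mulrA.
    by apply: le_trans (ler_wpM2l c0 (HM _)) _; rewrite !mulrDr !mulrA.
under eq_integral do rewrite !EFinD.
have J (q : R) (A : set mR) : measurable A -> 0 <= q ->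
    (forall s, [set: mR] s -> (0 <= (q * \1_A (s + l))%:E)%E) /\
    measurable_fun setT (fun s : mR => (q * \1_A (s + l))%:E).
  move=> mA q0; split; first by move=> s _; rewrite lee_fin mulr_ge0.
  by apply/measurable_EFinP; exact: mcI.
have cP0 : 0 <= c * P by exact: mulr_ge0.
have cM0 : 0 <= c * M by exact: mulr_ge0.
have mA1 : measurable A1 by exact: measurable_itv.
have mA2 : measurable A2 by exact: measurable_itv.
have mA3 : measurable A3 by exact: measurable_itv.
have [J1 J1'] := J _ _ mA1 cP0; have [J2 J2'] := J _ _ mA2 cM0; have [J3 J3'] := J _ _ mA3 cM0.
rewrite ge0_integralD//; last 2 first.
- by move=> s _; rewrite adde_ge0 ?J1 ?J2.
- exact: emeasurable_funD.
have K1 : (\int[leb]_s ((c * P) * \1_A1 (s + l))%:E = ((c * P) * (N - - N))%:E)%E.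
  by apply: integral_indic_shift => //; lra.
have K2 : (\int[leb]_s ((c * M) * \1_A2 (s + l))%:E = ((c * M) * (- N - (- N - 1)))%:E)%E.
  by apply: integral_indic_shift => //; lra.
have K3 : (\int[leb]_s ((c * M) * \1_A3 (s + l))%:E = ((c * M) * (N + 1 - N))%:E)%E.
  by apply: integral_indic_shift => //; lra.
rewrite ge0_integralD// K1 K2 K3 -!EFinD -EFinM lee_fin -/c.
by rewrite le_eqVlt; apply/orP; left; apply/eqP; ring.
Qed.

End cutoff_energy.

Section sharpness.
Context {R : realType} {n : nat}.
Local Notation mR := (measurableTypeR R).
Local Notation leb := (@lebesgue_measure R).
Local Notation G := (grushin R n).
Local Notation pt := (@grushin_pt R n).
Variables (p beta : R) (k : nat).
Hypothesis p2 : 2 <= p.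
Hypothesis n1 : (1 <= n)%N.
Local Notation a := (@expo R n p beta k).
Local Notation ang := (@ang R n p beta k).
Local Notation kappa := (@kappa R n p beta k).

Let p0 : 0 < p. Proof. exact: lt_le_trans p2. Qed.

Lemma cutoff_hardy (N : R) : 0 <= N ->
  ((2 * N)%:E * kappa <= hardy_term p beta k (cutoff a N : G -> R))%E.
Proof.
move=> N0; pose u : G -> R := cutoff a N.
have nu : nice u by exact: cutoff_nice.
have u0 : u 0 = 0 by rewrite /u /cutoff eqxx.
have h0 z : 0 <= hardy_integrand p beta k u z by exact: hardy_integrand_ge0.
have e0 s : 0 <= expR s ^+ (n + 2) :> R by rewrite exprn_ge0 ?expR_ge0.
have mh : gmeas (hardy_integrand p beta k u) by exact: gmeas_hardy.
have h00 : hardy_integrand p beta k u 0 = 0 by exact: hardy_integrand0.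
have [mF E] := polar gmeas_rho mh h0 h00.
change ((2 * N)%:E * kappa <= gintegral (hardy_integrand p beta k u))%E.
have N20 : 0 <= 2 * N by rewrite mulr_ge0.
rewrite E /kappa -ge0_integralZl_EFin//; last 2 first.
- by move=> z _; rewrite lee_fin ang_ge0.
- by apply/measurable_EFinP; exact: gmeas_ang.
apply: ge0_le_integral => //.
- by move=> z _; rewrite mule_ge0// lee_fin ?ang_ge0.
- by apply: measurable_funeM; apply/measurable_EFinP; exact: gmeas_ang.
move=> z _; have [s0|s0] := eqVneq (shell (pt z)) 0.
  rewrite /ang s0 mul0r mule0.
  by apply: integral_ge0 => s _; rewrite lee_fin mul0r.
have w0 : pt z != 0 by apply: contra_neq s0 => ->; rewrite /shell rho0 ltxx.
set w := pt z in w0 s0 *; set l := ln (rho w).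
pose c := ang w; have c0 : 0 <= c by exact: ang_ge0.
pose A1 : set mR := `[- N, N]%classic.
have K1 : (\int[leb]_s (c * \1_A1 (s + l))%:E = (c * (N - - N))%:E)%E.
  by apply: integral_indic_shift => //; lra.
have -> : ((2 * N)%:E * (ang w)%:E = (c * (N - - N))%:E)%E.
  by rewrite -EFinM; congr EFin; rewrite /c; ring.
have fE s : shell w * (hardy_integrand p beta k u (dil s w) * expR s ^+ (n + 2)) =
    c * `|plateau N (s + l)| `^ p.
  rewrite (hardy_ray beta k p0 u s w0).
  have := @cutoff_ops R n p beta k [::] N w s w0; rewrite /ops /= => ->.
  by rewrite /c /ang !mulrA.
have mi : measurable_fun setT (fun s : mR => \1_A1 (s + l) : mR).
  have mi : measurable_fun setT (\1_A1 : mR -> mR) by apply: measurable_indic; exact: measurable_itv.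
  by apply: (measurableT_comp mi); apply: measurable_funD => //; exact: measurable_cst.
rewrite -K1; apply: ge0_le_integral => //.
- by move=> s _; rewrite lee_fin mulr_ge0// indicE.
- by apply/measurable_EFinP; apply: measurable_funM => //; exact: measurable_cst.
- apply/measurable_EFinP; rewrite (_ : (fun s => _) = (fun s => c * `|plateau N (s + l)| `^ p)); last first.
    by apply/funext => s; exact: fE.
  apply: measurable_funM; first exact: measurable_cst.
  apply: continuous_measurable_fun => s.
  have So := smooth_shift l (@smooth_plateau R N).
  apply: (@continuous_comp _ _ _ (fun s => plateau N (s + l)) (fun x : R => `|x| `^ p)).
    exact: smooth_continuous So s.
  by apply: continuous_normr_powR; exact: ltW.
- move=> s _; rewrite lee_fin fE; apply: ler_wpM2l => //.
  rewrite indicE; case: (boolP (_ \in _)) => [|_]; last exact: powR_ge0.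
  rewrite inE /A1 /= in_itv /= => sN; by rewrite plateau1// normr1 powR1.
Qed.

(** An admissible [c'] larger than the product [P] would satisfy [c' * (2 N) <= P * (2 N) + 2 M] for
    every [N >= 1], once [kappa] is cancelled. *)
Lemma sharp_constant (rs : seq R) (F : (G -> R) -> G -> R) :
  (forall u, nice u -> gmeas (F u)) -> (forall u z, 0 <= F u z) ->
  (forall u, u 0 = 0 -> F u 0 = 0) ->
  (forall u (w : G) s, nice u -> w != 0 -> F u (dil s w) * expR s ^+ (n + 2) =
    weight p beta k w * `|ops rs (twist a u w) s| `^ p) ->
  best_constant (fun u => gintegral (F u)) (@hardy_term R n p beta k)
    (\prod_(b <- rs) `|b| `^ p).
Proof.
move=> mF F0 F00 Fray c' H; set P := \prod_(b <- rs) _.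
have P0 : 0 <= P by apply: prodr_ge0 => b _; exact: powR_ge0.
rewrite leNgt; apply/negP => Pc.
have [M M0 HM] := plateau_bound rs p0.
(* The inequality forces [N (c' - P) <= M], while this [N] gives [N (c' - P) = M + (c' - P)]. *)
pose N := M / (c' - P) + 1.
have cP : 0 < c' - P by rewrite subr_gt0.
have N1 : 1 <= N by rewrite lerDr divr_ge0// ltW.
have N0 : 0 <= N by rewrite (le_trans ler01).
pose u : G -> R := cutoff a N.
have nu : nice u by exact: cutoff_nice.
have u0 : u 0 = 0 by rewrite /u /cutoff eqxx.
have tu : test_function u by exact: cutoff_test.
have HE := cutoff_energy p2 N0 (mF u nu) (F0 u) (F00 u u0) (fun w s w0 => Fray u w s nu w0) M0
  (fun x => HM N x N1).
have HH := cutoff_hardy N0.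
have := H u tu.
have hf := hardy_fin beta k p2 tu; have kf := @kappa_fin R n p beta k p2.
have k0 := @kappa_gt0 R n p beta k p2 n1.
rewrite -/u -/P in HE HH.
move: HE HH k0; rewrite -(fineK kf) -(fineK hf).
set h := fine (hardy_term _ _ _ _); set q := fine kappa.
rewrite -!EFinM lee_fin lte_fin => HE HH q0.
rewrite sube_ge0 ?orbT//; move=> /le_trans /(_ HE); rewrite lee_fin => HC.
have c0 : 0 <= c' by rewrite (le_trans P0)// ltW.
have : c' * (2 * N * q) <= (P * (2 * N) + 2 * M) * q.
  by apply: le_trans HC; apply: ler_wpM2l.
rewrite mulrA ler_pM2r// => HQ.
have E : M = (N - 1) * (c' - P) by rewrite /N addrK divfK// gt_eqF.
by nra.
Qed.

End sharpness.

Section integrands.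
Context {R : realType} {n : nat}.
Local Notation G := (grushin R n).
Implicit Types (u : G -> R) (z : G).
Variables (p beta : R) (l : nat).
Hypothesis p0 : 0 < p.

Lemma even_integrand_ge0 u z : 0 <= even_integrand p beta l u z.
Proof. by rewrite divr_ge0 ?mulr_ge0 ?powR_ge0. Qed.

Lemma odd_integrand_ge0 u z : 0 <= odd_integrand p beta l u z.
Proof. by rewrite divr_ge0 ?mulr_ge0 ?powR_ge0. Qed.

Lemma gmeas_psi : gmeas (@psi R n).
Proof. by apply: gmeas_smooth; exact: smooth_psi. Qed.

Lemma gmeas_even u : nice u -> gmeas (even_integrand p beta l u).
Proof.
move=> nu; apply: gmeasM.
  by apply: gmeas_powR; apply: gmeas_norm; apply: nice_gmeas; exact: nice_iter.
apply: gmeasV => [z|]; first by rewrite mulr_ge0 ?powR_ge0.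
apply: gmeasM; apply: gmeas_powR; first exact: gmeas_grad_norm.
exact: gmeas_rho.
Qed.

Lemma gmeas_odd u : nice u -> gmeas (odd_integrand p beta l u).
Proof.
move=> nu; apply: gmeasM.
  apply: gmeas_powR; apply: gmeasM.
    have -> : (fun z => Num.sqrt (psi z)) = (fun z : G => psi z `^ 2^-1).
      by apply/funext => z; rewrite powR12_sqrt// psi_ge0.
    by apply: gmeas_powR; exact: gmeas_psi.
  by apply: gmeas_norm; apply: nice_gmeas; apply: nice_drho; exact: nice_iter.
apply: gmeasV => [z|]; first by rewrite mulr_ge0 ?powR_ge0.
apply: gmeasM; apply: gmeas_powR; first exact: gmeas_grad_norm.
exact: gmeas_rho.
Qed.

(** With division by zero read as 0, [psi] vanishes at the origin. This makes the energy integrands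
    0 there, as [polar] demands, whatever the derivatives are at that point. *)
Lemma psi0 : psi (0 : G) = 0.
Proof. by rewrite /psi rho0 expr0n invr0 mulr0. Qed.

Lemma even_integrand0 u : (0 < l)%N -> even_integrand p beta l u 0 = 0.
Proof.
case: l => // m _; rewrite /even_integrand iterS {1}/radial_lap psi0 mul0r normr0.
by rewrite powR0 ?gt_eqF// mul0r.
Qed.

Lemma odd_integrand0 u : odd_integrand p beta l u 0 = 0.
Proof. by rewrite /odd_integrand /radial_grad_norm psi0 sqrtr0 mul0r powR0 ?gt_eqF// mul0r. Qed.

End integrands.

(** * Roots, sharp constants and a gap uniform in the dimension *)

Section constants.
Context {R : realType}.

(* Each root of the ray operators is an affine function of [n] with nonzero
   slope, so its nonzero values stay away from zero. *)
Lemma affine_gap (c e : R) : c != 0 ->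
  exists2 d : R, 0 < d & forall n : nat, c * n%:R + e != 0 -> d <= `|c * n%:R + e|.
Proof.
move=> c0; have c1 : 0 < `|c| by rewrite normr_gt0.
(* For [n > (|c| + |e|) / |c|] the slope dominates: [|c n + e| >= |c| n - |e| > |c|]. Only finitely
   many [n] remain. *)
have [N HN] : exists N : nat, forall n, (N <= n)%N -> `|c| <= `|c * n%:R + e|.
  pose x := (`|c| + `|e|) / `|c|; exists (Num.truncn x).+1 => n Nn.
  have xn : x < n%:R by rewrite (lt_le_trans (truncnS_gt x))// ler_nat.
  have : `|c| + `|e| < `|c| * n%:R by rewrite mulrC -ltr_pdivrMr.
  have := lerB_normD (c * n%:R) e; rewrite normrM [`|n%:R|]ger0_norm//.
  by lra.
have [d d0 Hd] : exists2 d : R, 0 < d & forall n : nat, (n < N)%N ->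
    c * n%:R + e != 0 -> d <= `|c * n%:R + e|.
  elim: N {HN} => [|N [d d0 IH]]; first by exists 1.
  have [z|nz] := eqVneq (c * N%:R + e) 0.
    exists d => // n; rewrite ltnS leq_eqVlt => /orP[/eqP->|]; last exact: IH.
    by rewrite z eqxx.
  exists (Num.min d `|c * N%:R + e|); first by rewrite lt_min d0 normr_gt0.
  move=> n; rewrite ltnS leq_eqVlt => /orP[/eqP-> _|nN h]; first by rewrite ge_min lexx orbT.
  by rewrite ge_min IH.
exists (Num.min d `|c|); first by rewrite lt_min d0.
move=> n h; have [nN|nN] := ltnP n N; first by rewrite ge_min Hd.
by rewrite ge_min HN ?orbT.
Qed.

Lemma affine_gap_family m (c e : nat -> R) : (forall j, c j != 0) ->
  exists2 d : R, 0 < d & forall j n : nat, (j < m)%N ->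
    c j * n%:R + e j != 0 -> d <= `|c j * n%:R + e j|.
Proof.
move=> c0; elim: m => [|m [d d0 IH]]; first by exists 1.
have [d' d'0 H] := affine_gap (e m) (c0 m).
exists (Num.min d d'); first by rewrite lt_min d0.
move=> j n; rewrite ltnS leq_eqVlt => /orP[/eqP-> h|jm h]; rewrite ge_min.
  by rewrite H ?orbT.
by rewrite IH.
Qed.

End constants.

Section roots.
Context {R : realType} {n : nat}.
Local Notation Q := (hdim R n).
Variables (p beta : R) (k : nat).
Hypothesis p0 : 0 < p.
Local Notation a := (@expo R n p beta k).
Local Notation roots := (@roots R n).

Lemma mem_roots (x b : R) l : b \in roots x l ->
  exists2 j, (j < l)%N & b = x + 2 * j%:R + 2 - Q \/ b = x + 2 * j%:R.
Proof.
elim: l => // l IH; rewrite /= !inE => /or3P[/eqP->|/eqP->|/IH[j jl H]].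
- by exists l => //; left.
- by exists l => //; right.
- by exists j => //; exact: ltnW.
Qed.

(** For [x > 0] the roots [x + 2 j] are positive, and the roots [x + 2 j + 2 - Q] increase strictly
    with [j], so at most one of them is 0. *)
Lemma count_roots0 (x : R) (l : nat) : 0 < x -> (count_mem (0%R : R) (roots x l) <= 1)%N.
Proof.
move=> x0; elim: l => // l IH.
have xl (j : nat) : 0 <= 2 * j%:R :> R by rewrite mulr_ge0.
have h : (x + 2 * l%:R == 0) = false by rewrite gt_eqF// ltr_wpDr.
rewrite /= h add0n; have [e|_] := eqVneq; last by rewrite add0n.
suff /count_memPn -> : 0 \notin roots x l by [].
apply/negP => /mem_roots[j jl [H|H]]; last by have := xl j; lra.
have : j%:R < l%:R :> R by rewrite ltr_nat.
by lra.
Qed.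

(** One radial Laplacian accounts for one factor [Lambda]. With [k' = k - 2 j] one has
    [p (a + 2 j) = Q - beta - k' p] and [p (Q - 2 - a - 2 j) = Q (p - 1) + beta + (k' - 2) p]. *)
Lemma Lambda_roots j : (2 * j + 2 <= k)%N ->
  Lambda R n p beta (k - 2 * j) = `|a + 2 * j%:R + 2 - Q| `^ p * `|a + 2 * j%:R| `^ p.
Proof.
move=> jk; have pn0 : p != 0 by rewrite gt_eqF.
rewrite /Lambda ifF; last by by apply/eqP => E; lia.
have -> : (k - 2 * j)%:R = k%:R - 2 * j%:R :> R by rewrite natrB ?natrM//; lia.
rewrite -powRM// -normrM -[in RHS]normrN; congr (`|_| `^ p).
by rewrite /expo; field.
Qed.

Lemma Lambda1_root l : k = (2 * l + 1)%N -> Lambda R n p beta 1 = `|a + 2 * l%:R| `^ p.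
Proof.
move=> kl; have pn0 : p != 0 by rewrite gt_eqF.
by rewrite /Lambda eqxx /expo kl natrD natrM; congr (`|_| `^ p); field.
Qed.

Lemma prod_roots (x : R) l : \prod_(b <- roots x l) `|b| `^ p =
  \prod_(0 <= j < l) (`|x + 2 * j%:R + 2 - Q| `^ p * `|x + 2 * j%:R| `^ p).
Proof.
elim: l => [|l IH]; first by rewrite big_nil big_geq.
by rewrite big_nat_recr//= !big_cons IH mulrA mulrC.
Qed.

Lemma Cst_even l : k = (2 * l)%N -> Cst R n p beta k = \prod_(b <- roots a l) `|b| `^ p.
Proof.
move=> kl; rewrite /Cst {1}kl oddM /= prod_roots kl mul2n doubleK big_add1 /= big_nat_rev /= -mul2n -kl.
apply: eq_big_nat => j /andP[_ jl]; rewrite add0n -Lambda_roots; last by lia.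
by congr (Lambda R n p beta _); lia.
Qed.

Lemma Cst_odd l : k = (2 * l + 1)%N ->
  Cst R n p beta k = \prod_(b <- a + 2 * l%:R :: roots a l) `|b| `^ p.
Proof.
move=> kl; have ok : odd k by rewrite kl oddD oddM.
have hk : k./2 = l by lia.
rewrite /Cst ok hk big_nat_recl// muln0 add0n (Lambda1_root kl) big_cons prod_roots; congr (_ * _).
rewrite big_nat_rev /=; apply: eq_big_nat => j /andP[_ jl].
rewrite add0n -Lambda_roots; last by lia.
by congr (Lambda R n p beta _); lia.
Qed.

Lemma notin0_of_prod (rs : seq R) : \prod_(b <- rs) `|b| `^ p != 0 -> 0 \notin rs.
Proof.
rewrite prodf_seq_neq0 => /allP H; apply/negP => /H /=.
by rewrite normr0 powR0 ?eqxx// gt_eqF.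
Qed.

End roots.

(** With [hdim R n = n + 2] the two families of roots are affine in [n] with slopes [1 / p - 1] and
    [1 / p], and [p >= 2] keeps both away from 0. The range [j <= k] also covers the additional root
    [a + 2 l] of the odd case. *)
Lemma roots_gap {R : realType} (p beta : R) (k : nat) : 2 <= p ->
  exists2 d : R, 0 < d <= 1 & forall (n j : nat) (b : R), (j <= k)%N ->
    let a := @expo R n p beta k in
    b = a + 2 * j%:R + 2 - hdim R n \/ b = a + 2 * j%:R -> b != 0 -> d <= `|b|.
Proof.
move=> p2; have pn0 : p != 0 by rewrite gt_eqF//; lra.
have c1 : p^-1 != 0 by rewrite invr_eq0.
have c2 : p^-1 - 1 != 0.
  by rewrite subr_eq0 invr_eq1 gt_eqF//; lra.
pose e := (2 - k%:R * p - beta) / p.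
have [d1 d10 H1] := @affine_gap_family R k.+1 (fun=> p^-1) (fun j => e + 2 * j%:R) (fun=> c1).
have [d2 d20 H2] := @affine_gap_family R k.+1 (fun=> p^-1 - 1) (fun j => e + 2 * j%:R) (fun=> c2).
exists (Num.min 1 (Num.min d1 d2)); first by rewrite !lt_min ltr01 d10 d20 ge_min lexx.
move=> n j b jk /= [->|->].
  have -> : @expo R n p beta k + 2 * j%:R + 2 - hdim R n = (p^-1 - 1) * n%:R + (e + 2 * j%:R).
    by rewrite /expo /hdim /e natrD; field.
  by move=> h; rewrite !ge_min H2 ?orbT.
have -> : @expo R n p beta k + 2 * j%:R = p^-1 * n%:R + (e + 2 * j%:R).
  by rewrite /expo /hdim /e natrD; field.
by move=> h; rewrite !ge_min H1 ?orbT.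
Qed.

Theorem theorem1p3 (R : realType) (k : nat) (p beta : R)
    (hk : (2 <= k)%N) (hp : 2 <= p) :
  exists C : R, 0 < C /\
  forall n : nat, (1 <= n)%N -> (k < n + 2)%N -> p < hdim R n / k%:R ->
    (forall l : nat, (1 <= l)%N -> k = (2 * l)%N ->
       - (2 * l%:R - 2) * p - hdim R n * (p - 1) < beta ->
       beta < hdim R n - 2 * l%:R * p ->
       ((2 < p -> Cst R n p beta k != 0) ->
        forall u : grushin R n -> R, test_function u ->
          (C%:E * sup_dist2 p beta k u
             <= even_energy p beta l u - (Cst R n p beta k)%:E * hardy_term p beta k u)%E)
       /\ best_constant (@even_energy R n p beta l) (@hardy_term R n p beta k)
            (Cst R n p beta k))
    /\
    (forall l : nat, (1 <= l)%N -> k = (2 * l + 1)%N ->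
       - (2 * l%:R - 1) * p - hdim R n * (p - 1) < beta ->
       beta < hdim R n - (2 * l%:R + 1) * p ->
       ((2 < p -> Cst R n p beta k != 0) ->
        forall u : grushin R n -> R, test_function u ->
          (C%:E * sup_dist2 p beta k u
             <= odd_energy p beta l u - (Cst R n p beta k)%:E * hardy_term p beta k u)%E)
       /\ best_constant (@odd_energy R n p beta l) (@hardy_term R n p beta k)
            (Cst R n p beta k)).
Proof.
have p0 : 0 < p by rewrite (lt_le_trans _ hp).
have [d d01 Hd] := roots_gap beta k hp.
have d0 : 0 < d by case/andP: d01.
(* In both parities the list of roots has length exactly [k]: two per radial Laplacian, and one more
   for the radial gradient. *)
exists (d `^ p ^+ k / (2 * p)); split.
  by rewrite divr_gt0 ?exprn_gt0 ?powR_gt0// mulr_gt0.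
move=> n n1 _ _; set a := @expo R n p beta k.
(* The upper bound on [beta] is the positivity of [a], which keeps all roots [a + 2 j] positive and
   leaves at most one zero among the others. *)
have a0 : beta < hdim R n - k%:R * p -> 0 < a.
  by move=> H; rewrite divr_gt0//; lra.
split=> l l1 kl _.
  move=> bk; have kR : k%:R = 2 * l%:R :> R by rewrite kl natrM.
  have {}a0 : 0 < a by apply: a0; rewrite kR.
  have CE := @Cst_even R n p beta k p0 l kl.
  split=> [C0 u tu|]; last first.
    rewrite CE; apply: sharp_constant => //.
    + by move=> u; exact: gmeas_even.
    + by move=> u z; exact: even_integrand_ge0.
    + by move=> u _; exact: even_integrand0.
    + by move=> u w s; exact: even_ray.
  have nu := test_function_nice tu.
  rewrite CE {1}(_ : k = size (@roots R n a l)); last by rewrite size_roots.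
  apply: energy_ineq => //.
  + exact: gmeas_even.
  + by move=> z; exact: even_integrand_ge0.
  + exact: even_integrand0.
  + by move=> w s; exact: even_ray.
  + by rewrite -size_eq0 size_roots; lia.
  + by move=> b /mem_roots[j jl]; apply: Hd; lia.
  + exact: count_roots0.
  + by move=> /C0; rewrite CE; exact: notin0_of_prod.
move=> bk; have kR : k%:R = 2 * l%:R + 1 :> R by rewrite kl natrD natrM.
have {}a0 : 0 < a by apply: a0; rewrite kR.
have CE := @Cst_odd R n p beta k p0 l kl.
split=> [C0 u tu|]; last first.
  rewrite CE; apply: sharp_constant => //.
  + by move=> u; exact: gmeas_odd.
  + by move=> u z; exact: odd_integrand_ge0.
  + by move=> u _; exact: odd_integrand0.
  + by move=> u w s; exact: odd_ray.
have nu := test_function_nice tu.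
rewrite CE {1}(_ : k = size (a + 2 * l%:R :: @roots R n a l)); last by rewrite /= size_roots; lia.
apply: energy_ineq => //.
+ exact: gmeas_odd.
+ by move=> z; exact: odd_integrand_ge0.
+ exact: odd_integrand0.
+ by move=> w s; exact: odd_ray.
+ move=> b; rewrite inE => /orP[/eqP bE|/mem_roots[j jl]]; last by apply: Hd; lia.
  by apply: (Hd n l); [lia|right].
+ have al : (a + 2 * l%:R == 0) = false by rewrite gt_eqF// ltr_wpDr// mulr_ge0.
  by rewrite /= al; exact: count_roots0.
+ by move=> /C0; rewrite CE; exact: notin0_of_prod.
Qed.
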